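(* Let $k\ge 1$ be an integer. There is a constant $c>0$, independent of the mesh size $h$ and of the viscosity $\nu$, such that for every $\mathbf v_h\in \mathbf V_h^k$ $$\sup_{(\underline{\boldsymbol\tau}_h,q_h)\in\underline{\boldsymbol\Sigma}_h^{k-1}\times Q_h^{k-1},\ (\underline{\boldsymbol\tau}_h,q_h)\neq 0}\ \frac{b_1(\mathbf v_h,q_h)+b_2(\underline{\boldsymbol\tau}_h,\mathbf v_h)}{\|\underline{\boldsymbol\tau}_h\|_{\Sigma_h}+\|q_h\|_{Q_h}}\ \ge\ c\,\|\mathbf v_h\|_{\mathbf V_h}.$$
   Context: Domain and meshes. $\Omega\subset\mathbb R^2$ is an open bounded (polygonal) Lipschitz domain with boundary $\Gamma$. $\{\mathcal T_h\}$ is a family of conforming, shape-regular, quasi-uniform triangulations of $\Omega$, $h=\max_{K\in\mathcal T_h}h_K$, and $\mathcal F_h$ is the set of edges of $\mathcal T_h$. Clough--Tocher split: for a triangle $K\in\mathcal T_h$ with vertices $\mathbf a_1,\mathbf a_2,\mathbf a_3$ and barycenter $\mathbf b_K$, set $K_i=\operatorname{conv}\{\mathbf b_K,\mathbf a_j,\mathbf a_l\}$, $\{i,j,l\}=\{1,2,3\}$; $\mathcal C_h$ is the submesh formed by all $K_i$, $K\in\mathcal T_h$, $i=1,2,3$. Constants may depend on $k$, $\Omega$ and the shape-regularity and quasi-uniformity constants, but not on $h$ or $\nu$. Notation. $\mathbb S$ is the space of symmetric $2\times2$ matrices. For an edge $F\in\mathcal F_h$, $\mathbf n=(n_1,n_2)$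 is a fixed unit normal (outward to $\Omega$ if $F\subset\Gamma$) and $\mathbf t=(n_2,-n_1)$; for a vector field $\mathbf v_n=\mathbf v\cdot\mathbf n$, $\mathbf v_t=\mathbf v\cdot\mathbf t$; for a matrix field $\underline{\boldsymbol\tau}_{nt}=\mathbf t^T\underline{\boldsymbol\tau}\,\mathbf n$. The jump $[\![\cdot]\!]$ on an interior edge is the value from the side out of which $\mathbf n$ points minus the value from the other side (with $\mathbf n,\mathbf t$ fixed); on boundary edges it is the identity. $\underline{\boldsymbol\varepsilon}(\mathbf v)=\frac12(\nabla\mathbf v+(\nabla\mathbf v)^T)$ (elementwise). $\mathbb P_k(\mathcal T_h,X)$, $\mathbb P_k(\mathcal C_h,X)$ are the spaces of discontinuous piecewise polynomials of degree at most $k$ with values in $X$. Spaces. $\underline{\boldsymbol\Sigma}_h^{k-1}=\{\underline{\boldsymbol\tau}_h\in\mathbb P_{k-1}(\mathcal C_h,\mathbb S): \operatorname{tr}\underline{\boldsymbol\tau}_h=0,\ [\![(\underline{\boldsymbol\tau}_h)_{nt}]\!]_F=0 \text{ for all interior } F\in\mathcal F_h\}$ (no continuity across the edges of $\mathcal C_h$ interior to the elements of $\mathcal T_h$); $\mathbf V_h^k=\{\mathbf v_h\in\mathbb P_k(\mathcal T_h,\mathbb R^2): [\![(\mathbf v_h)_n]\!]_F=0\ \forall F\in\mathcal F_h\}$ (so $\mathbf v_h\cdot\mathbf n=0$ on $\Gamma$); $Q_h^{k-1}=\{q_h\in\mathbb P_{k-1}(\mathcal T_h,\mathbb R):\int_\Omega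 q_h=0\}$. Bilinear forms. $b_1(\mathbf v,q)=\int_\Omega \operatorname{div}\mathbf v\;q\,dx$ and $b_2(\underline{\boldsymbol\tau},\mathbf v)=-\sum_{K\in\mathcal T_h}\sum_{i=1}^3\int_{K_i}\underline{\boldsymbol\tau}:\underline{\boldsymbol\varepsilon}(\mathbf v)\,dx+\sum_{F\in\mathcal F_h}\int_F\underline{\boldsymbol\tau}_{nt}[\![\mathbf v_t]\!]\,ds.$ Norms. $\|\underline{\boldsymbol\tau}_h\|_{\Sigma_h}=\|\underline{\boldsymbol\tau}_h\|_{L^2(\Omega)}$, $\|q_h\|_{Q_h}=\|q_h\|_{L^2(\Omega)}$, $\|\mathbf v_h\|_{\mathbf V_h}^2=\sum_{K\in\mathcal T_h}\|\underline{\boldsymbol\varepsilon}(\mathbf v_h)\|_{L^2(K)}^2+\sum_{F\in\mathcal F_h}\frac1h\|[\![(\mathbf v_h)_t]\!]\|_{L^2(F)}^2$. *)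

(* Defs.v *)
From HB Require Import structures.
From mathcomp Require Export all_boot all_order all_algebra.
From mathcomp Require Export all_classical all_reals all_analysis.

Set Implicit Arguments.
Unset Strict Implicit.
Unset Printing Implicit Defensive.

Export Order.TTheory GRing.Theory Num.Theory.
Export numFieldNormedType.Exports.

Local Open Scope classical_set_scope.
Local Open Scope ring_scope.

(* Points and vectors of the plane are pairs, the type that carries the product
   Lebesgue measure. The library norm on pairs is the maximum norm: it is used
   for topology only, all lengths below are Euclidean. *)
Section plane.
Context {R : realType}.
Implicit Types (p q : R * R) (A : set (R * R)).

Definition dot p q : R := p.1 * q.1 + p.2 * q.2.

Definition enorm p : R := Num.sqrt (dot p p).

Definition component (i : 'I_2) p : R := if i == ord0 then p.1 else p.2.

Definition unit_vec (i : 'I_2) : R * R := if i == ord0 then (1, 0) else (0, 1).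

Definition tangent (n : R * R) : R * R := (n.2, - n.1).

Definition mxact (A : 'M[R]_2) p : R * R :=
  (A ord0 ord0 * p.1 + A ord0 ord_max * p.2,
   A ord_max ord0 * p.1 + A ord_max ord_max * p.2).

Definition frob (A B : 'M[R]_2) : R := \sum_i \sum_j A i j * B i j.

Definition grad (v : R * R -> R * R) p : 'M[R]_2 :=
  \matrix_(i, j) 'D_(unit_vec j) (fun x => component i (v x)) p.

Definition eps (v : R * R -> R * R) p : 'M[R]_2 :=
  2^-1 *: (grad v p + (grad v p)^T).

Definition dive (v : R * R -> R * R) p : R := \tr (grad v p).

Definition area_int A (f : R * R -> R) : R :=
  Rintegral (@lebesgue_measure R \x @lebesgue_measure R)%E A f.

(* line integral with respect to arc length along the segment [p, q] *)
Definition seg_int p q (f : R * R -> R) : R :=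
  enorm (q - p) *
  Rintegral (@lebesgue_measure R) `[0, 1] (fun s => f ((1 - s) *: p + s *: q)).

(* closed convex hull of finitely many points *)
Definition conv (s : seq (R * R)) : set (R * R) :=
  [set p | exists l : 'I_(size s) -> R,
    [/\ forall i, 0 <= l i, \sum_i l i = 1 & p = \sum_i l i *: s`_i]].

Definition diam A : R := sup [set d | exists p q, [/\ A p, A q & d = enorm (p - q)]].

(* diameter of the largest disc contained in A *)
Definition indiam A : R :=
  sup [set d | exists c r, [/\ 0 <= r, d = 2 * r &
                 [set p | enorm (p - c) <= r] `<=` A]].

Definition is_poly (d : nat) (f : R * R -> R) : Prop :=
  exists c : nat -> nat -> R, forall p,
    f p = \sum_(i < d.+1) \sum_(j < d.+1 | (i + j <= d)%N)
            c i j * p.1 ^+ i * p.2 ^+ j.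

Definition boundary A : set (R * R) := closure A `\` interior A.

Definition domain A : Prop := [/\ A !=set0, open A & connected A].

(* near each boundary point and in suitable Cartesian coordinates, A is the
   strict epigraph of a Lipschitz function *)
Definition lipschitz_boundary A : Prop :=
  forall z, boundary A z ->
  exists (e1 e2 : R * R) (r s : R) (phi : R -> R),
    [/\ [/\ dot e1 e1 = 1, dot e2 e2 = 1 & dot e1 e2 = 0],
        0 < r, 0 < s, lipschitz phi &
        forall a b, `|a| < r -> `|b| < s ->
          (A (z + a *: e1 + b *: e2) <-> phi a < b)].

Definition polygonal A : Prop :=
  exists s : seq ((R * R) * (R * R)),
    boundary A = \bigcup_(e in [set` s]) conv [:: e.1; e.2].

End plane.

Record mesh (R : realType) := Mesh {
  node : finType;
  elt : finType;
  coord : node -> R * R;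
  vert : elt -> 'I_3 -> node }.

(* (K, i) names the Clough--Tocher subtriangle K_i, and also the edge of K
   opposite to its vertex number i, which is the outer edge of K_i *)
Notation sub_elt Th := (elt Th * 'I_3)%type.

Section mesh.
Context {R : realType}.
Variable Th : mesh R.
Implicit Types (K : elt Th) (i : 'I_3) (s : sub_elt Th) (F : {set node Th}).

Definition apex K i : R * R := coord (vert K i).

Definition cell K : set (R * R) := conv [seq apex K i | i <- enum 'I_3].

Definition bary K : R * R := 3%:R^-1 *: \sum_(i < 3) apex K i.

Definition sub_cell s : set (R * R) :=
  conv (bary s.1 :: [seq apex s.1 j | j <- enum 'I_3 & j != s.2]).

Definition hull F : set (R * R) := conv [seq coord z | z in F].

Definition outer_edge s : {set node Th} :=
  [set vert s.1 j | j in [set~ s.2]]%SET.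

Definition edges : {set {set node Th}} :=
  [set outer_edge s | s : sub_elt Th]%SET.

Definition noncollinear (a b c : R * R) : Prop :=
  (b.1 - a.1) * (c.2 - a.2) - (c.1 - a.1) * (b.2 - a.2) != 0.

Definition verts K : {set node Th} := [set vert K i | i : 'I_3]%SET.

Definition triangulation (Omega : set (R * R)) : Prop :=
  [/\ injective (@coord R Th), injective verts,
      forall K, noncollinear (apex K 0) (apex K 1) (apex K 2%:R),
      forall K K', cell K `&` cell K' = hull (verts K :&: verts K') &
      closure Omega = \bigcup_(K in [set: elt Th]) cell K].

Definition mesh_size : R := \big[Num.max/0]_(K : elt Th) diam (cell K).

Definition shape_regular (sigma : R) : Prop :=
  forall K, diam (cell K) <= sigma * indiam (cell K).

Definition quasi_uniform (rho : R) : Prop :=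
  forall K, mesh_size <= rho * diam (cell K).

Definition boundary_edge (Omega : set (R * R)) F : Prop :=
  F \in edges /\ hull F `<=` boundary Omega.

Definition interior_edge (Omega : set (R * R)) F : Prop :=
  F \in edges /\ ~ (hull F `<=` boundary Omega).

(* the normal n points out of the element s.1 across the edge s *)
Definition outward (n : R * R) s : bool :=
  [forall j in [set~ s.2]%SET, dot n (apex s.1 s.2 - apex s.1 j) < 0].

Definition edge_normal (Omega : set (R * R)) (n : {set node Th} -> R * R) : Prop :=
  (forall F, F \in edges ->
     enorm (n F) = 1 /\
     forall y z, y \in F -> z \in F -> dot (n F) (coord y - coord z) = 0) /\
  (forall s, boundary_edge Omega (outer_edge s) -> outward (n (outer_edge s)) s).

Definition edge_int F (f : R * R -> R) : R :=
  if enum F is [:: y; z] then seg_int (coord y) (coord z) f else 0.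

Section fields.
Variable n : {set node Th} -> R * R.

(* One-sided traces on F of a broken field w, from the side out of which n
   points and from the other side. In a conforming mesh each sum has at most
   one term; on a boundary edge the second one is empty, so that the jump there
   is the identity. *)
Definition trace_out F (w : sub_elt Th -> R * R -> R) (p : R * R) : R :=
  \sum_(s | (outer_edge s == F) && outward (n F) s) w s p.

Definition trace_in F (w : sub_elt Th -> R * R -> R) (p : R * R) : R :=
  \sum_(s | (outer_edge s == F) && ~~ outward (n F) s) w s p.

Definition jump F (w : sub_elt Th -> R * R -> R) (p : R * R) : R :=
  trace_out F w p - trace_in F w p.

(* Broken fields: one polynomial, defined on the whole plane, per (sub)element. *)
Implicit Types (tau : sub_elt Th -> R * R -> 'M[R]_2)
  (v : elt Th -> R * R -> R * R) (q : elt Th -> R * R -> R).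

Definition comp_nt F tau s (p : R * R) : R :=
  dot (tangent (n F)) (mxact (tau s p) (n F)).

Definition comp_n F v s (p : R * R) : R := dot (v s.1 p) (n F).

Definition comp_t F v s (p : R * R) : R := dot (v s.1 p) (tangent (n F)).

Definition Sigma_h (Omega : set (R * R)) (d : nat) tau : Prop :=
  [/\ forall s (i j : 'I_2), is_poly d (fun p => tau s p i j),
      forall s p, (tau s p)^T = tau s p,
      forall s p, \tr (tau s p) = 0 &
      forall F, interior_edge Omega F ->
        forall p, hull F p -> jump F (comp_nt F tau) p = 0].

Definition V_h (d : nat) v : Prop :=
  (forall K (i : 'I_2), is_poly d (fun p => component i (v K p))) /\
  (forall F, F \in edges -> forall p, hull F p -> jump F (comp_n F v) p = 0).

Definition Q_h (d : nat) q : Prop :=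
  (forall K, is_poly d (q K)) /\ \sum_K area_int (cell K) (q K) = 0.

Definition b1 v q : R :=
  \sum_K area_int (cell K) (fun p => dive (v K) p * q K p).

(* tau_nt is single valued on interior edges for tau in Sigma_h *)
Definition b2 tau v : R :=
  - (\sum_K \sum_(i < 3)
       area_int (sub_cell (K, i)) (fun p => frob (tau (K, i) p) (eps (v K) p)))
  + \sum_(F in edges)
      edge_int F (fun p => trace_out F (comp_nt F tau) p * jump F (comp_t F v) p).

Definition norm_Sigma tau : R :=
  Num.sqrt (\sum_s area_int (sub_cell s) (fun p => frob (tau s p) (tau s p))).

Definition norm_Q q : R :=
  Num.sqrt (\sum_K area_int (cell K) (fun p => q K p ^+ 2)).

Definition norm_V v : R :=
  Num.sqrt
    (\sum_K area_int (cell K) (fun p => frob (eps (v K) p) (eps (v K) p))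
     + \sum_(F in edges)
         mesh_size^-1 * edge_int F (fun p => jump F (comp_t F v) p ^+ 2)).

End fields.
End mesh.

(* Main.v *)
(* The test pair is q = div v and, on the subtriangle K_i with outer edge F,
     tau = delta h^-1 m_F (t n^T + n t^T) - ((t t^T - n n^T) : eps v) (t t^T - n n^T),
   where m_F is the mean over F of the tangential jump of v.

   The last term of tau yields the squared norm of (t t^T - n n^T) : eps v on
   each K_i. The three edge directions of K are quantitatively independent after
   doubling of the angles, so the three numbers (t t^T - n n^T) : e control the
   deviator of a symmetric matrix e, and a polynomial on K is controlled by its
   restriction to any K_i: together with div v this controls eps v in L^2.

   The constant m_F suffices for the jumps: the tangential derivative of v_t along
   an edge is t^T eps(v) t, so the jump minus its mean is controlled by eps v. The
   cross term of m_F with eps v is absorbed by taking delta small.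

   The inverse inequalities come from a square inside K_i of side comparable to h:
   Lagrange interpolation bounds a polynomial in one variable on a long interval by
   its L^2 norm on a short one, and Fubini extends this to two variables.

   q has mean zero by the divergence theorem on each triangle, the normal
   component of v being continuous across the edges. *)
Require Import Defs.
From mathcomp Require Import unstable measurable_realfun zify ring lra.

Local Open Scope classical_set_scope.
Local Open Scope ring_scope.

Set Implicit Arguments.
Unset Strict Implicit.
Unset Printing Implicit Defensive.

(** * Polynomials in the plane *)

Section Polynomials.
Context {R : realType}.
Implicit Types (f g : R * R -> R) (p u : R * R).
Local Notation mu := (@lebesgue_measure R).

(** The shape of tau is dictated by the continuity of its nt component. That component must be
    single valued on F and of degree k - 1, whereas the tangential jump of v has degree k: only a
    projection such as the mean m_F is admissible. The matrix t t^T - n n^T has no nt component for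
    the normal n, so its coefficient may be any polynomial of degree k - 1 and may differ on the two
    sides of F. Since each K_i has exactly one outer edge and no continuity is asked inside K, the
    three normals of K are used independently of each other. The estimates are expressed by four
    sums: the strain energy E, the part D of the divergence, the part B of (t t^T - n n^T) : eps v
    on the K_i, and the energy J of the mean jumps. With S the norm of the test pair and N that of
    v, the forms are at least beta (E + J), while S^2 and N^2 are at most multiples of E + J; then 2
    N S <= N^2 + S^2 concludes. A real quotient with zero denominator is 0. Hence S must be shown
    positive when N is not 0, and when N = 0 another nonzero pair is needed, because the supremum
    excludes the zero pair. *)

Lemma is_poly_ind (d : nat) (P : (R * R -> R) -> Prop) :
  P (fun=> 0) -> (forall f g, P f -> P g -> P (fun p => f p + g p)) ->
  (forall c i j, (i + j <= d)%N -> P (fun p => c * p.1 ^+ i * p.2 ^+ j)) ->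
  forall f, is_poly d f -> P f.
Proof.
move=> P0 PD PM f [c fE].
have -> : f = (fun p => \sum_(i < d.+1) \sum_(j < d.+1 | (i + j <= d)%N)
            c i j * p.1 ^+ i * p.2 ^+ j) by apply/funext.
have Psum (I : Type) (s : seq I) (Q : pred I) (F : I -> R * R -> R) :
    (forall i, Q i -> P (F i)) -> P (fun p => \sum_(i <- s | Q i) F i p).
  move=> PF; elim: s => [|i s IH].
    by under eq_fun do rewrite big_nil.
  have [Qi|Qi] := boolP (Q i).
    by under eq_fun do rewrite big_cons Qi; apply: PD => //; apply: PF.
  by under eq_fun do rewrite big_cons (negbTE Qi).
by apply: (Psum) => i _; apply: Psum => j ij; apply: PM.
Qed.

Lemma is_poly_mono (d : nat) (c : R) (i j : nat) : (i + j <= d)%N ->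
  is_poly d (fun p => c * p.1 ^+ i * p.2 ^+ j).
Proof.
move=> ijd; have id : (i < d.+1)%N by lia.
have jd : (j < d.+1)%N by lia.
exists (fun i' j' => if (i' == i) && (j' == j) then c else 0) => p.
rewrite (bigD1 (Ordinal id)) //= (bigD1 (Ordinal jd)) //= !eqxx /=.
rewrite !big1 ?addr0// => i'.
  move=> /negbTE h; apply: big1 => j' _.
  by rewrite (_ : (_ == i) = false) ?mul0r.
by move=> /andP[_ /negbTE h]; rewrite (_ : (_ == j) = false) ?mul0r.
Qed.

Lemma is_polyD (d : nat) f g : is_poly d f -> is_poly d g ->
  is_poly d (fun p => f p + g p).
Proof.
move=> [c fE] [c' gE]; exists (fun i j => c i j + c' i j) => p.
rewrite fE gE -big_split; apply: eq_bigr => i _ /=.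
by rewrite -big_split; apply: eq_bigr => j _ /=; ring.
Qed.

Lemma is_polyZ (d : nat) f (a : R) : is_poly d f ->
  is_poly d (fun p => a * f p).
Proof.
move=> [c fE]; exists (fun i j => a * c i j) => p.
rewrite fE mulr_sumr; apply: eq_bigr => i _ /=.
by rewrite mulr_sumr; apply: eq_bigr => j _ /=; ring.
Qed.

Lemma is_polyC (d : nat) (a : R) : is_poly d (fun=> a).
Proof.
have -> : (fun=> a) = (fun p : R * R => a * p.1 ^+ 0 * p.2 ^+ 0).
  by apply/funext => p; rewrite !expr0 !mulr1.
exact: is_poly_mono.
Qed.

(* Restriction to lines turns the calculus of f into that of {poly R}. *)
Definition partials (d : nat) f f1 f2 : Prop :=
  [/\ is_poly d.-1 f1, is_poly d.-1 f2 &
    forall p u, exists L : {poly R}, [/\ (size L <= d.+1)%N,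
      forall h, L.[h] = f (p + h *: u) &
      forall h, L^`().[h] = u.1 * f1 (p + h *: u) + u.2 * f2 (p + h *: u)]].

Lemma is_poly_partials (d : nat) f : is_poly d f ->
  exists f1 f2, partials d f f1 f2.
Proof.
move=> pf; apply: (is_poly_ind (P := fun f => exists f1 f2, partials d f f1 f2)
  _ _ _ pf) => {f pf}.
- exists (fun=> 0), (fun=> 0); split; [exact: is_polyC..|move=> p u].
  exists 0; split => [|h|h]; first by rewrite size_poly0.
    by rewrite horner0.
  by rewrite deriv0 horner0 !mulr0 addr0.
- move=> f g [f1 [f2 [pf1 pf2 Lf]]] [g1 [g2 [pg1 pg2 Lg]]].
  exists (fun p => f1 p + g1 p), (fun p => f2 p + g2 p).
  split; [exact: is_polyD..|move=> p u].
  have [A [sA eA dA]] := Lf p u; have [B [sB eB dB]] := Lg p u.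
  exists (A + B); split=> [|h|h].
  + by rewrite (leq_trans (size_polyD _ _))// geq_max sA.
  + by rewrite hornerD eA eB.
  + by rewrite derivD hornerD dA dB; ring.
- move=> c i j ijd.
  exists (fun p => c * i%:R * p.1 ^+ i.-1 * p.2 ^+ j),
    (fun p => c * j%:R * p.1 ^+ i * p.2 ^+ j.-1); split.
  (* For i = 0 the monomial with exponent [i.-1] may have too large a degree, but its coefficient
     [i%:R] is zero. *)
  + case: i ijd => [|i] ijd; last by apply: is_poly_mono; lia.
    by under eq_fun do rewrite mulr0 !mul0r; exact: is_polyC.
  + case: j ijd => [|j] ijd; last by apply: is_poly_mono; lia.
    by under eq_fun do rewrite mulr0 !mul0r; exact: is_polyC.
  move=> p u; pose X (a b : R) : {poly R} := a%:P + b *: 'X.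
  have sX a b : (size (X a b) <= 2)%N.
    rewrite (leq_trans (size_polyD _ _))// geq_max (leq_trans (size_polyC_leq1 _))//.
    by rewrite (leq_trans (size_scale_leq _ _))// size_polyX.
  have sXn a b n : (size (X a b ^+ n) <= n.+1)%N.
    rewrite (leq_trans (size_poly_exp_leq _ _))// ltnS.
    by have := sX a b; case: (size _) => [|[|[]]]//=; lia.
  exists (c *: (X p.1 u.1 ^+ i * X p.2 u.2 ^+ j)); split=> [|h|h].
  + rewrite (leq_trans (size_scale_leq _ _))// (leq_trans (size_polyMleq _ _))//.
    have := sXn p.1 u.1 i; have := sXn p.2 u.2 j; lia.
  + have hX a b : (X a b).[h] = a + h * b.
      by rewrite /X hornerD hornerC hornerZ hornerX mulrC.
    by clearbody X; rewrite !(hornerZ, hornerM, horner_exp, hX) /= mulrA.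
  + have dX a b : (X a b)^`() = b%:P.
      by rewrite /X derivD derivC add0r derivZ derivX alg_polyC.
    have hX a b : (X a b).[h] = a + h * b.
      by rewrite /X hornerD hornerC hornerZ hornerX mulrC.
    clearbody X; rewrite derivZ derivM !deriv_exp !dX.
    rewrite !(hornerZ, hornerD, hornerM, hornerMn, horner_exp, hornerC, hX) /=.
    rewrite -[_ *+ i]mulr_natr -[_ *+ j]mulr_natr.
    rewrite [h *: u.1](_ : _ = h * u.1)// [h *: u.2](_ : _ = h * u.2)//.
    by ring.
Qed.
End Polynomials.

(** * One-variable integrals and the inverse inequality *)

Section Integration1.
Context {R : realType}.
Local Notation mu := (@lebesgue_measure R).
Implicit Types (P Q : {poly R}) (a b : R).

Lemma horner_integrable P a b : mu.-integrable `[a, b] (EFin \o horner P).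
Proof.
apply: continuous_compact_integrable; first exact: segment_compact.
by apply: continuous_subspaceT; exact: continuous_horner.
Qed.

Lemma poly_primitive P : exists Q, Q^`() = P.
Proof.
(* At i = 0 the division by zero gives 0, so this primitive has no constant term. *)
exists (\poly_(i < (size P).+1) (P`_i.-1 / i%:R)).
apply/polyP => i; rewrite coef_deriv coef_poly ltnS.
case: ltnP => iP /=; last by rewrite nth_default // mul0rn.
by rewrite -[LHS]mulr_natr divfK // pnatr_eq0.
Qed.

Lemma int_deriv Q a b : a <= b ->
  \int[mu]_(x in `[a, b]) (Q^`()).[x] = Q.[b] - Q.[a].
Proof.
rewrite le_eqVlt => /orP[/eqP->|ab].
  by rewrite set_itv1 Rintegral_set1 subrr.
rewrite /Rintegral (@continuous_FTC2 _ _ (horner Q)) //.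
- by apply: continuous_subspaceT; exact: continuous_horner.
- split.
  + by move=> x _; exact: derivable_horner.
  + by apply: cvg_at_right_filter; exact: continuous_horner.
  + by apply: cvg_at_left_filter; exact: continuous_horner.
- by move=> x _; rewrite derivE.
Qed.

Lemma Rint_subset d (T : measurableType d) (m : {measure set T -> \bar R})
  (A B : set T) (f : T -> R) : measurable A -> measurable B -> A `<=` B ->
  m.-integrable B (EFin \o f) -> (forall x, B x -> 0 <= f x) ->
  \int[m]_(x in A) f x <= \int[m]_(x in B) f x.
Proof.
move=> mA mB AB iB f0; rewrite /Rintegral fine_le//.
- by apply: integrable_fin_num => //; exact: integrableS iB.
- exact: integrable_fin_num.
- by apply: ge0_subset_integral => //; exact: (measurable_int m).
Qed.

(** The difference of the two sides has size at most n and vanishes at n distinct nodes. *)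
Lemma poly_lagrange (n : nat) (x : 'I_n -> R) P : injective x ->
  (size P <= n)%N ->
  P = \sum_j P.[x j] *: \prod_(i | i != j) ((x j - x i)^-1 *: ('X - (x i)%:P)).
Proof.
move=> xI sP; apply/eqP; rewrite -subr_eq0; apply/eqP; set D := _ - _.
pose l j := \prod_(i < n | i != j) ((x j - x i)^-1 *: ('X - (x i)%:P)).
have sl j : (size (l j) <= n)%N.
  have n0 : (0 < n)%N by case: (n) j => [[]|].
  rewrite (leq_trans (size_poly_prod_leq _ _))//.
  have : (\sum_(i < n | i != j) size ((x j - x i)^-1 *: ('X - (x i)%:P)) <=
          \sum_(i < n | i != j) 2)%N.
    by apply: leq_sum => i _; rewrite (leq_trans (size_scale_leq _ _))// size_XsubC.
  rewrite sum_nat_const cardC1 card_ord.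
  move=> h; rewrite leq_subLR; apply: (@leq_trans (n.-1 * 2).+1); [exact: h | lia].
have sD : (size D <= n)%N.
  rewrite (leq_trans (size_polyD _ _))// geq_max sP size_polyN /=.
  rewrite (leq_trans (size_sum _ _ _))//; apply/bigmax_leqP => j _.
  by rewrite (leq_trans (size_scale_leq _ _))//; exact: sl.
apply: (@roots_geq_poly_eq0 _ D (codom x)).
- apply/allP => _ /codomP[j ->]; rewrite /root /D hornerD hornerN horner_sum.
  rewrite (bigD1 j) //= [X in _ - (_ + X)]big1 => [|i ij]; last first.
    have ji : j != i by rewrite eq_sym.
    by rewrite hornerZ horner_prod (bigD1 j ji) /= hornerZ hornerXsubC subrr mulr0 mul0r mulr0.
  rewrite hornerZ horner_prod big1 => [|i ij]; first by rewrite mulr1 addr0 subrr.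
  rewrite !hornerE mulVf // subr_eq0; apply: contra ij => /eqP/xI ->; exact: eqxx.
- by rewrite map_inj_uniq ?enum_uniq.
- by rewrite size_codom card_ord.
Qed.

(** The minimum of the square, attained by continuity, is at most its mean. Such a point serves as
    an interpolation node with a controlled value. *)
Lemma poly_min_le (P : {poly R}) a b : a < b ->
  exists2 x, x \in `[a, b] & (b - a) * P.[x] ^+ 2 <= \int[mu]_(t in `[a, b]) P.[t] ^+ 2.
Proof.
move=> ab; have [x xab xmin] : exists2 c, c \in `[a, b] &
    forall t, t \in `[a, b] -> (P ^+ 2).[c] <= (P ^+ 2).[t].
  apply: EVT_min; first exact: ltW.
  by apply: continuous_subspaceT; exact: continuous_horner.
exists x => //.
have -> : \int[mu]_(t in `[a, b]) P.[t] ^+ 2 = \int[mu]_(t in `[a, b]) (P ^+ 2).[t].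
  by apply: eq_Rintegral => t _; rewrite horner_exp.
have <- : \int[mu]_(t in `[a, b]) (P.[x] ^+ 2) = (b - a) * P.[x] ^+ 2.
  by rewrite Rintegral_cst //= lebesgue_measure_itv /= lte_fin ab -EFinB /= mulrC.
apply: le_Rintegral => //; last by move=> t; rewrite -horner_exp; exact: xmin.
- have -> : (EFin \o fun=> P.[x] ^+ 2) = EFin \o horner (P.[x] ^+ 2)%:P.
    by apply/funext => t /=; rewrite hornerC.
  exact: horner_integrable.
- exact: horner_integrable.
Qed.

(* Lagrange interpolation at nodes lying in n separated subintervals, at each of
   which the square of P is at most its mean over the subinterval. *)
Lemma poly_sup_le_int (n : nat) (M : R) : exists2 C : R, 0 < C &
  forall P a r x, (size P <= n)%N -> 0 < r -> `|x - a| <= M * r ->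
    P.[x] ^+ 2 <= C / r * \int[mu]_(t in `[a, a + r]) P.[t] ^+ 2.
Proof.
(* B bounds every factor |x - y_i| / |y_j - y_i| of the Lagrange basis: the numerator is at most
   (|M| + 1) r and the denominator at least r / (2 N). The added 1 makes B >= 1, so that powers of B
   increase; N is n + 1 in order to be positive for n = 0 too. *)
pose N : R := n.+1%:R; pose B := 2 * N * (`|M| + 1) + 1.
have N0 : 0 < N by rewrite ltr0n.
have B1 : 1 <= B by rewrite /B lerDr mulr_ge0// ?addr_ge0 ?mulr_ge0// ltW.
have B0 : 0 < B by apply: lt_le_trans B1.
exists ((N * B ^+ n) ^+ 2 * (2 * N)) => [|P a r x sP r0 xa].
  by rewrite mulr_gt0 ?exprn_gt0 ?mulr_gt0 // exprn_gt0.
(* Intervals of length [dl] start at distance 2 [dl] from each other, so nodes taken in different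
   intervals are at least [dl] apart. *)
pose l (j : nat) := a + r * (2 * j%:R) / (2 * N).
pose dl := r / (2 * N).
have dl0 : 0 < dl by rewrite divr_gt0 // mulr_gt0.
set I := \int[mu]_(t in _) _.
have I0 : 0 <= I by apply: Rintegral_ge0 => t _; exact: sqr_ge0.
have lE j : l j = a + 2 * j%:R * dl by rewrite /l /dl; field; rewrite gt_eqF.
have rE : r = 2 * N * dl by rewrite /dl; field; rewrite gt_eqF.
have jN (j : 'I_n) : (j%:R : R) + 1 <= N by rewrite /N -natr1 lerD2r ler_nat ltnW.
have node (j : 'I_n) : exists y, [/\ l j <= y, y <= l j + dl &
     P.[y] ^+ 2 <= 2 * N / r * I].
  have lj : l j < l j + dl by rewrite ltrDl.
  have [y yI yP] := poly_min_le P lj; exists y.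
  move: (yI); rewrite in_itv /= => /andP[? ?]; split => //.
  have : \int[mu]_(t in `[l j, l j + dl]) P.[t] ^+ 2 <= I.
    apply: Rint_subset => //; last by move=> t _; exact: sqr_ge0.
      move=> t /=; rewrite !in_itv /= lE rE => /andP[h1 h2].
      have := jN j; have : (0:R) <= j%:R by []; nra.
    have -> : (EFin \o fun t => P.[t] ^+ 2) = EFin \o horner (P ^+ 2).
      by apply/funext => t /=; rewrite horner_exp.
    exact: horner_integrable.
  move=> /(le_trans yP); rewrite addrAC subrr add0r => h.
  rewrite -(ler_pM2l dl0) (le_trans h)// le_eqVlt; apply/orP; left.
  by apply/eqP; rewrite /dl; field; rewrite !gt_eqF.
have [y yP] : exists y : 'I_n -> R, forall j : 'I_n, [/\ l j <= y j, y j <= l j + dl &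
     P.[y j] ^+ 2 <= 2 * N / r * I].
  by have [y yP] := boolp.choice node; exists y.
have sep (i j : 'I_n) : i != j -> dl <= `|y j - y i|.
  have [li1 li2 _] := yP i; have [lj1 lj2 _] := yP j; rewrite neq_ltn.
  move=> /orP[] ij.
    have : (i%:R : R) + 1 <= j%:R by rewrite natr1 ler_nat.
    move: li1 li2 lj1 lj2; rewrite !lE => li1 li2 lj1 lj2 h.
    apply: le_trans (ler_norm _); nra.
  have : (j%:R : R) + 1 <= i%:R by rewrite natr1 ler_nat.
  move: li1 li2 lj1 lj2; rewrite !lE => li1 li2 lj1 lj2 h.
  rewrite distrC; apply: le_trans (ler_norm _); nra.
have yI : injective y.
  move=> i j yij; apply/eqP/negP => /negP /sep; rewrite yij subrr normr0.
  by rewrite leNgt dl0.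
pose m := Num.sqrt (2 * N / r * I).
have m2 : m ^+ 2 = 2 * N / r * I by rewrite sqr_sqrtr // mulr_ge0// divr_ge0 ?mulr_ge0 // ltW.
have Pym j : `|P.[y j]| <= m.
  have [_ _ h] := yP j; rewrite -sqrtr_sqr /m ler_wsqrtr//.
suff : `|P.[x]| <= N * B ^+ n * m.
  move=> h; rewrite -(real_normK (num_real _)).
  have : `|P.[x]| ^+ 2 <= (N * B ^+ n * m) ^+ 2.
    have h0 : 0 <= N * B ^+ n * m.
      by rewrite !mulr_ge0 ?sqrtr_ge0 ?exprn_ge0//; exact: ltW.
    by rewrite lerXn2r ?nnegrE.
  move=> /le_trans; apply; rewrite exprMn m2 le_eqVlt; apply/orP; left; apply/eqP.
  by ring.
rewrite {1}(poly_lagrange yI sP) horner_sum (le_trans (ler_norm_sum _ _ _))//.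
have -> : N * B ^+ n * m = \sum_(j < n.+1) B ^+ n * m.
  by rewrite sumr_const card_ord -mulr_natl mulrA.
rewrite big_ord_recr /= ler_wpDr //.
  by rewrite mulr_ge0 ?sqrtr_ge0 ?exprn_ge0//; exact: ltW.
apply: ler_sum => j _; rewrite hornerZ normrM mulrC ler_pM//.
rewrite horner_prod normr_prod.
apply: (@le_trans _ _ (\prod_(i < n | i != j) B)).
  apply: ler_prod => i ij; rewrite normr_ge0 /= !hornerE normrM normfV.
  have := sep _ _ ij => h; have h0 : 0 < `|y j - y i| by apply: lt_le_trans h.
  rewrite mulrC ler_pdivrMr//; apply: (@le_trans _ _ (B * dl)); last by rewrite ler_pM2l.
  have : `|x - y i| <= `|x - a| + `|a - y i|.
    by rewrite -[x - y i](subrKA a); exact: ler_normD.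
  move=> /le_trans; apply.
  have [h1 h2 _] := yP i.
  have : `|a - y i| <= r.
    rewrite distrC ger0_norm; have := jN i; have : (0:R) <= i%:R by [].
      move: h1 h2; rewrite lE rE; nra.
    move: h1 h2; rewrite lE; nra.
  have : `|x - a| <= `|M| * r by rewrite (le_trans xa)// ler_pM2r// ler_norm.
  have -> : B * dl = r * (`|M| + 1) + dl by rewrite [in RHS]rE /B; ring.
  have := normr_ge0 M; nra.
rewrite prodr_const; apply: ler_weXn2l => //.
by rewrite (leq_trans (max_card _))// card_ord.
Qed.
End Integration1.

(** * Integration in the plane *)

Section Integration2.
Context {R : realType}.
Local Notation mu := (@lebesgue_measure R).
Local Notation mu2 := (mu \x mu)%E.
Implicit Types (f g : R * R -> R) (A B : set (R * R)) (p : R * R).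

(** Measurable and bounded on bounded sets: a class that contains the polynomials, is stable under
    the sums and products that occur, and is integrable over every bounded measurable set. *)
Definition tame f : Prop := measurable_fun setT f /\
  forall M : R, exists b : R, forall p, `|p.1| <= M -> `|p.2| <= M -> `|f p| <= b.

Definition tame_set A : Prop := measurable A /\
  exists M : R, forall p, A p -> `|p.1| <= M /\ `|p.2| <= M.

Lemma tameC (a : R) : tame (fun=> a).
Proof. by split=> [|M]; [exact: measurable_cst|exists `|a|]. Qed.

Lemma tameD f g : tame f -> tame g -> tame (fun p => f p + g p).
Proof.
move=> [mf bf] [mg bg]; split=> [|M]; first exact: measurable_funD.
have [B1 h1] := bf M; have [B2 h2] := bg M; exists (B1 + B2) => p p1 p2.
by rewrite (le_trans (ler_normD _ _))// lerD ?h1 ?h2.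
Qed.

Lemma tameM f g : tame f -> tame g -> tame (fun p => f p * g p).
Proof.
move=> [mf bf] [mg bg]; split=> [|M]; first exact: measurable_funM.
have [B1 h1] := bf M; have [B2 h2] := bg M; exists (B1 * B2) => p p1 p2.
by rewrite normrM ler_pM ?h1 ?h2.
Qed.

Lemma tameZ a f : tame f -> tame (fun p => a * f p).
Proof. by apply: tameM; exact: tameC. Qed.

Lemma tameX f n : tame f -> tame (fun p => f p ^+ n).
Proof.
move=> tf; elim: n => [|n IH]; first by under eq_fun do rewrite expr0; exact: tameC.
by under eq_fun do rewrite exprS; exact: tameM.
Qed.

Lemma tame_fst : tame fst.
Proof. by split=> [|M]; [exact: measurable_fst|exists M]. Qed.

Lemma tame_snd : tame snd.
Proof. by split=> [|M]; [exact: measurable_snd|exists M]. Qed.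

Lemma tame_poly d f : is_poly d f -> tame f.
Proof.
apply: is_poly_ind; [exact: tameC|exact: tameD|move=> c i j _].
apply: tameM; last by apply: tameX; exact: tame_snd.
by apply: tameZ; apply: tameX; exact: tame_fst.
Qed.

Lemma tame_set_rect (a b c d : R) : tame_set (`[a, b] `*` `[c, d]).
Proof.
split; first exact: measurableX.
exists (`|a| + `|b| + (`|c| + `|d|)) => -[x y] [/=]; rewrite !in_itv /= => /andP[ax xb] /andP[cy yd].
have xh : `|x| <= `|a| + `|b|.
  have := ler_norm (- a); have := ler_norm b; rewrite normrN ler_norml.
  have := normr_ge0 a; have := normr_ge0 b => *; apply/andP; split; lra.
have yh : `|y| <= `|c| + `|d|.
  have := ler_norm (- c); have := ler_norm d; rewrite normrN ler_norml.
  have := normr_ge0 c; have := normr_ge0 d => *; apply/andP; split; lra.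
have := normr_ge0 a; have := normr_ge0 b; have := normr_ge0 c.
by have := normr_ge0 d => *; split; lra.
Qed.

Lemma tame_setS A B : measurable A -> A `<=` B -> tame_set B -> tame_set A.
Proof. by move=> mA AB [_ [M bM]]; split=> //; exists M => p /AB /bM. Qed.

Lemma rect_measure (a b c d : R) : a <= b -> c <= d ->
  mu2 (`[a, b] `*` `[c, d]) = ((b - a) * (d - c))%:E.
Proof.
have itvE (x y : R) : x <= y -> mu `[x, y] = (y - x)%:E.
  rewrite lebesgue_measure_itv /= lte_fin le_eqVlt => /orP[/eqP->|->//].
  by rewrite ltxx subrr.
by move=> ab cd; rewrite product_measure1E ?EFinM -?itvE //.
Qed.

Lemma tame_set_fin A : tame_set A -> (mu2 A < +oo)%E.
Proof.
move=> [mA [M bM]]; have Ab : A `<=` `[- `|M|, `|M|] `*` `[- `|M|, `|M|].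
  move=> [x y] /bM /= [h1 h2]; split; rewrite /= in_itv /= -ler_norml.
    exact: le_trans h1 (ler_norm _).
  exact: le_trans h2 (ler_norm _).
apply: (@le_lt_trans _ _ (mu2 (`[- `|M|, `|M|] `*` `[- `|M|, `|M|]))).
  by apply: le_measure; rewrite ?inE//; exact: measurableX.
by rewrite rect_measure ?ltry // lerNl (le_trans _ (normr_ge0 M))// oppr_le0.
Qed.

Lemma tame_integrable A f : tame_set A -> tame f -> mu2.-integrable A (EFin \o f).
Proof.
move=> tA [mf bf]; have [mA [M bM]] := tA.
apply: measurable_bounded_integrable => //; first exact: tame_set_fin.
  exact: measurable_funTS.
have [B hB] := bf M; exists B; split; first exact: num_real.
move=> x Bx p /= Ap; have [h1 h2] := bM _ Ap.
by rewrite (le_trans (hB _ h1 h2))// ltW.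
Qed.

Lemma area_intD A f g : tame_set A -> tame f -> tame g ->
  area_int A (fun p => f p + g p) = area_int A f + area_int A g.
Proof.
by move=> tA tf tg; apply: RintegralD; [exact: tA.1|exact: tame_integrable..].
Qed.

Lemma area_intZ A f a : tame_set A -> tame f ->
  area_int A (fun p => a * f p) = a * area_int A f.
Proof.
by move=> tA tf; apply: RintegralZl; [exact: tA.1|exact: tame_integrable].
Qed.

Lemma area_int_le A f g : tame_set A -> tame f -> tame g ->
  (forall p, A p -> f p <= g p) -> area_int A f <= area_int A g.
Proof.
by move=> tA tf tg fg; apply: le_Rintegral; [exact: tA.1|exact: tame_integrable..|].
Qed.

Lemma area_int_ge0 A f : (forall p, A p -> 0 <= f p) -> 0 <= area_int A f.
Proof. by move=> f0; rewrite /area_int; apply: Rintegral_ge0. Qed.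

Lemma area_int_subset A B f : measurable A -> tame_set B -> A `<=` B -> tame f ->
  (forall p, B p -> 0 <= f p) -> area_int A f <= area_int B f.
Proof.
by move=> mA tB AB tf f0; apply: Rint_subset => //; [exact: tB.1|exact: tame_integrable].
Qed.

(** A square of side 2 h around c contains A. This crude area is precise enough for all the upper
    bounds below, where only the power of h matters. *)
Lemma area_int_ub A f (c : R * R) (h M : R) : measurable A -> 0 <= h -> 0 <= M ->
  (forall p, A p -> `|p.1 - c.1| <= h /\ `|p.2 - c.2| <= h) ->
  tame f -> (forall p, A p -> f p <= M) -> area_int A f <= 4 * h ^+ 2 * M.
Proof.
move=> mA h0 M0 Ah tf fM; set S := `[c.1 - h, c.1 + h] `*` `[c.2 - h, c.2 + h].
have AS : A `<=` S.
  by move=> p /Ah[h1 h2]; split => /=; rewrite in_itv /= -ler_distl.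
have tS : tame_set S by exact: tame_set_rect.
have tA : tame_set A by exact: tame_setS tS.
apply: (le_trans (area_int_le tA tf (tameC M) fM)).
apply: (le_trans (area_int_subset mA tS AS (tameC M) _)) => //.
rewrite /area_int Rintegral_cst; last exact: tS.1.
have hS : fine (mu2 S) = 4 * h ^+ 2 by rewrite rect_measure /=; [ring|lra..].
by rewrite -[fine _]/(fine (mu2 S)) hS mulrC.
Qed.

(** Extension by zero puts the integrals over A into the form on the whole plane required by the
    theorem of Fubini. *)
Lemma tame_patch A f : tame_set A -> tame f ->
  mu2.-integrable setT (EFin \o (f \_ A)).
Proof.
move=> tA tf; rewrite -restrict_EFin; apply/integrable_restrict => //; first exact: tA.1.
by rewrite setTI; exact: tame_integrable.
Qed.

Lemma tame_section1 A f x : tame_set A -> tame f ->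
  mu.-integrable setT (EFin \o (fun y => (f \_ A) (x, y))).
Proof.
move=> [mA [M bM]] [mf bf].
have -> : EFin \o (fun y => (f \_ A) (x, y)) =
          (EFin \o (fun y => f (x, y))) \_ (xsection A x).
  apply/funext => y; rewrite /= !patchE mem_xsection; by case: ifP.
apply/integrable_restrict; [exact: measurable_xsection|exact: measurableT|].
rewrite setTI; apply: measurable_bounded_integrable.
- exact: measurable_xsection.
- apply: (@le_lt_trans _ _ (mu `[- M, M])).
    apply: le_measure; rewrite ?inE; [exact: measurable_xsection|exact: measurable_itv|].
    by move=> y; rewrite /xsection /= inE => /bM[_]; rewrite in_itv /= ler_norml.
  by rewrite /= lebesgue_measure_itv /=; case: ifP => _; rewrite ?ltry // -EFinB ltry.
- apply: measurable_funTS; apply: (measurableT_comp mf); exact: measurable_pair1.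
have [B hB] := bf M; exists B; split; first exact: num_real.
move=> z Bz y; rewrite /xsection /= inE => /bM[h1 h2].
by rewrite (le_trans (hB _ h1 h2))// ltW.
Qed.

Lemma tame_swap f : tame f -> tame (f \o swap).
Proof.
move=> [mf bf]; split; first exact: (measurableT_comp mf (@measurable_swap _ _ _ _)).
by move=> M; have [B hB] := bf M; exists B => p p1 p2; apply: hB.
Qed.

Lemma tame_set_swap A : tame_set A -> tame_set (swap @^-1` A).
Proof.
move=> [mA [M bM]]; split.
  by rewrite -[X in measurable X]setTI; exact: measurable_swap.
by exists M => p /bM[].
Qed.

Lemma area_int12 A f : tame_set A -> tame f ->
  area_int A f = \int[mu]_x \int[mu]_y (f \_ A) (x, y).
Proof.
move=> tA tf; rewrite /area_int Rintegral_mkcond /Rintegral.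
have := integral12_prod_meas1 (tame_patch tA tf) => <-.
congr fine; apply: eq_integral => x _; rewrite /fubini_F /=.
by rewrite fineK//; apply: integrable_fin_num => //; exact: (tame_section1 x tA tf).
Qed.

Lemma area_int21 A f : tame_set A -> tame f ->
  area_int A f = \int[mu]_y \int[mu]_x (f \_ A) (x, y).
Proof.
move=> tA tf; rewrite /area_int Rintegral_mkcond /Rintegral.
have := integral21_prod_meas1 (tame_patch tA tf) => <-.
congr fine; apply: eq_integral => y _; rewrite /fubini_G /=.
rewrite fineK//; apply: integrable_fin_num => //.
have := tame_section1 y (tame_set_swap tA) (tame_swap tf).
rewrite (_ : (fun y0 => _) = (fun x => (f \_ A) (x, y)))//.
Qed.

Lemma area_int_swap A f : tame_set A -> tame f ->
  area_int (swap @^-1` A) (f \o swap) = area_int A f.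
Proof.
move=> tA tf; rewrite (area_int21 tA tf) area_int12; [|exact: tame_set_swap|exact: tame_swap].
by [].
Qed.

(** The point p need not lie in the square, only within M times its side in each coordinate. This is
    what lets a small square inside a subtriangle control a polynomial on the whole element. *)
Lemma square_lower_bound (d : nat) (M : R) : exists2 C : R, 0 < C &
  forall f (a p : R * R) (r : R), is_poly d f -> 0 < r ->
   `|p.1 - a.1| <= M * r -> `|p.2 - a.2| <= M * r ->
    f p ^+ 2 <= C / r ^+ 2 *
      area_int (`[a.1, a.1 + r] `*` `[a.2, a.2 + r]) (fun q => f q ^+ 2).
Proof.
have [C C0 HC] := @poly_sup_le_int R d.+1 M; exists (C ^+ 2); first exact: exprn_gt0.
move=> f a [x y] r pf r0 /= xa ya.
have [f1 [f2 [_ _ Hl]]] := is_poly_partials pf.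
have line (p u : R * R) : exists2 L : {poly R}, (size L <= d.+1)%N & forall h, L.[h] = f (p + h *: u).
  by have [L [sL eL _]] := Hl p u; exists L.
set S := _ `*` _; have tS : tame_set S by exact: tame_set_rect.
have tf2 : tame (fun q => f q ^+ 2) by apply: tameX; exact: tame_poly pf.
rewrite (area_int12 tS tf2).
(* J integrates the square of f over vertical sections. The one-variable bound on vertical lines
   gives f(x', y)^2 <= C / r * J(x') for x' in the base; the same bound on the horizontal line
   through p then leaves the integral of J, which is the area integral. *)
set J := fun x' => \int[mu]_y' ((fun q => f q ^+ 2) \_ S) (x', y').
have JE x' : J x' = if x' \in `[a.1, a.1 + r] then \int[mu]_(t in `[a.2, a.2 + r]) f (x', t) ^+ 2 else 0.
  rewrite /J; case: ifPn => xI.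
    rewrite [RHS]Rintegral_mkcond; apply: eq_Rintegral => t _; rewrite !patchE.
    congr (if _ then _ else _); apply/idP/idP; rewrite !inE /S /=.
      by case.
    by split.
  have -> : (fun t => ((fun q => f q ^+ 2) \_ S) (x', t)) = fun=> 0.
    apply/funext => t; rewrite patchE memNset // /S /= => -[/= h _]; by rewrite h in xI.
  by rewrite Rintegral_cst // mul0r.
have J1 x' : x' \in `[a.1, a.1 + r] -> f (x', y) ^+ 2 <= C / r * J x'.
  move=> xI; rewrite JE xI; have [L sL eL] := line (x', 0) (0, 1).
  have eL' t : f (x', t) = L.[t] by rewrite eL; congr f; apply/eqP; rewrite xpair_eqE /= ?scaler0 ?addr0 ?add0r [t *: 1]mulr1 !eqxx.
  under eq_Rintegral do rewrite eL'.
  by rewrite eL'; apply: HC.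
have [L sL eL] := line (0, y) (1, 0).
have eL' t : f (t, y) = L.[t] by rewrite eL; congr f; apply/eqP; rewrite xpair_eqE /= ?scaler0 ?addr0 ?add0r [t *: 1]mulr1 !eqxx.
rewrite eL'; apply: (le_trans (HC L a.1 r x sL r0 xa)).
have iJ : mu.-integrable setT (EFin \o J).
  have -> : EFin \o J = fubini_F mu (EFin \o ((fun q => f q ^+ 2) \_ S)).
    apply/funext => x'; rewrite /fubini_F /J /Rintegral /= fineK //.
    by apply: integrable_fin_num => //; exact: (tame_section1 x' tS tf2).
  exact: integrable_fubini_F (tame_patch tS tf2).
have J0 x' : 0 <= J x'.
  by rewrite JE; case: ifP => // _; apply: Rintegral_ge0 => t _; exact: sqr_ge0.
have -> : C ^+ 2 / r ^+ 2 * (\int[mu]_x0 J x0) = C / r * (C / r * \int[mu]_x0 J x0).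
  by field; rewrite gt_eqF.
rewrite ler_pM2l ?divr_gt0 //.
rewrite -RintegralZl //.
apply: (@le_trans _ _ (\int[mu]_(t in `[a.1, a.1 + r]) (C / r * J t))).
  apply: le_Rintegral => //.
  - have -> : (EFin \o fun t => L.[t] ^+ 2) = EFin \o horner (L ^+ 2).
      by apply/funext => t /=; rewrite horner_exp.
    exact: horner_integrable.
  - apply: (integrableS measurableT) => //.
    rewrite (_ : _ \o _ = fun t => ((C / r)%:E * (EFin \o J) t)%E).
      exact: integrableZl.
    by apply/funext => t; rewrite /= EFinM.
  - by move=> t tI; rewrite -eL'; exact: J1.
apply: Rint_subset => //.
  rewrite (_ : _ \o _ = fun t => ((C / r)%:E * (EFin \o J) t)%E).
    exact: integrableZl.
  by apply/funext => t; rewrite /= EFinM.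
by move=> t _; rewrite mulr_ge0// divr_ge0// ltW.
Qed.
End Integration2.

(** * Triangles and the divergence theorem *)

Section Triangles.
Context {R : realType}.
Local Notation mu := (@lebesgue_measure R).
Implicit Types (f g : R * R -> R) (a b c p u : R * R).

Lemma scale_regE (x y : R) : x *: y = x * y.
Proof. by []. Qed.

(** Twice the signed area of the triangle. By the rule of Cramer, [orient p b c / orient a b c] is
    the barycentric coordinate of p at a. *)
Definition orient a b c : R :=
  (b.1 - a.1) * (c.2 - a.2) - (c.1 - a.1) * (b.2 - a.2).

Lemma conv3P a b c p : conv [:: a; b; c] p <->
  exists l0 l1 l2 : R, [/\ 0 <= l0, 0 <= l1, 0 <= l2, l0 + l1 + l2 = 1 &
    p = l0 *: a + l1 *: b + l2 *: c].
Proof.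
split=> [[l [l0 l1 ->]]|[l0 [l1 [l2 [h0 h1 h2 hs ->]]]]].
  exists (l ord0), (l (lift ord0 ord0)), (l (lift ord0 (lift ord0 ord0))).
  by move: l1; rewrite !big_ord_recl !big_ord0 /= !addr0 => <-; rewrite !addrA.
exists (fun i : 'I_3 => nth 0 [:: l0; l1; l2] i).
split; first by case=> [[|[|[|]]]] //=.
  by rewrite !big_ord_recl big_ord0 /= !addr0 addrA.
by rewrite !big_ord_recl big_ord0 /= !addr0 addrA.
Qed.

(** The barycentric coordinates are nonnegative; multiplying by the square of the determinant
    instead of dividing by it treats both orientations at once and leaves conditions that are affine
    in p. *)
Lemma conv3E a b c p : orient a b c != 0 -> conv [:: a; b; c] p <->
  [/\ 0 <= orient a b c * orient p b c, 0 <= orient a b c * orient a p c &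
      0 <= orient a b c * orient a b p].
Proof.
set D := orient a b c => D0; rewrite conv3P; split.
  move=> [l0 [l1 [l2 [h0 h1 h2 hs pE]]]].
  have l2E : l2 = 1 - l0 - l1 by rewrite -hs; ring.
  have -> : orient p b c = l0 * D.
    by rewrite pE /D /orient l2E /= !scale_regE; ring.
  have -> : orient a p c = l1 * D.
    by rewrite pE /D /orient l2E /= !scale_regE; ring.
  have -> : orient a b p = l2 * D.
    by rewrite pE /D /orient l2E /= !scale_regE; ring.
  by split; rewrite mulrCA mulr_ge0 // -expr2 sqr_ge0.
move=> [h0 h1 h2].
have div_ge0 x : 0 <= D * x -> 0 <= x / D.
  move=> h; have -> : x / D = D * x / D ^+ 2 by field.
  by rewrite divr_ge0 // sqr_ge0.
exists (orient p b c / D), (orient a p c / D), (orient a b p / D).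
split; [exact: div_ge0..| |].
  by rewrite -!mulrDl -[RHS](divff D0); congr (_ / _); rewrite /D /orient; ring.
case: p {h0 h1 h2} => x y; apply/eqP; rewrite xpair_eqE /=; apply/andP.
move: D0; rewrite /D /orient /= => D0.
by split; apply/eqP; rewrite !scale_regE; field.
Qed.

Lemma conv3_tame a b c : orient a b c != 0 -> tame_set (conv [:: a; b; c]).
Proof.
move=> D0; set D := orient a b c in D0; split.
  have -> : conv [:: a; b; c] =
      ((fun p => D * orient p b c) @^-1` [set x | 0 <= x]) `&`
      ((fun p => D * orient a p c) @^-1` [set x | 0 <= x]) `&`
      ((fun p => D * orient a b p) @^-1` [set x | 0 <= x]).
    apply/seteqP; split=> p; rewrite conv3E //.
      by case.
    by move=> [[]].
  have mi : measurable [set x : R | 0 <= x].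
    have -> : [set x : R | 0 <= x] = `[0, +oo[%classic.
      by apply/seteqP; split => x /=; rewrite in_itv /= andbT.
    exact: measurable_itv.
  have mg (g : R * R -> R) : tame g -> measurable (g @^-1` [set x | 0 <= x]).
    by move=> [mg _]; rewrite -[X in measurable X]setTI; exact: mg.
  have tsub (g h : R * R -> R) : tame g -> tame h -> tame (fun p => g p - h p).
    move=> tg th; have -> : (fun p => g p - h p) = fun p => g p + (-1) * h p.
      by apply/funext => p; ring.
    by apply: tameD => //; apply: tameZ.
  have t1 (x : R) : tame (fun p => p.1 - x) by apply: tsub; [exact: tame_fst|exact: tameC].
  have t2 (x : R) : tame (fun p => p.2 - x) by apply: tsub; [exact: tame_snd|exact: tameC].
  have s1 (x : R) : tame (fun p => x - p.1) by apply: tsub; [exact: tameC|exact: tame_fst].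
  have s2 (x : R) : tame (fun p => x - p.2) by apply: tsub; [exact: tameC|exact: tame_snd].
  by do 2?[apply: measurableI]; apply: mg; apply: tameZ; rewrite /orient;
    apply: tsub; apply: tameM; (exact: t1 || exact: t2 || exact: s1 || exact: s2 || exact: tameC).
exists (`|a.1| + `|b.1| + `|c.1| + (`|a.2| + `|b.2| + `|c.2|)) => p /conv3P.
move=> [l0 [l1 [l2 [h0 h1 h2 hs ->]]]] /=.
have bd (x y z : R) : `|l0 * x + l1 * y + l2 * z| <= `|x| + `|y| + `|z|.
  rewrite (le_trans (ler_normD _ _)) // lerD // ?(le_trans (ler_normD _ _)) // ?lerD //;
  by rewrite normrM ler_piMl // ger0_norm //; lra.
by split; rewrite (le_trans (bd _ _ _)) // ?lerDl ?lerDr !addr_ge0.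
Qed.

(** The line integral of f dy along the segment oriented from a to b: it changes sign with the
    orientation and vanishes on horizontal segments. *)
Definition edge_flux f a b : R :=
  (b.2 - a.2) * \int[mu]_(s in `[0, 1]) f ((1 - s) *: a + s *: b).

Definition absc a b (y : R) : R := a.1 + (y - a.2) / (b.2 - a.2) * (b.1 - a.1).

(** A line that is not horizontal is parametrised by the height y, with slope m = dx/dy; a primitive
    in y then serves both orientations, and also the horizontal sections of a triangle. *)
Lemma edge_flux_primitive d f a b : is_poly d f -> a.2 != b.2 ->
  exists Q : {poly R}, [/\ forall y, Q^`().[y] = f (absc a b y, y),
    edge_flux f a b = Q.[b.2] - Q.[a.2] & edge_flux f b a = Q.[a.2] - Q.[b.2]].
Proof.
move=> pf ab; have ab0 : b.2 - a.2 != 0 by rewrite subr_eq0 eq_sym.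
have ba0 : a.2 - b.2 != 0 by rewrite subr_eq0.
have [f1 [f2 [_ _ Hl]]] := is_poly_partials pf.
pose m := (b.1 - a.1) / (b.2 - a.2).
have [H [_ HE _]] := Hl (a.1 - a.2 * m, 0) (m, 1).
have [Q QE] := poly_primitive H; exists Q.
have Hy y : H.[y] = f (absc a b y, y).
  rewrite HE; congr f; apply/eqP; rewrite xpair_eqE /= /absc /m; apply/andP; split.
    apply/eqP; rewrite !scale_regE. by field.
  by rewrite add0r [y *: 1]mulr1.
have flux (p q : R * R) : q.2 - p.2 != 0 ->
    (forall s, (1 - s) *: p + s *: q = (absc a b (p.2 + s * (q.2 - p.2)), p.2 + s * (q.2 - p.2))) ->
    edge_flux f p q = Q.[q.2] - Q.[p.2].
  move=> pq0 lin; pose G := Q \Po (p.2%:P + (q.2 - p.2) *: 'X).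
  have GE x : G.[x] = Q.[p.2 + (q.2 - p.2) * x].
    by rewrite /G horner_comp hornerD hornerC hornerZ hornerX.
  have dG x : G^`().[x] = (q.2 - p.2) * f ((1 - x) *: p + x *: q).
    rewrite lin -Hy /G deriv_comp QE derivD derivC add0r derivZ derivX alg_polyC.
    by rewrite hornerM hornerC horner_comp hornerD hornerC hornerZ hornerX mulrC [x * _]mulrC.
  have := int_deriv G (@ler01 R); rewrite !GE mulr1 mulr0 addr0 [p.2 + _]addrC subrK => <-.
  rewrite /edge_flux; under [in RHS]eq_Rintegral do rewrite dG.
  rewrite RintegralZl //.
  have -> : (EFin \o fun s => f ((1 - s) *: p + s *: q)) =
            EFin \o horner ((q.2 - p.2)^-1 *: G^`()).
    by apply/funext => s; rewrite /= hornerZ dG mulKf.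
  exact: horner_integrable.
split.
- by move=> y; rewrite QE Hy.
- apply: flux => // s; apply/eqP; rewrite xpair_eqE /= /absc; apply/andP.
  by split; apply/eqP; rewrite !scale_regE; field.
- apply: flux => // s; apply/eqP; rewrite xpair_eqE /= /absc; apply/andP.
  by split; apply/eqP; rewrite !scale_regE; field.
Qed.

Lemma edge_fluxC d f a b : is_poly d f -> edge_flux f b a = - edge_flux f a b.
Proof.
move=> pf; have [ab|ab] := eqVneq a.2 b.2.
  by rewrite /edge_flux ab subrr !mul0r oppr0.
by have [Q [_ -> ->]] := edge_flux_primitive pf ab; rewrite opprB.
Qed.

Lemma section_int d f f1 f2 (K : set (R * R)) (l r y : R) : partials d f f1 f2 ->
  l <= r -> (forall x, K (x, y) <-> l <= x <= r) ->
  \int[mu]_x (f1 \_ K) (x, y) = f (r, y) - f (l, y).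
Proof.
move=> [_ _ Hl] lr HK; have [L [_ LE dL]] := Hl (0, y) (1, 0).
have e x : (0, y) + x *: (1, 0) = (x, y).
  by apply/eqP; rewrite xpair_eqE /= scaler0 addr0 add0r [x *: 1]mulr1 !eqxx.
have -> : f (r, y) - f (l, y) = L.[r] - L.[l] by rewrite !LE !e.
rewrite -(int_deriv L lr) [RHS]Rintegral_mkcond; apply: eq_Rintegral => x _.
rewrite !patchE; have [/HK h|h] := pselect (K (x, y)).
  by rewrite !mem_set /= ?in_itv //= ?dL ?e ?mul1r ?mul0r ?addr0 //; exact/HK.
by rewrite !memNset //= in_itv /=; move/HK: h.
Qed.
End Triangles.

(** * Green's formula on a triangle *)

Section Green.
Context {R : realType}.
Local Notation mu := (@lebesgue_measure R).
Implicit Types (f g : R * R -> R) (a b c p u : R * R).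

(** Below the height of b the condition for the side bc follows from the other two: [es] expresses
    its barycentric coordinate, up to positive factors, as a nonnegative combination of 1 and the
    coordinate for the side ab. *)
Lemma section_lowP a b c x y : a.2 < b.2 -> b.2 <= c.2 -> a.2 <= y <= b.2 ->
  orient a b c != 0 ->
  conv [:: a; b; c] (x, y) <->
  (0 <= orient a b c * (x - absc a c y)) /\ (0 <= orient a b c * (absc a b y - x)).
Proof.
move=> ab bc /andP[ay yb] D0; rewrite conv3E //.
have ac : a.2 < c.2 by apply: lt_le_trans bc.
have ba0 : b.2 - a.2 != 0 by rewrite subr_eq0 gt_eqF.
have ca0 : c.2 - a.2 != 0 by rewrite subr_eq0 gt_eqF.
have eb : orient a (x, y) c = (c.2 - a.2) * (x - absc a c y).
  by rewrite /orient /absc /=; field.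
have ec : orient a b (x, y) = (b.2 - a.2) * (absc a b y - x).
  by rewrite /orient /absc /=; field.
have es : (b.2 - y) * orient a b c = orient (x, y) b c * (b.2 - a.2) - orient a b (x, y) * (c.2 - b.2).
  by rewrite /orient /=; ring.
rewrite eb ec in es *; set D := orient a b c in D0 es *.
set u := x - _ in es *; set w := _ - x in es *.
have c1 : 0 < c.2 - a.2 by rewrite subr_gt0.
have b1 : 0 < b.2 - a.2 by rewrite subr_gt0.
rewrite mulrCA (mulrCA D (b.2 - a.2)) (pmulr_rge0 _ c1) (pmulr_rge0 _ b1).
split=> [[]//|[h1 h2]]; split=> //.
have : 0 <= (b.2 - a.2) * (D * orient (x, y) b c).
  have -> : (b.2 - a.2) * (D * orient (x, y) b c) =
      (b.2 - y) * D ^+ 2 + (b.2 - a.2) * (c.2 - b.2) * (D * w).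
    have := congr1 (fun z => D * z) es => /= es'; rewrite -[(b.2 - y) * D ^+ 2](_ : D * ((b.2 - y) * D) = _); last by ring.
    by rewrite es'; ring.
  by apply: addr_ge0; apply: mulr_ge0; rewrite ?sqr_ge0 ?subr_ge0 //;
    apply: mulr_ge0; rewrite subr_ge0 // ltW.
by rewrite (pmulr_rge0 _ b1).
Qed.

Lemma section_highP a b c x y : a.2 <= b.2 -> b.2 < c.2 -> b.2 <= y <= c.2 ->
  orient a b c != 0 ->
  conv [:: a; b; c] (x, y) <->
  (0 <= orient a b c * (x - absc a c y)) /\ (0 <= orient a b c * (absc b c y - x)).
Proof.
move=> ab bc /andP[by' yc] D0; rewrite conv3E //.
have ac : a.2 < c.2 by apply: le_lt_trans bc.
have cb0 : c.2 - b.2 != 0 by rewrite subr_eq0 gt_eqF.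
have ca0 : c.2 - a.2 != 0 by rewrite subr_eq0 gt_eqF.
have eb : orient a (x, y) c = (c.2 - a.2) * (x - absc a c y).
  by rewrite /orient /absc /=; field.
have ea : orient (x, y) b c = (c.2 - b.2) * (absc b c y - x).
  by rewrite /orient /absc /=; field.
have es : (y - b.2) * orient a b c = orient a b (x, y) * (c.2 - b.2) - orient (x, y) b c * (b.2 - a.2).
  by rewrite /orient /=; ring.
rewrite eb ea in es *; set D := orient a b c in D0 es *.
set u := x - _ in es *; set w := _ - x in es *.
have c1 : 0 < c.2 - a.2 by rewrite subr_gt0.
have b1 : 0 < c.2 - b.2 by rewrite subr_gt0.
rewrite mulrCA (mulrCA D (c.2 - a.2)) (pmulr_rge0 _ c1) (pmulr_rge0 _ b1).
split=> [[]//|[h1 h2]]; split=> //.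
have : 0 <= (c.2 - b.2) * (D * orient a b (x, y)).
  have -> : (c.2 - b.2) * (D * orient a b (x, y)) =
      (y - b.2) * D ^+ 2 + (c.2 - b.2) * (b.2 - a.2) * (D * w).
    have := congr1 (fun z => D * z) es => /= es'; rewrite -[(y - b.2) * D ^+ 2](_ : D * ((y - b.2) * D) = _); last by ring.
    by rewrite es'; ring.
  by apply: addr_ge0; apply: mulr_ge0; rewrite ?sqr_ge0 ?subr_ge0 //;
    apply: mulr_ge0; rewrite subr_ge0 // ltW.
by rewrite (pmulr_rge0 _ b1).
Qed.

(** The section runs from l to r for D > 0 and from r to l for D < 0; the sign of D makes up for the
    exchange of the ends. *)
Lemma oriented_section_int d f f1 f2 (K : set (R * R)) (D l r y : R) :
  partials d f f1 f2 -> D != 0 -> 0 <= D * (r - l) ->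
  (forall x, K (x, y) <-> (0 <= D * (x - l)) /\ (0 <= D * (r - x))) ->
  Num.sg D * (\int[mu]_x (f1 \_ K) (x, y)) = f (r, y) - f (l, y).
Proof.
move=> pf D0 rl HK; have [Dn|Dp|] := ltrgtP D 0; last by move/eqP: D0.
  rewrite ltr0_sg // (section_int (l := r) (r := l) pf) ?mulN1r ?opprB //.
    by rewrite nmulr_rge0 // subr_le0 in rl.
  move=> x; rewrite HK !nmulr_rge0 // !subr_le0.
  by split=> [[-> ->]//|/andP[]].
rewrite gtr0_sg // (section_int (l := l) (r := r) pf) ?mul1r //.
  by rewrite pmulr_rge0 // subr_ge0 in rl.
move=> x; rewrite HK !pmulr_rge0 // !subr_ge0.
by split=> [[-> ->]//|/andP[]].
Qed.

(* Below the height of b the horizontal sections run between the edges ac and ab,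
   above it between ac and bc. *)
Lemma green_sorted d f f1 f2 a b c : is_poly d f -> partials d f f1 f2 ->
  a.2 <= b.2 -> b.2 <= c.2 -> orient a b c != 0 ->
  Num.sg (orient a b c) * area_int (conv [:: a; b; c]) f1 =
  edge_flux f a b + edge_flux f b c + edge_flux f c a.
Proof.
move=> pf pdf ab bc D0; set D := orient a b c.
have ac : a.2 < c.2.
  rewrite lt_def (le_trans ab bc) andbT; apply: contra D0 => /eqP ca.
  have ba : b.2 = a.2 by apply/le_anti; rewrite ab -ca bc.
  by rewrite /orient ba ca; apply/eqP; ring.
have tK := conv3_tame D0; set K := conv _ in tK *.
have tf1 : tame f1 by case: pdf => p1 _ _; exact: tame_poly p1.
have [Qac [Qac' _ Eca]] := edge_flux_primitive pf (negbT (lt_eqF ac)).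
have ca0 : c.2 - a.2 != 0 by rewrite subr_eq0 gt_eqF.
rewrite area_int21 //; set J := fun y => \int[mu]_x (f1 \_ K) (x, y).
have iJ : mu.-integrable setT (EFin \o J).
  have -> : EFin \o J = fubini_F mu (EFin \o ((f1 \o swap) \_ (swap @^-1` K))).
    apply/funext => y; rewrite /fubini_F /J /Rintegral /= fineK //.
    apply: integrable_fin_num => //.
    exact: tame_section1 y (tame_set_swap tK) (tame_swap tf1).
  exact: integrable_fubini_F (tame_patch (tame_set_swap tK) (tame_swap tf1)).
have iJS (S : set R) : measurable S -> mu.-integrable S (EFin \o J).
  by move=> mS; exact: (integrableS measurableT).
have Jout y : ~~ (a.2 <= y <= c.2) -> J y = 0.
  move=> yout; rewrite /J.
  have -> : (fun x => (f1 \_ K) (x, y)) = fun=> 0.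
    apply/funext => x; rewrite patchE memNset // /K conv3P.
    move=> [l0 [l1 [l2 [h0 h1 h2 hs [_ yE]]]]]; move/negP: yout; apply.
    by rewrite yE !scale_regE; apply/andP; split; nra.
  by rewrite Rintegral_cst // mul0r.
have cut : \int[mu]_y J y = \int[mu]_(y in `[a.2, b.2]) J y + \int[mu]_(y in `[b.2, c.2]) J y.
  have -> : \int[mu]_y J y = \int[mu]_(y in `[a.2, c.2]) J y.
    rewrite [RHS]Rintegral_mkcond; apply: eq_Rintegral => y _; rewrite patchE.
    case: ifPn => // yo; apply: Jout; apply: contra yo => yI.
    by rewrite inE /= in_itv.
  rewrite -(Rintegral_itv_obnd_cbnd (r := b.2)); last by apply: iJS.
  rewrite -(@Rintegral_itvB _ J (BLeft a.2) (BRight c.2) b.2); last 3 first.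
  - exact: iJS.
  - by rewrite bnd_simp.
  - by rewrite bnd_simp.
  by rewrite addrC subrK.
(* The side ac bounds both the lower and the upper part. Its contributions, both expressed by the
   primitive [Qac], telescope to the flux from c to a. If a and b have the same height, both sides
   are zero. *)
have low : Num.sg D * (\int[mu]_(y in `[a.2, b.2]) J y) =
    edge_flux f a b - (Qac.[b.2] - Qac.[a.2]).
  move: ab; rewrite le_eqVlt => /orP[/eqP ab|ab].
    by rewrite /edge_flux -ab set_itv1 Rintegral_set1 !subrr mulr0 mul0r subr0.
  have ba0 : b.2 - a.2 != 0 by rewrite subr_eq0 gt_eqF.
  have [Qab [Qab' -> _]] := edge_flux_primitive pf (negbT (lt_eqF ab)).
  rewrite -RintegralZl //; last exact: iJS.
  transitivity (\int[mu]_(y in `[a.2, b.2]) ((Qab - Qac)^`()).[y]).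
    apply: eq_Rintegral => y; rewrite inE /= in_itv /= => yab.
    rewrite derivB hornerD hornerN Qab' Qac'.
    apply: (oriented_section_int pdf D0); last first.
      by move=> x; apply: section_lowP.
    have -> : absc a b y - absc a c y = D * (y - a.2) / ((b.2 - a.2) * (c.2 - a.2)).
      by rewrite /absc /D /orient; field; rewrite ba0 ca0.
    rewrite !mulrA -expr2.
    apply: divr_ge0; apply: mulr_ge0; rewrite ?sqr_ge0 ?subr_ge0 //;
      solve [exact: ltW|by case/andP: yab].
  by rewrite int_deriv ?ltW // !(hornerD, hornerN); ring.
have high : Num.sg D * (\int[mu]_(y in `[b.2, c.2]) J y) =
    edge_flux f b c - (Qac.[c.2] - Qac.[b.2]).
  move: bc; rewrite le_eqVlt => /orP[/eqP bc|bc].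
    by rewrite /edge_flux -bc set_itv1 Rintegral_set1 !subrr mulr0 mul0r subr0.
  have cb0 : c.2 - b.2 != 0 by rewrite subr_eq0 gt_eqF.
  have [Qbc [Qbc' -> _]] := edge_flux_primitive pf (negbT (lt_eqF bc)).
  rewrite -RintegralZl //; last exact: iJS.
  transitivity (\int[mu]_(y in `[b.2, c.2]) ((Qbc - Qac)^`()).[y]).
    apply: eq_Rintegral => y; rewrite inE /= in_itv /= => ybc.
    rewrite derivB hornerD hornerN Qbc' Qac'.
    apply: (oriented_section_int pdf D0); last first.
      by move=> x; apply: section_highP.
    have -> : absc b c y - absc a c y = D * (c.2 - y) / ((c.2 - b.2) * (c.2 - a.2)).
      by rewrite /absc /D /orient; field; rewrite cb0 ca0.
    rewrite !mulrA -expr2.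
    apply: divr_ge0; apply: mulr_ge0; rewrite ?sqr_ge0 ?subr_ge0 //;
      solve [exact: ltW|by case/andP: ybc].
  by rewrite int_deriv ?ltW // !(hornerD, hornerN); ring.
by rewrite cut mulrDr low high Eca; ring.
Qed.

Lemma conv3_rot a b c : conv [:: a; b; c] = conv [:: b; c; a].
Proof.
apply/seteqP; split=> p; rewrite !conv3P => -[l0 [l1 [l2 [h0 h1 h2 hs ->]]]].
  exists l1, l2, l0; split=> //; first by rewrite -hs; ring.
  by rewrite -addrA addrC.
exists l2, l0, l1; split=> //; first by rewrite -hs; ring.
by rewrite addrC addrA.
Qed.

Lemma conv3_flip a b c : conv [:: a; b; c] = conv [:: b; a; c].
Proof.
apply/seteqP; split=> p; rewrite !conv3P => -[l0 [l1 [l2 [h0 h1 h2 hs ->]]]];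
  by exists l1, l0, l2; split=> //; [rewrite -hs; ring|rewrite [X in X + _]addrC].
Qed.

(** A cyclic permutation of the vertices changes neither side of the identity, and a transposition
    changes the sign of both, so the vertices may be sorted by height. *)
Lemma green_x d f f1 f2 a b c : is_poly d f -> partials d f f1 f2 ->
  orient a b c != 0 ->
  Num.sg (orient a b c) * area_int (conv [:: a; b; c]) f1 =
  edge_flux f a b + edge_flux f b c + edge_flux f c a.
Proof.
move=> pf pdf; pose G a b c := orient a b c != 0 ->
  Num.sg (orient a b c) * area_int (conv [:: a; b; c]) f1 =
  edge_flux f a b + edge_flux f b c + edge_flux f c a.
have rot (x y z : R * R) : G x y z -> G y z x.
  rewrite /G (conv3_rot x) => H; have -> : orient y z x = orient x y z.
    by rewrite /orient; ring.
  by move/H ->; ring.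
have flip (x y z : R * R) : G x y z -> G y x z.
  rewrite /G (conv3_flip x) => H; have -> : orient y x z = - orient x y z.
    by rewrite /orient; ring.
  rewrite oppr_eq0 sgrN mulNr => /H ->.
  by rewrite (edge_fluxC y x pf) (edge_fluxC z y pf) (edge_fluxC x z pf); ring.
have sorted (x y z : R * R) : x.2 <= y.2 -> y.2 <= z.2 -> G x y z.
  by move=> xy yz D0; exact: (green_sorted pf pdf xy yz D0).
rewrite -/(G a b c); have [ab|/ltW ba] := leP a.2 b.2; have [bc|/ltW cb] := leP b.2 c.2;
  have [ac|/ltW ca] := leP a.2 c.2.
- exact: sorted.
- exact: sorted.
- by apply: (rot); apply: flip; apply: sorted.
- by apply: (rot); apply: sorted.
- by apply: flip; apply: sorted.
- by apply: (rot); apply: (rot); apply: sorted.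
- by apply: (rot); apply: (rot); apply: flip; apply: sorted.
- by apply: (rot); apply: (rot); apply: flip; apply: sorted.
Qed.
End Green.

(** * The divergence theorem on a triangle *)

Section Divergence.
Context {R : realType}.
Local Notation mu := (@lebesgue_measure R).
Implicit Types (f g : R * R -> R) (a b c p u : R * R) (v : R * R -> R * R).

Lemma is_poly_swap d f : is_poly d f -> is_poly d (f \o swap).
Proof.
move=> pf; apply: (is_poly_ind (P := fun f => is_poly d (f \o swap)) _ _ _ pf).
- exact: is_polyC.
- by move=> g h; exact: is_polyD.
- move=> k i j ij; have -> : (fun p => k * p.1 ^+ i * p.2 ^+ j) \o swap =
      (fun p : R * R => k * p.1 ^+ j * p.2 ^+ i).
    by apply/funext => p /=; ring.
  by apply: is_poly_mono; rewrite addnC.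
Qed.

Lemma partials_swap d f f1 f2 : partials d f f1 f2 ->
  partials d (f \o swap) (f2 \o swap) (f1 \o swap).
Proof.
move=> [p1 p2 Hl]; split; [exact: is_poly_swap..|move=> p u].
have [L [sL LE dL]] := Hl (swap p) (swap u); exists L; split=> // h.
by rewrite dL /= addrC.
Qed.

(** Reflection in the diagonal exchanges the two partial derivatives and reverses the orientation,
    whence the minus sign. *)
Lemma green_y d f f1 f2 a b c : is_poly d f -> partials d f f1 f2 ->
  orient a b c != 0 ->
  Num.sg (orient a b c) * area_int (conv [:: a; b; c]) f2 =
  - (edge_flux (f \o swap) (swap a) (swap b) + edge_flux (f \o swap) (swap b) (swap c) +
     edge_flux (f \o swap) (swap c) (swap a)).
Proof.
move=> pf pdf D0.
have oE : orient (swap a) (swap b) (swap c) = - orient a b c.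
  by rewrite /orient /=; ring.
have D0' : orient (swap a) (swap b) (swap c) != 0 by rewrite oE oppr_eq0.
have := green_x (is_poly_swap pf) (partials_swap pdf) D0' => <-.
rewrite oE sgrN mulNr opprK; congr (_ * _).
rewrite -(area_int_swap (conv3_tame D0)); last by case: pdf => _ /tame_poly.
congr area_int; apply/seteqP; split=> p /=; rewrite !conv3P => -[l0 [l1 [l2 [h0 h1 h2 hs pE]]]];
  exists l0, l1, l2; split => //; first by case: p pE => x y [-> ->].
by rewrite pE.
Qed.

(** The difference quotients of f along u and those of its restriction L at 0 are the same function.
    This identifies the limits in [grad] with polynomials. *)
Lemma partials_derive d f f1 f2 p u : partials d f f1 f2 ->
  'D_u f p = u.1 * f1 p + u.2 * f2 p.
Proof.
move=> [_ _ Hl]; have [L [_ LE dL]] := Hl p u.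
have := dL 0; rewrite scale0r addr0 => <-.
rewrite derivE derive1E /derive; set F := (X in lim (X @ _) = _).
set G := (X in _ = lim (X @ _)); suff -> : F = G by [].
apply/funext => h; rewrite /F /G /=.
by rewrite !LE addr0 [h *: 1]mulr1 scale0r addr0 [h *: u + p]addrC.
Qed.

Definition poly_field (d : nat) v : Prop :=
  forall i : 'I_2, is_poly d (fun p => component i (v p)).

Lemma poly_field_grad d v : poly_field d v ->
  exists g : 'I_2 -> 'I_2 -> R * R -> R,
    [/\ forall i j, is_poly d.-1 (g i j),
        forall i, partials d (fun p => component i (v p)) (g i ord0) (g i ord_max) &
        forall p i j, grad v p i j = g i j p].
Proof.
move=> pv.
have pd i : exists h : (R * R -> R) * (R * R -> R),
    partials d (fun p => component i (v p)) h.1 h.2.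
  by have [f1 [f2 h]] := is_poly_partials (pv i); exists (f1, f2).
have [h hE] := boolp.choice pd.
exists (fun i j => if j == ord0 then (h i).1 else (h i).2); split.
- by move=> i j; case: (hE i) => h1 h2 _; case: ifP.
- by move=> i; exact: hE.
- move=> p i j; rewrite mxE (partials_derive _ _ (hE i)) /unit_vec.
  by case: ifP => _ /=; ring.
Qed.

Lemma sum_ord2 (F : 'I_2 -> R) : \sum_i F i = F ord0 + F ord_max.
Proof. by rewrite big_ord_recl big_ord1; congr (_ + F _); apply/val_inj. Qed.

(** The flux of v across the segment: [tangent (b - a)] is normal to it, has its length, and points
    to the right of the direction from a to b, that is outward when a triangle is traversed
    counterclockwise. *)
Definition vec_flux v a b : R :=
  \int[mu]_(s in `[0, 1]) dot (v ((1 - s) *: a + s *: b)) (tangent (b - a)).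

Lemma segment_line a b (s : R) : (1 - s) *: a + s *: b = a + s *: (b - a).
Proof. by rewrite scalerBl scale1r scalerBr addrAC -addrA. Qed.

Lemma poly_segment_integrable d f a b : is_poly d f ->
  mu.-integrable `[0, 1] (EFin \o (fun s => f ((1 - s) *: a + s *: b))).
Proof.
move=> pf; have [f1 [f2 [_ _ Hl]]] := is_poly_partials pf.
have [L [_ LE _]] := Hl a (b - a).
have -> : (EFin \o (fun s => f ((1 - s) *: a + s *: b))) = EFin \o horner L.
  apply/funext => s /=; rewrite LE; congr (f _)%:E.
  by rewrite segment_line.
exact: horner_integrable.
Qed.

Lemma dive_poly_field d v : poly_field d v -> is_poly d.-1 (dive v).
Proof.
move=> /poly_field_grad[g [pg _ gE]].
have -> : dive v = fun p => g ord0 ord0 p + g ord_max ord_max p.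
  by apply/funext => p; rewrite /dive /mxtrace sum_ord2 !gE.
exact: is_polyD.
Qed.

Lemma triangle_divergence d v a b c : poly_field d v -> orient a b c != 0 ->
  Num.sg (orient a b c) * area_int (conv [:: a; b; c]) (dive v) =
  vec_flux v a b + vec_flux v b c + vec_flux v c a.
Proof.
move=> pv D0; have [g [pg gpd gE]] := poly_field_grad pv.
have -> : dive v = fun p => g ord0 ord0 p + g ord_max ord_max p.
  by apply/funext => p; rewrite /dive /mxtrace sum_ord2 !gE.
rewrite area_intD; [|exact: conv3_tame|exact: tame_poly (pg _ _)..].
rewrite mulrDr (green_x (pv ord0) (gpd ord0) D0) (green_y (pv ord_max) (gpd ord_max) D0).
have fluxE p q : vec_flux v p q = edge_flux (fun p => component ord0 (v p)) p q
    - edge_flux ((fun p => component ord_max (v p)) \o swap) (swap p) (swap q).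
  have i0 := poly_segment_integrable p q (pv ord0).
  have i1 := poly_segment_integrable p q (pv ord_max).
  rewrite /edge_flux /= -!RintegralZl //.
  rewrite -RintegralB //; first last.
  - exact: (poly_segment_integrable p q (is_polyZ _ (pv ord_max))).
  - exact: (poly_segment_integrable p q (is_polyZ _ (pv ord0))).
  by apply: eq_Rintegral => s _; rewrite /dot /= /component /=; ring.
rewrite !fluxE; ring.
Qed.
End Divergence.

(** * Shape regularity *)

Section Geometry.
Context {R : realType}.
Implicit Types (a b c p q u w z : R * R) (r h : R).

Lemma dot_ge0 u : 0 <= dot u u.
Proof. by rewrite /dot -!expr2 addr_ge0 ?sqr_ge0. Qed.

Lemma enorm_ge0 u : 0 <= enorm u. Proof. exact: sqrtr_ge0. Qed.

Lemma enorm_sqr u : enorm u ^+ 2 = dot u u.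
Proof. by rewrite sqr_sqrtr // dot_ge0. Qed.

Lemma enorm_le u r : 0 <= r -> (enorm u <= r) = (dot u u <= r ^+ 2).
Proof.
move=> r0; rewrite -enorm_sqr -[LHS]ler_sqr ?nnegrE ?enorm_ge0 //.
Qed.

Lemma enorm_comp u r : 0 <= r -> enorm u <= r -> `|u.1| <= r /\ `|u.2| <= r.
Proof.
move=> r0; rewrite enorm_le // /dot => h.
have sq (x : R) : x * x <= r ^+ 2 -> `|x| <= r.
  by rewrite -expr2 => hx; rewrite -[r]ger0_norm // -ler_sqr ?nnegrE // !real_normK ?num_real.
have := sqr_ge0 u.1; have := sqr_ge0 u.2 => h1 h2.
by split; apply: sq; nra.
Qed.

Lemma enorm_eq0 u : (enorm u == 0) = (u == 0).
Proof.
rewrite -[LHS](sqrf_eq0 (enorm u)) enorm_sqr /dot.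
rewrite paddr_eq0 ?[X in X && _]mulf_eq0 ?mulf_eq0 -?expr2 ?sqr_ge0 // !orbb.
by case: u => x y; rewrite xpair_eqE.
Qed.

(** Along the diameter of the disc normal to bc, [orient p b c] varies by 2 r |c - b|, and on the
    triangle its values fill an interval of length [|orient a b c|]: the diameter is at most the
    height. *)
Lemma disc_height a b c c0 r : orient a b c != 0 -> 0 < r ->
  (forall p, enorm (p - c0) <= r -> conv [:: a; b; c] p) ->
  2 * r * enorm (c - b) <= `|orient a b c|.
Proof.
move=> D0 r0 disc; set D := orient a b c in D0 *; set L := enorm (c - b).
have L2 : L ^+ 2 = dot (c - b) (c - b) by rewrite enorm_sqr.
have L0 : 0 < L.
  rewrite lt_def enorm_ge0 andbT enorm_eq0 subr_eq0; apply: contra D0 => /eqP cb.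
  by rewrite /D /orient cb; apply/eqP; ring.
pose nu : R * R := L^-1 *: tangent (c - b).
have nu1 : dot nu nu = 1.
  have -> : dot nu nu = dot (c - b) (c - b) / L ^+ 2.
    by rewrite /nu /dot /= !scale_regE; field; rewrite gt_eqF.
  by rewrite -L2 divff // expf_neq0 // gt_eqF.
have inT s : `|s| <= r -> conv [:: a; b; c] (c0 + s *: nu).
  move=> sr; apply: disc; rewrite addrC addKr enorm_le ?(ltW r0) //.
  have -> : dot (s *: nu) (s *: nu) = s ^+ 2 * dot nu nu.
    by rewrite /dot /= !scale_regE; ring.
  by rewrite nu1 mulr1 -[s ^+ 2]real_normK ?num_real // ler_sqr ?nnegrE // (ltW r0).
have bd p : conv [:: a; b; c] p -> 0 <= D * orient p b c <= D ^+ 2.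
  rewrite conv3E // -/D => -[h0 h1 h2]; rewrite h0 /=.
  have <- : D * orient p b c + D * orient a p c + D * orient a b p = D ^+ 2.
    by rewrite /D /orient; ring.
  by rewrite -addrA lerDl addr_ge0.
have lin s : orient (c0 + s *: nu) b c = orient c0 b c - s * L.
  have -> : orient (c0 + s *: nu) b c = orient c0 b c - s * (dot (c - b) (c - b) / L).
    by rewrite /orient /dot /nu /= !scale_regE; field; rewrite gt_eqF.
  by rewrite -L2; field; rewrite gt_eqF.
have rr : `|r| <= r by rewrite ger0_norm // ltW.
have rn : `|- r| <= r by rewrite normrN.
have /bd := inT r rr; rewrite lin => /andP[h1 h2].
have /bd := inT (- r) rn; rewrite lin => /andP[h3 h4].
have rL : 0 <= 2 * r * L by rewrite !mulr_ge0 // ltW.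
rewrite -ler_sqr ?nnegrE // real_normK ?num_real //.
have [Dp|Dn] := leP 0 D.
  have Dp' : 0 < D by rewrite lt_def D0.
  have : D * (2 * r * L) <= D * D by nra.
  rewrite ler_pM2l // => hD; by rewrite ler_sqr ?nnegrE.
have : D * D >= - D * (2 * r * L) by nra.
rewrite -[D * D]mulrNN ler_pM2l ?oppr_gt0 // => hD.
by rewrite -[D ^+ 2]sqrrN ler_sqr ?nnegrE // oppr_ge0 ltW.
Qed.

Lemma cross_le u w : `|u.1 * w.2 - w.1 * u.2| <= enorm u * enorm w.
Proof.
rewrite -ler_sqr ?nnegrE ?mulr_ge0 ?enorm_ge0 // real_normK ?num_real //.
by rewrite exprMn !enorm_sqr /dot; have := sqr_ge0 (u.1 * w.1 + u.2 * w.2); nra.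
Qed.

(** The height bound for the side ab, 2 r |b - a| <= |D|, is compared with |D| <= |c - b| |a -
    b|. *)
Lemma disc_edge a b c c0 r : orient a b c != 0 -> 0 < r ->
  (forall p, enorm (p - c0) <= r -> conv [:: a; b; c] p) ->
  2 * r <= enorm (c - b).
Proof.
move=> D0 r0 disc.
have Dc : orient c a b != 0 by move: D0; rewrite /orient; congr (_ != _); ring.
have disc' : forall p, enorm (p - c0) <= r -> conv [:: c; a; b] p.
  by move=> p /disc; rewrite -conv3_rot.
have := disc_height Dc r0 disc'.
have -> : orient c a b = (c - b).1 * (a - b).2 - (a - b).1 * (c - b).2.
  by rewrite /orient /=; ring.
move=> /le_trans /(_ (cross_le _ _)).
have ba : enorm (b - a) = enorm (a - b) by rewrite /enorm /dot /=; congr Num.sqrt; ring.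
rewrite ba ler_pM2r // lt_def enorm_ge0 andbT enorm_eq0 subr_eq0.
by apply: contra D0 => /eqP ->; rewrite /orient; apply/eqP; ring.
Qed.

(* The homothety of ratio 1/4 centred at (a + 4 b + 4 c) / 9 maps the triangle
   abc into its Clough-Tocher subtriangle with base bc. *)
Lemma sub_square a b c c0 r : 0 < r ->
  (forall p, enorm (p - c0) <= r -> conv [:: a; b; c] p) ->
  exists e : R * R, `[e.1, e.1 + r / 4] `*` `[e.2, e.2 + r / 4] `<=`
    conv [:: 3^-1 *: (a + b + c); b; c].
Proof.
move=> r0 disc; pose g := 9^-1 *: (a + 4 *: b + 4 *: c).
pose c1 := g + 4^-1 *: (c0 - g).
exists (c1 - (r / 8, r / 8)) => q [qa qb].
have /andP[q1 q1'] : c1.1 - r / 8 <= q.1 <= c1.1 - r / 8 + r / 4.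
  by move: qa; rewrite /= in_itv.
have /andP[q2 q2'] : c1.2 - r / 8 <= q.2 <= c1.2 - r / 8 + r / 4.
  by move: qb; rewrite /= in_itv.
(* The preimage of q under the homothety. Its coordinates differ from those of c0 by at most r / 2,
   so it lies in the disc. *)
pose p := c0 + 4 *: (q - c1).
have : conv [:: a; b; c] p.
  apply: disc; rewrite {}/p; clearbody c1.
  rewrite addrC addKr enorm_le ?(ltW r0) // /dot /= !scale_regE.
  have sq (t : R) : - (r / 8) <= t -> t <= r / 8 -> t ^+ 2 <= (r / 8) ^+ 2.
    by move=> t1 t2; rewrite -subr_ge0 subr_sqr mulr_ge0 ?subr_ge0 // -lerBlDl sub0r.
  have d1 : (q.1 - c1.1) ^+ 2 <= (r / 8) ^+ 2 by apply: sq; lra.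
  have d2 : (q.2 - c1.2) ^+ 2 <= (r / 8) ^+ 2 by apply: sq; lra.
  move: d1 d2; rewrite !expr2; have := mulr_ge0 (ltW r0) (ltW r0); lra.
rewrite !conv3P => -[l0 [l1 [l2 [h0 h1 h2 hs pE]]]].
(* With z the barycentre, 3/4 of the centre g equals (z + b + c) / 4, and a = 3 z - b - c in the
   quarter of p; these are the resulting weights of z, b and c. *)
exists (4^-1 + 3 / 4 * l0), (4^-1 + (l1 - l0) / 4), (4^-1 + (l2 - l0) / 4).
split; [lra..|].
have -> : q = c1 + 4^-1 *: (p - c0).
  by rewrite /p [c0 + _]addrC addrK scalerA mulVf ?scale1r ?[c1 + _]addrC ?subrK // pnatr_eq0.
rewrite /c1 /g pE; apply/eqP; rewrite xpair_eqE /= !scale_regE.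
have l2E : l2 = 1 - l0 - l1 by rewrite -hs; ring.
by apply/andP; split; apply/eqP; rewrite l2E; field.
Qed.

(* Since u + w + z = 0, one of |u.w| and |u.z| is at least |u|^2 / 2: u and that
   other edge are neither nearly parallel nor nearly orthogonal. *)
Lemma three_directions (u w z : R * R) (x y qu qw qz r h D : R) :
  u + w + z = 0 -> 0 < r -> 0 < dot u u ->
  dot u u <= h ^+ 2 -> dot w w <= h ^+ 2 -> dot z z <= h ^+ 2 ->
  `|u.1 * w.2 - w.1 * u.2| = D ->
  4 * r ^+ 2 * dot w w <= D ^+ 2 -> 4 * r ^+ 2 * dot z z <= D ^+ 2 ->
  qu * dot u u = (u.1 ^+ 2 - u.2 ^+ 2) * x + 2 * u.1 * u.2 * y ->
  qw * dot w w = (w.1 ^+ 2 - w.2 ^+ 2) * x + 2 * w.1 * w.2 * y ->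
  qz * dot z z = (z.1 ^+ 2 - z.2 ^+ 2) * x + 2 * z.1 * z.2 * y ->
  2 * r ^+ 2 * (x ^+ 2 + y ^+ 2) <= h ^+ 2 * (qu ^+ 2 + qw ^+ 2 + qz ^+ 2).
Proof.
move=> suwz r0 u0 uh wh zh DE rw rz Eu Ew Ez.
have pair (v : R * R) (q : R) : dot v v <= h ^+ 2 ->
    `|u.1 * v.2 - v.1 * u.2| = D -> 4 * r ^+ 2 * dot v v <= D ^+ 2 ->
    q * dot v v = (v.1 ^+ 2 - v.2 ^+ 2) * x + 2 * v.1 * v.2 * y ->
    (dot u u) ^+ 2 <= 4 * (dot u v) ^+ 2 ->
    2 * r ^+ 2 * (x ^+ 2 + y ^+ 2) <= h ^+ 2 * (qu ^+ 2 + q ^+ 2).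
  move=> vh DEv rv Ev uv.
  have v0 : 0 < dot v v.
    rewrite lt_def dot_ge0 andbT; apply/negP => /eqP v0.
    have := uv; rewrite -(enorm_sqr v) in v0; move/eqP: v0; rewrite sqrf_eq0 enorm_eq0 => /eqP ->.
    by rewrite {2}/dot !mulr0 addr0 expr0n mulr0 leNgt exprn_gt0.
  (* The determinant of the two equations for x and y. It equals |u|^2 |v|^2 times the sine of twice
     the angle between u and v, hence degenerates exactly for parallel or orthogonal directions;
     [Sx] and [Sy] are the rule of Cramer. *)
  set S := 2 * (u.1 * v.2 - v.1 * u.2) * dot u v.
  have S2 : S ^+ 2 = 4 * D ^+ 2 * dot u v ^+ 2.
    by rewrite -DEv real_normK ?num_real // /S; ring.
  have Sx : S * x = dot u u * qu * (2 * v.1 * v.2) - dot v v * q * (2 * u.1 * u.2).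
    by rewrite [dot u u * _]mulrC Eu [dot v v * _]mulrC Ev /S /dot; ring.
  have Sy : S * y = dot v v * q * (u.1 ^+ 2 - u.2 ^+ 2) - dot u u * qu * (v.1 ^+ 2 - v.2 ^+ 2).
    by rewrite [dot u u * _]mulrC Eu [dot v v * _]mulrC Ev /S /dot; ring.
  have key : S ^+ 2 * (x ^+ 2 + y ^+ 2) <= 2 * dot u u ^+ 2 * dot v v ^+ 2 * (qu ^+ 2 + q ^+ 2).
    have -> : S ^+ 2 * (x ^+ 2 + y ^+ 2) = (S * x) ^+ 2 + (S * y) ^+ 2 by ring.
    rewrite Sx Sy.
    set A := dot u u * qu; set B := dot v v * q.
    have -> : 2 * dot u u ^+ 2 * dot v v ^+ 2 * (qu ^+ 2 + q ^+ 2) =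
        2 * (A ^+ 2 * dot v v ^+ 2 + B ^+ 2 * dot u u ^+ 2) by rewrite /A /B; ring.
    have := sqr_ge0 (A * (2 * v.1 * v.2) + B * (2 * u.1 * u.2)).
    have := sqr_ge0 (B * (u.1 ^+ 2 - u.2 ^+ 2) + A * (v.1 ^+ 2 - v.2 ^+ 2)).
    have <- : A ^+ 2 * ((2 * v.1 * v.2) ^+ 2 + (v.1 ^+ 2 - v.2 ^+ 2) ^+ 2) = A ^+ 2 * dot v v ^+ 2.
      by rewrite /dot; ring.
    have <- : B ^+ 2 * ((2 * u.1 * u.2) ^+ 2 + (u.1 ^+ 2 - u.2 ^+ 2) ^+ 2) = B ^+ 2 * dot u u ^+ 2.
      by rewrite /dot; ring.
    lra.
  have lowS : 4 * r ^+ 2 * dot v v * dot u u ^+ 2 <= S ^+ 2.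
    have -> : S ^+ 2 = D ^+ 2 * (4 * dot u v ^+ 2) by rewrite S2; ring.
    have rv0 : 0 <= 4 * r ^+ 2 * dot v v.
      by apply: mulr_ge0; [apply: mulr_ge0; [exact: ler0n|exact: sqr_ge0]|exact: dot_ge0].
    by apply: ler_pM => //; exact: sqr_ge0.
  have xy0 : 0 <= x ^+ 2 + y ^+ 2 by rewrite addr_ge0 ?sqr_ge0.
  have q0 : 0 <= qu ^+ 2 + q ^+ 2 by rewrite addr_ge0 ?sqr_ge0.
  have main : 4 * r ^+ 2 * dot v v * dot u u ^+ 2 * (x ^+ 2 + y ^+ 2) <=
      2 * dot u u ^+ 2 * dot v v ^+ 2 * (qu ^+ 2 + q ^+ 2).
    by apply: le_trans key; rewrite ler_wpM2r.
  have : 2 * r ^+ 2 * (x ^+ 2 + y ^+ 2) <= dot v v * (qu ^+ 2 + q ^+ 2).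
    have c0 : 0 < 2 * dot v v * dot u u ^+ 2 by rewrite !mulr_gt0 // exprn_gt0.
    rewrite -(ler_pM2l c0); apply: le_trans (le_trans main _); rewrite le_eqVlt; apply/orP; left; apply/eqP; ring.
  by move=> /le_trans; apply; rewrite ler_wpM2r.
have h2 : 0 <= h ^+ 2 by exact: sqr_ge0.
have uu : dot u u = - dot u w - dot u z.
  have -> : u = - (w + z) by apply/eqP; rewrite -addr_eq0 addrA suwz.
  by rewrite /dot /=; ring.
have [uw|uw] := leP (dot u u ^+ 2) (4 * dot u w ^+ 2).
  apply: (le_trans (pair w qw wh DE rw Ew uw)).
  by rewrite ler_wpM2l // lerDl sqr_ge0.
have uz : dot u u ^+ 2 <= 4 * dot u z ^+ 2.
  move: uw; rewrite uu; set A := dot u w; set B := dot u z => uw.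
  nra.
apply: (le_trans (pair z qz zh _ rz Ez uz)).
  rewrite -DE; have -> : z = - (u + w) by apply/eqP; rewrite -addr_eq0 addrC suwz.
  by rewrite -normrN /=; congr (`|_|); ring.
by rewrite ler_wpM2l // lerD2r lerDl sqr_ge0.
Qed.
End Geometry.

(** * Sides of a line and unit normals *)

Section Sides.
Context {R : realType}.
Implicit Types (a b c m p q u w y z : R * R).

Lemma affine_coords a y z p : orient a y z != 0 ->
  exists l0 l1 l2 : R, [/\ l0 + l1 + l2 = 1, p = l0 *: a + l1 *: y + l2 *: z &
    orient y z p = l0 * orient y z a].
Proof.
move=> D0; exists (orient p y z / orient a y z), (orient a p z / orient a y z),
  (orient a y p / orient a y z); split.
- by rewrite -!mulrDl -[RHS](divff D0); congr (_ / _); rewrite /orient; ring.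
- case: p => p1 p2; apply/eqP; rewrite xpair_eqE /= !scale_regE; apply/andP.
  by move: D0; rewrite /orient /= => D0; split; apply/eqP; field.
- have -> : orient y z a = orient a y z by rewrite /orient; ring.
  by rewrite divfK // /orient; ring.
Qed.

(** A point near the midpoint of yz, moved slightly towards a, lies in both triangles and off the
    line. It will show that two elements on the same side of an edge overlap. *)
Lemma same_side_overlap a a' y z : 0 < orient y z a * orient y z a' ->
  exists p, [/\ conv [:: a; y; z] p, conv [:: a'; y; z] p & orient y z p != 0].
Proof.
move=> side; have a'0 : orient y z a' != 0.
  by apply: contraTN side => /eqP ->; rewrite mulr0 ltxx.
have a0 : orient y z a != 0.
  by apply: contraTN side => /eqP ->; rewrite mul0r ltxx.
have D0 : orient a' y z != 0 by move: a'0; rewrite /orient; congr (_ != _); ring.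
have [g [al [be [s1 aE sE]]]] := affine_coords a D0.
have g0 : 0 < g.
  move: side; rewrite sE -mulrA -expr2 pmulr_lgt0 // lt_def sqr_ge0 andbT.
  by rewrite expf_neq0.
(* With e = 1 / N, the weights (1 - e) / 2 of y and z stay nonnegative after the corrections e al
   and e be that come from expressing a in terms of a', y and z. *)
pose N := 2 * (1 + `|al| + `|be|); pose e := N^-1.
have al0 := normr_ge0 al; have be0 := normr_ge0 be.
have N0 : 0 < N by rewrite /N; lra.
have e0 : 0 < e by rewrite invr_gt0.
have eN : e * N = 1 by rewrite mulVf // gt_eqF.
have eal : e * `|al| <= 1 / 2 - e by move: eN; rewrite /N; have := mulr_ge0 (ltW e0) be0; lra.
have ebe : e * `|be| <= 1 / 2 - e by move: eN; rewrite /N; have := mulr_ge0 (ltW e0) al0; lra.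
have nal : - (e * `|al|) <= e * al by rewrite -mulrN ler_pM2l // lerNl ler_normr lexx orbT.
have nbe : - (e * `|be|) <= e * be by rewrite -mulrN ler_pM2l // lerNl ler_normr lexx orbT.
have eal0 := mulr_ge0 (ltW e0) al0.
exists (e *: a + ((1 - e) / 2) *: y + ((1 - e) / 2) *: z); split.
- by apply/conv3P; exists e, ((1 - e) / 2), ((1 - e) / 2); split=> //; lra.
- apply/conv3P; exists (e * g), ((1 - e) / 2 + e * al), ((1 - e) / 2 + e * be).
  split; [by rewrite mulr_ge0 // ltW|lra|lra| |].
    have -> : e * g + ((1 - e) / 2 + e * al) + ((1 - e) / 2 + e * be) =
      e * (g + al + be) + (1 - e) by field.
    by rewrite s1; ring.
  rewrite aE; apply/eqP; rewrite xpair_eqE /= !scale_regE.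
  by apply/andP; split; apply/eqP; ring.
- rewrite [X in X != 0](_ : _ = e * orient y z a).
    by rewrite mulf_neq0 // gt_eqF.
  by rewrite /orient /= !scale_regE; field.
Qed.

Lemma orient_normal y z p (n : R * R) : enorm n = 1 -> dot n (z - y) = 0 ->
  orient y z p = dot (z - y) (tangent n) * dot n (p - y).
Proof.
move=> /(congr1 (fun x => x ^+ 2)); rewrite enorm_sqr expr1n => n1 nz.
have -> : orient y z p = orient y z p * dot n n + dot n (z - y) * dot (tangent n) (p - y).
  by rewrite n1 nz mul0r addr0 mulr1.
by rewrite /orient /dot /tangent /=; ring.
Qed.

Lemma orth_tangent u m : dot m m = 1 -> dot m u = 0 ->
  u = dot u (tangent m) *: tangent m.
Proof.
case: u m => u1 u2 [m1 m2]; rewrite /dot /tangent /= => mm mu.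
apply/eqP; rewrite xpair_eqE /= !scale_regE; apply/andP; split; apply/eqP.
  transitivity ((m1 * m1 + m2 * m2) * u1 - (m1 * u1 + m2 * u2) * m1); last by ring.
  by rewrite mm mu; ring.
transitivity ((m1 * m1 + m2 * m2) * u2 - (m1 * u1 + m2 * u2) * m2); last by ring.
by rewrite mm mu; ring.
Qed.

Lemma normal_edge_length y z (n : R * R) : enorm n = 1 -> dot n (z - y) = 0 ->
  dot (z - y) (tangent n) ^+ 2 = dot (z - y) (z - y).
Proof.
move=> /(congr1 (fun x => x ^+ 2)); rewrite enorm_sqr expr1n => n1 nz.
have -> : dot (z - y) (z - y) = dot (z - y) (z - y) * dot n n - dot n (z - y) ^+ 2.
  by rewrite n1 nz expr0n mulr1 subr0.
by rewrite /dot /tangent /=; ring.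
Qed.

Lemma affine_limit_ge0 (A B : R) :
  (forall e, 0 < e -> exists t, [/\ 0 < t, t < e & 0 <= A + t * B]) -> 0 <= A.
Proof.
move=> H; rewrite leNgt; apply/negP => A0.
have B0 : 0 < `|B| + 1 by rewrite ltr_wpDl.
have [|t [t0 te]] := H (- A / (`|B| + 1)); first by rewrite divr_gt0 // oppr_gt0.
move: te; rewrite ltr_pdivlMr // => te; apply/negP; rewrite -ltNge.
have : t * B <= t * (`|B| + 1) by rewrite ler_pM2l // (le_trans (ler_norm _)) // lerDl.
lra.
Qed.
End Sides.

Section Ordinals3.
Implicit Types i j : 'I_3.

Lemma ord3_cases i : [\/ i = 0, i = 1 | i = 2%:R].
Proof.
by case: i => [[|[|[|]]]] // ?; [constructor 1|constructor 2|constructor 3]; apply/val_inj.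
Qed.

(** Addition in 'I_3 is modulo 3: i + 1 and i + 2 name the other two vertices in cyclic order, and
    the three edges of an element are handled by one argument. *)
Lemma setC1_ord3 i : [set~ i]%SET = [set i + 1; i + 2%:R]%SET.
Proof. by apply/setP => j; case: (ord3_cases i) => ->; case: (ord3_cases j) => ->; rewrite !inE. Qed.

Lemma ord3_addE : ((((0 + 1)%R = 1%R :> 'I_3) * ((0 + 2%:R)%R = 2%:R%R :> 'I_3)) *
  (((1 + 1)%R = 2%:R%R :> 'I_3) * ((1 + 2%:R)%R = 0%R :> 'I_3)) *
  (((2%:R + 1)%R = 0%R :> 'I_3) * ((2%:R + 2%:R)%R = 1%R :> 'I_3)))%type.
Proof. by do !split; apply/val_inj. Qed.

Lemma enum_ord3 : enum 'I_3 = [:: 0; 1; 2%:R].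
Proof. by apply: (inj_map val_inj); rewrite val_enum_ord. Qed.
End Ordinals3.

(** * Conforming meshes *)

Section Hulls.
Context {R : realType}.

Lemma conv_mapP (T : eqType) (f : T -> R * R) (s : seq T) (p : R * R) : uniq s ->
  conv (map f s) p <-> exists l : T -> R,
    [/\ forall z, z \in s -> 0 <= l z, \sum_(z <- s) l z = 1 &
        p = \sum_(z <- s) l z *: f z].
Proof.
move=> us; split=> [[l [l0 l1 ->]]|[l [l0 l1 ->]]].
  pose g z := if insub (index z s) is Some i then l i else 0.
  have gE (i : 'I_(size (map f s))) x0 : g (nth x0 s i) = l i.
    have iS : (i < size s)%N by rewrite -(size_map f).
    by rewrite /g index_uniq // valK.
  exists g; split=> [z _||]; first by rewrite /g; case: insubP.
    rewrite -l1; case: s us l l0 l1 g gE => [|x0 s'] us l l0 l1 g gE; first by rewrite big_nil big_ord0.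
    rewrite (big_nth x0) big_mkord -(size_map f).
    by apply: eq_bigr => i _; exact: gE.
  case: s us l l0 l1 g gE => [|x0 s'] us l l0 l1 g gE; first by rewrite big_nil big_ord0.
  rewrite (big_nth x0) big_mkord -(size_map f).
  apply: eq_bigr => i _; rewrite gE (nth_map x0) //.
  by rewrite -(size_map f).
case: s us l0 l1 => [|x0 s'] us l0 l1.
  by move: l1; rewrite big_nil => /esym/eqP; rewrite oner_eq0.
exists (fun i => l (nth x0 (x0 :: s') i)); split.
- by move=> i; apply: l0; apply: mem_nth; rewrite -(size_map f).
- by rewrite -l1 [RHS](big_nth x0) big_mkord -(size_map f).
- rewrite [LHS](big_nth x0) big_mkord -(size_map f).
  by apply: eq_bigr => i _; rewrite (nth_map x0) // -(size_map f).
Qed.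
End Hulls.

Section MeshGeometry.
Context {R : realType}.
Variables (Th : mesh R) (Omega : set (R * R)).
Implicit Types (K : elt Th) (i j : 'I_3) (s : sub_elt Th) (F : {set node Th}).

Lemma hullP F p : hull F p <-> exists l : node Th -> R,
    [/\ forall z, z \in F -> 0 <= l z, \sum_(z in F) l z = 1 &
        p = \sum_(z in F) l z *: coord z].
Proof.
rewrite /hull conv_mapP ?enum_uniq //; split=> -[l [l0 l1 ->]]; exists l; split.
- by move=> z zF; apply: l0; rewrite mem_enum.
- by rewrite -l1 big_enum.
- by rewrite big_enum.
- by move=> z; rewrite mem_enum; exact: l0.
- by rewrite -l1 big_enum.
- by rewrite big_enum.
Qed.

Lemma hull2P (y z : node Th) p : y != z -> hull [set y; z]%SET p <->
  exists s : R, 0 <= s <= 1 /\ p = (1 - s) *: coord y + s *: coord z.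
Proof.
move=> yz; rewrite hullP; split=> [[l [l0 l1 ->]]|[s [/andP[s0 s1] ->]]].
  move: l1; rewrite !big_setU1 ?inE //= !big_set1 => l1.
  exists (l z); split.
    have := l0 y; have := l0 z; rewrite !inE !eqxx orbT => /(_ isT) h1 /(_ isT) h2.
    by rewrite h1 -l1 lerDr.
  by rewrite -l1 addrK.
exists (fun x => if x == z then s else 1 - s); split.
- by move=> x _; case: ifP => _; rewrite ?subr_ge0.
- by rewrite !big_setU1 ?inE //= !big_set1 eqxx (negbTE yz) subrK.
- by rewrite !big_setU1 ?inE //= !big_set1 eqxx (negbTE yz).
Qed.

Lemma apex_cell i K : cell K = conv [:: apex K i; apex K (i + 1); apex K (i + 2%:R)].
Proof.
have -> : cell K = conv [:: apex K 0; apex K 1; apex K 2%:R] by rewrite /cell enum_ord3.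
case: (ord3_cases i) => ->; rewrite !ord3_addE //; first by rewrite conv3_rot.
by rewrite -conv3_rot.
Qed.

Lemma apex_sub_cell i K : sub_cell (K, i) =
  conv [:: 3%:R^-1 *: (apex K i + apex K (i + 1) + apex K (i + 2%:R));
        apex K (i + 1); apex K (i + 2%:R)].
Proof.
have bE : bary K = 3%:R^-1 *: (apex K 0 + apex K 1 + apex K 2%:R).
  rewrite /bary !big_ord_recl big_ord0 addr0 addrA.
  by congr (_ *: (_ + _ + _)); congr apex; apply/val_inj.
rewrite /sub_cell enum_ord3 /= bE; case: (ord3_cases i) => -> /=.
- by rewrite !ord3_addE.
- rewrite !ord3_addE conv3_rot conv3_flip -conv3_rot.
  by congr (conv [:: _ *: _; _; _]); rewrite -addrA [LHS]addrC.
- by rewrite !ord3_addE; congr (conv [:: _ *: _; _; _]); rewrite [LHS]addrC addrA.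
Qed.

Lemma orient_apex i K : orient (apex K i) (apex K (i + 1)) (apex K (i + 2%:R)) =
  orient (apex K 0) (apex K 1) (apex K 2%:R).
Proof.
case: (ord3_cases i) => ->; rewrite !ord3_addE //;
  by rewrite /orient; ring.
Qed.

Hypothesis HT : triangulation Th Omega.

Lemma apex_orient_neq0 i K :
  orient (apex K i) (apex K (i + 1)) (apex K (i + 2%:R)) != 0.
Proof. by rewrite orient_apex; case: HT => _ _ nc _ _; exact: nc. Qed.

Lemma vert_inj K : injective (vert K).
Proof.
have D0 := apex_orient_neq0 0 K; rewrite !ord3_addE in D0.
have h01 : vert K 0 != vert K 1.
  by apply: contra D0 => /eqP e; rewrite /orient /apex e; apply/eqP; ring.
have h02 : vert K 0 != vert K 2%:R.
  by apply: contra D0 => /eqP e; rewrite /orient /apex e; apply/eqP; ring.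
have h12 : vert K 1 != vert K 2%:R.
  by apply: contra D0 => /eqP e; rewrite /orient /apex e; apply/eqP; ring.
move=> i j; case: (ord3_cases i) => ->; case: (ord3_cases j) => -> // /eqP;
  rewrite ?(negbTE h01) ?(negbTE h02) ?(negbTE h12) // eq_sym
    ?(negbTE h01) ?(negbTE h02) ?(negbTE h12) //.
Qed.

Lemma outer_edgeE K i : outer_edge (K, i) =
  [set vert K (i + 1); vert K (i + 2%:R)]%SET.
Proof. by rewrite /outer_edge /= setC1_ord3 imsetU !imset_set1. Qed.

Lemma ord3_neq i : [/\ i + 1 != i, i + 2%:R != i & i + 1 != i + 2%:R].
Proof. by case: (ord3_cases i) => ->. Qed.

Lemma outer_edge_neq K i : vert K (i + 1) != vert K (i + 2%:R).
Proof. by rewrite (inj_eq (@vert_inj K)); case: (ord3_neq i). Qed.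

Lemma vertsE K i : verts K = (vert K i |: outer_edge (K, i))%SET.
Proof.
rewrite /verts outer_edgeE; apply/setP => z; rewrite !inE; apply/imsetP/idP.
  move=> [j _ ->]; have [->|ji] := eqVneq j i; first by rewrite eqxx.
  have : j \in [set~ i]%SET by rewrite !inE.
  by rewrite setC1_ord3 !inE => /orP[] /eqP ->; rewrite eqxx ?orbT.
by case/or3P => /eqP ->; [exists i|exists (i + 1)|exists (i + 2%:R)].
Qed.

Lemma apex_notin_outer K i : vert K i \notin outer_edge (K, i).
Proof.
rewrite outer_edgeE !inE !(inj_eq (@vert_inj K)) eq_sym [i == _]eq_sym.
by case: (ord3_neq i) => /negbTE -> /negbTE -> _.
Qed.

Lemma outer_edge_apex K i F : outer_edge (K, i) = F -> F \subset verts K.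
Proof. by move=> <-; rewrite (vertsE K i) finset.subsetUr. Qed.

Lemma outer_edge_inj K : injective (fun i => outer_edge (K, i)).
Proof.
move=> i j e; apply/eqP/negP => /negP ij.
have : vert K i \in outer_edge (K, j).
  by apply/imsetP; exists i; rewrite // !inE.
by rewrite -e (negbTE (apex_notin_outer K i)).
Qed.

(* orient (coord y) (coord z) tells the sides of the line through y and z apart *)
Lemma same_side_unique K i K' i' (y z : node Th) :
  outer_edge (K, i) = [set y; z]%SET -> outer_edge (K', i') = [set y; z]%SET -> y != z ->
  0 < orient (coord y) (coord z) (apex K i) * orient (coord y) (coord z) (apex K' i') ->
  (K, i) = (K', i').
Proof.
move=> E E' yz side.
have [KK|KK] := eqVneq K K'.
  subst K'; congr (_, _); apply: (@outer_edge_inj K) => /=.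
  by rewrite E E'.
have cE L l : outer_edge (L, l) = [set y; z]%SET ->
    cell L = conv [:: apex L l; coord y; coord z].
  rewrite outer_edgeE => e; rewrite (apex_cell l) /apex.
  have : vert L (l + 1) \in [set y; z]%SET by rewrite -e !inE eqxx.
  have : vert L (l + 2%:R) \in [set y; z]%SET by rewrite -e !inE eqxx orbT.
  have := outer_edge_neq L l; rewrite !inE => ne.
  move=> /orP[] /eqP e2 /orP[] /eqP e1.
  - by move: ne; rewrite e1 e2 eqxx.
  - by rewrite e1 e2 conv3_rot conv3_flip -conv3_rot conv3_flip -conv3_rot.
  - by rewrite e1 e2.
  - by move: ne; rewrite e1 e2 eqxx.
have [p [pK pK' pF]] := same_side_overlap side.
have : (cell K `&` cell K') p by rewrite (cE _ _ E) (cE _ _ E').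
case: HT => _ verts_inj _ inter _; rewrite inter.
(* Three shared vertices would make the elements equal, so the cells meet exactly in the edge yz;
   but p lies in both cells and off the line. *)
have -> : (verts K :&: verts K')%SET = [set y; z]%SET.
  apply/eqP; rewrite eq_sym eqEcard; apply/andP; split.
    by rewrite finset.subsetI (outer_edge_apex E) (outer_edge_apex E').
  rewrite leqNgt; apply/negP => h.
  have c3 L l : outer_edge (L, l) = [set y; z]%SET -> #|verts L| = 3%N.
    by move=> e; rewrite (vertsE L l) cardsU1 apex_notin_outer e cards2 yz.
  move: h; rewrite cards2 yz => h.
  have /eqP : verts K = verts K'.
    transitivity (verts K :&: verts K')%SET.
      by apply/esym/eqP; rewrite eqEcard finset.subsetIl (c3 _ _ E).
    by apply/eqP; rewrite eqEcard finset.subsetIr (c3 _ _ E').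
  by rewrite (inj_eq verts_inj) (negbTE KK).
move=> /(hull2P _ yz) [t [_ pE]]; exfalso; move/negP: pF; apply.
by rewrite pE /orient /= !scale_regE; apply/eqP; ring.
Qed.
End MeshGeometry.

(** * Interior edges have a second element *)

Section Topology.
Context {R : realType}.
Variables (Th : mesh R) (Omega : set (R * R)).
Hypothesis HT : triangulation Th Omega.
Implicit Types (K : elt Th) (i j : 'I_3) (s : sub_elt Th) (F : {set node Th}).

(** The reciprocal of 1 plus the sum of all reciprocals is below every value, and makes sense for an
    empty T as well. *)
Lemma fin_lower_bound (T : finType) (eta : T -> R) : (forall x, 0 < eta x) ->
  exists2 e : R, 0 < e & forall x, e <= eta x.
Proof.
move=> eta0; have S0 : 0 <= \sum_x (eta x)^-1.
  by apply: sumr_ge0 => x _; rewrite invr_ge0 ltW.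
exists (1 + \sum_x (eta x)^-1)^-1 => [|x]; first by rewrite invr_gt0 ltr_wpDr.
rewrite -[leRHS]invrK lef_pV2 ?posrE ?invr_gt0 ?ltr_wpDr //.
by rewrite (bigD1 x) //= addrCA lerDl addr_ge0 // sumr_ge0 // => z _; rewrite invr_ge0 ltW.
Qed.

(** Each of the three conditions for a triangle is affine in t and holds for arbitrarily small t >
    0, hence at t = 0. *)
Lemma cell_limit K (p v : R * R) :
  (forall e, 0 < e -> exists t : R, [/\ 0 < t, t < e & cell K (p - t *: v)]) -> cell K p.
Proof.
have D0 := apex_orient_neq0 HT 0 K; rewrite (apex_cell 0).
set a := apex K 0; set b := apex K _; set c := apex K _.
set D := orient a b c => H; rewrite conv3E // -/D; split.
- apply: (@affine_limit_ge0 _ _ (D * (v.2 * b.1 - v.2 * c.1 + v.1 * c.2 - v.1 * b.2))).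
  move=> e /H[t [t0 te]]; rewrite conv3E // -/D => -[h _ _]; exists t; split=> //.
  by move: h; congr (0 <= _); rewrite /orient /= !scale_regE; ring.
- apply: (@affine_limit_ge0 _ _ (D * (v.2 * c.1 - v.2 * a.1 + v.1 * a.2 - v.1 * c.2))).
  move=> e /H[t [t0 te]]; rewrite conv3E // -/D => -[_ h _]; exists t; split=> //.
  by move: h; congr (0 <= _); rewrite /orient /= !scale_regE; ring.
- apply: (@affine_limit_ge0 _ _ (D * (v.2 * a.1 - v.2 * b.1 + v.1 * b.2 - v.1 * a.2))).
  move=> e /H[t [t0 te]]; rewrite conv3E // -/D => -[_ _ h]; exists t; split=> //.
  by move: h; congr (0 <= _); rewrite /orient /= !scale_regE; ring.
Qed.

(** The three indices add up to 0 modulo 3, so the third one is - (i + j). *)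
Lemma ord3_third i j : i != j -> exists k, [set k + 1; k + 2%:R]%SET = [set i; j]%SET.
Proof.
suff H k : i != j -> k != i -> k != j -> [set k + 1; k + 2%:R]%SET = [set i; j]%SET.
  move=> ij; exists (- (i + j)); apply: H => //.
    by move: ij; case: (ord3_cases i) => ->; case: (ord3_cases j) => ->.
  by move: ij; case: (ord3_cases i) => ->; case: (ord3_cases j) => ->.
move=> ij ki kj; rewrite -setC1_ord3; apply/setP => l; rewrite !inE.
by move: ij ki kj; case: (ord3_cases i) => ->; case: (ord3_cases j) => ->;
  case: (ord3_cases k) => ->; case: (ord3_cases l) => ->.
Qed.

(* Points close to the edge and beyond it lie in the domain, hence infinitely
   many of them in one same cell; that cell contains a relative interior point
   of the edge and thus, the mesh being conforming, the whole edge. *)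
Lemma interior_edge_neighbour s : interior_edge Omega (outer_edge s) ->
  exists2 s', s' != s & outer_edge s' = outer_edge s.
Proof.
case: s => K i [_ /existsNP[p /not_implyP[pF pb]]].
set y := vert K (i + 1); set z := vert K (i + 2%:R).
have yz : y != z := outer_edge_neq HT K i.
set Y := coord y; set Z := coord z; set a := apex K i.
have D0 : orient a Y Z != 0 := apex_orient_neq0 HT i K.
have cK : cell K = conv [:: a; Y; Z] := apex_cell i K.
move: (pF); rewrite outer_edgeE (hull2P _ yz) => -[t [/andP[t0 t1] pE]].
have pK : cell K p.
  rewrite cK conv3P; exists 0, (1 - t), t; split; rewrite ?subr_ge0 //; first by ring.
  by rewrite scale0r add0r.
have [_ _ _ inter cover] := HT.
(* An interior edge is only known to have one point p off the boundary; as p is in the closure, it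
   is interior to the domain. *)
have pint : nbhs p Omega.
  have : closure Omega p by rewrite cover; exists K.
  by move=> pc; apply: contrapT => pn; apply: pb; split.
have [e /= e0 eO] := (nbhs_ballP p Omega).1 pint.
(* Since p may be an endpoint, it is first moved towards the midpoint of the edge, by less than half
   of the radius e of the neighbourhood; the other half is left for the step beyond the edge. *)
pose dm := 2^-1 *: (Y + Z) - p; pose C0 := `|dm.1| + `|dm.2| + 1.
have C00 : 0 < C0 by rewrite ltr_wpDl ?addr_ge0.
pose t' := Num.min 1 (e / (2 * C0)).
have t'0 : 0 < t' by rewrite lt_min ltr01 /= divr_gt0 // mulr_gt0.
have t'1 : t' <= 1 by rewrite ge_min lexx.
have t'e : t' * C0 <= e / 2.
  have : t' <= e / (2 * C0) by rewrite ge_min lexx orbT.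
  by rewrite -(ler_pM2r C00) => /le_trans; apply; rewrite le_eqVlt; apply/orP; left; apply/eqP; field; rewrite gt_eqF.
pose m := p + t' *: dm.
pose r := (1 - t') * t + t' / 2.
have r0 : 0 < r by rewrite ltr_wpDl ?mulr_ge0 ?subr_ge0 // divr_gt0.
have r1 : r < 1.
  have : 0 < t' / 2 by rewrite divr_gt0.
  rewrite /r; have : 0 <= (1 - t') * (1 - t) by rewrite mulr_ge0 // subr_ge0.
  lra.
have mE : m = (1 - r) *: Y + r *: Z.
  rewrite /m /dm /r pE; apply/eqP; rewrite xpair_eqE /= !scale_regE.
  by apply/andP; split; apply/eqP; field.
pose v := a - m; pose C1 := `|v.1| + `|v.2| + 1.
have C10 : 0 < C1 by rewrite ltr_wpDl ?addr_ge0.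
have near d : 0 < d -> d < e / (2 * C1) -> Omega (m - d *: v).
  move=> d0 de; have dC : d * C1 < e / 2.
    by move: de; rewrite -(ltr_pM2r C10) => /lt_le_trans; apply; rewrite le_eqVlt; apply/orP; left; apply/eqP; field; rewrite gt_eqF.
  have bd (A B x1 x2 : R) : `|x1| + 1 <= C0 -> `|x2| + 1 <= C1 -> `|A - (A + t' * x1 - d * x2)| < e.
    move=> h1 h2; rewrite (_ : A - _ = d * x2 - t' * x1); last by ring.
    rewrite (le_lt_trans (ler_normB _ _)) // !normrM (gtr0_norm d0) (gtr0_norm t'0).
    have : t' * `|x1| <= t' * C0 by rewrite ler_pM2l //; lra.
    have : d * `|x2| <= d * C1 by rewrite ler_pM2l //; lra.
    lra.
  apply: eO; split; rewrite /ball /=; apply: bd => //;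
    rewrite ?/C0 ?/C1 lerD2r ?lerDl ?lerDr //.
(* Otherwise each cell misses all sufficiently near points of the ray; as there are finitely many
   cells, some point of the domain on the ray would lie in none. *)
have [K' K'P] : exists K', forall eta, 0 < eta -> exists d, [/\ 0 < d, d < eta & cell K' (m - d *: v)].
  apply: contrapT => /forallNP H.
  have {}H K' : exists eta, 0 < eta /\ forall d, 0 < d -> d < eta -> ~ cell K' (m - d *: v).
    have /existsNP[eta /not_implyP[eta0 Heta]] := H K'; exists eta; split=> // d d0 de cd.
    by apply: Heta; exists d.
  have [eta etaP] := boolp.choice H.
  have [e1 e10 e1P] := fin_lower_bound (fun K' => (etaP K').1).
  pose d := Num.min e1 (e / (2 * C1)) / 2.
  have mm : 0 < Num.min e1 (e / (2 * C1)) by rewrite lt_min e10 divr_gt0 // mulr_gt0.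
  have d0 : 0 < d by rewrite divr_gt0.
  have dm' : d < Num.min e1 (e / (2 * C1)) by rewrite ltr_pdivrMr // ltr_pMr // ltr1n.
  have /(near d d0) /subset_closure : d < e / (2 * C1) by apply: lt_le_trans dm' _; rewrite ge_min lexx orbT.
  rewrite cover => -[K' _]; apply: (etaP K').2 => //.
  by apply: lt_le_trans dm' _; rewrite ge_min e1P.
(* Beyond the edge the barycentric coordinate at a, relative to K, is negative. *)
have KK' : K' != K.
  apply/eqP => KK'; subst K'; have [d [d0 _]] := K'P 1 ltr01.
  rewrite cK conv3E // => -[+ _ _].
  have -> : orient (m - d *: v) Y Z = - d * orient a Y Z.
    by rewrite /v mE /orient /= !scale_regE; ring.
  rewrite mulrCA mulNr oppr_ge0 -expr2 leNgt mulr_gt0 // lt_def sqr_ge0 andbT.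
  by rewrite expf_neq0.
have mK' : cell K' m := cell_limit K'P.
have mK : cell K m.
  rewrite cK conv3P; exists 0, (1 - r), r; split; rewrite ?subr_ge0 // ?ltW //; first by ring.
  by rewrite scale0r add0r -mE.
have : (cell K `&` cell K') m by [].
rewrite inter hullP => -[l [_ l1 ml]].
(* The point m is a combination of the shared vertices alone. Barycentric coordinates in K are
   unique and those of m at y and z are positive, so y and z are shared. *)
pose l' x := if x \in verts K' then l x else 0.
have sumV (T : zmodType) (g : node Th -> T) :
   \sum_(x in (verts K :&: verts K')%SET) g x = \sum_(x in verts K) (if x \in verts K' then g x else 0).
  rewrite -big_mkcondr; apply: eq_bigl => x; by rewrite inE.
have sum3 (T : zmodType) (g : node Th -> T) :
   \sum_(x in verts K) g x = g (vert K i) + (g y + g z).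
  rewrite (vertsE K i) big_setU1 ?(apex_notin_outer HT) //= outer_edgeE.
  by rewrite big_setU1 ?inE //= big_set1.
have l1' : l' (vert K i) + (l' y + l' z) = 1 by rewrite -l1 sumV sum3.
have ml' : m = l' (vert K i) *: a + (l' y *: Y + l' z *: Z).
  rewrite ml sumV sum3 /l'.
  by congr (_ + (_ + _)); case: ifP => // _; rewrite scale0r.
have ly : l' y = 1 - r.
  apply: (mulIf D0); transitivity (orient a m Z).
    rewrite ml' /orient /= !scale_regE.
    have -> : l' (vert K i) = 1 - l' y - l' z by rewrite -l1'; ring.
    by ring.
  by rewrite mE /orient /= !scale_regE; ring.
have lz : l' z = r.
  apply: (mulIf D0); transitivity (orient a Y m).
    rewrite ml' /orient /= !scale_regE.
    have -> : l' (vert K i) = 1 - l' y - l' z by rewrite -l1'; ring.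
    by ring.
  by rewrite mE /orient /= !scale_regE; ring.
have /imsetP[j _ yj] : y \in verts K'.
  by apply: contraT => h; move: ly; rewrite /l' (negbTE h) => /eqP; rewrite lt_eqF // subr_gt0.
have /imsetP[k _ zk] : z \in verts K'.
  by apply: contraT => h; move: lz; rewrite /l' (negbTE h) => /eqP; rewrite lt_eqF.
have jk : j != k by apply: contra yz => /eqP jk; rewrite yj zk jk.
have [i' i'E] := ord3_third jk; exists (K', i').
  by apply: contra KK' => /eqP[-> _].
by rewrite /outer_edge /= setC1_ord3 i'E imsetU !imset_set1 -yj -zk -outer_edgeE.
Qed.
End Topology.

(** * One-sided traces on edges *)

Section Traces.
Context {R : realType}.
Variables (Th : mesh R) (Omega : set (R * R)) (n : {set node Th} -> R * R).
Hypotheses (HT : triangulation Th Omega) (Hn : edge_normal Omega n).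
Implicit Types (K : elt Th) (i j : 'I_3) (s : sub_elt Th) (F : {set node Th}).

Lemma outer_edge_in s : outer_edge s \in edges Th.
Proof. by apply/imsetP; exists s. Qed.

Definition edge_start s : R * R := apex s.1 (s.2 + 1).
Definition edge_end s : R * R := apex s.1 (s.2 + 2%:R).

Lemma normal_unit s : enorm (n (outer_edge s)) = 1.
Proof. by case: (Hn.1 _ (outer_edge_in s)). Qed.

Lemma normal_orth s (y z : node Th) : y \in outer_edge s -> z \in outer_edge s ->
  dot (n (outer_edge s)) (coord y - coord z) = 0.
Proof. by case: (Hn.1 _ (outer_edge_in s)) => _; apply. Qed.

(** The normal is orthogonal to the edge, so one endpoint decides for both. *)
Lemma outwardE s (y : node Th) : y \in outer_edge s ->
  outward (n (outer_edge s)) s = (dot (n (outer_edge s)) (apex s.1 s.2 - coord y) < 0).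
Proof.
move=> yF; have same z : z \in outer_edge s ->
    dot (n (outer_edge s)) (apex s.1 s.2 - coord z) =
    dot (n (outer_edge s)) (apex s.1 s.2 - coord y).
  move=> zF; have := normal_orth yF zF; rewrite /dot /=; lra.
apply/forallP/idP => [H|H j].
  case/imsetP: (yF) => j js yj; have := H j; rewrite js /=.
  by rewrite /apex -yj.
apply/implyP => js; rewrite same //.
by apply/imsetP; exists j.
Qed.

(** By [orient_normal], [orient] and the scalar product with n differ by a factor common to both
    elements; equal outwardness thus means the same side of the edge, where [same_side_unique]
    applies. *)
Lemma same_edge_unique s s' : outer_edge s = outer_edge s' ->
  outward (n (outer_edge s)) s = outward (n (outer_edge s)) s' -> s = s'.
Proof.
case: s s' => K i [K' i'] E; set F := outer_edge (K, i).
have yF : vert K (i + 1) \in F by rewrite /F outer_edgeE !inE eqxx.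
have zF : vert K (i + 2%:R) \in F by rewrite /F outer_edgeE !inE eqxx orbT.
have yF' : vert K (i + 1) \in outer_edge (K', i') by rewrite -E.
have o1 := outwardE yF; have o2 := outwardE yF'; rewrite -E in o2.
rewrite {}o1 {}o2 /=.
set y := coord _ => side.
have yz := outer_edge_neq HT K i.
apply: (same_side_unique HT (outer_edgeE K i) (etrans (esym E) (outer_edgeE K i)) yz).
have n1 := normal_unit (K, i); have nyz := normal_orth zF yF.
rewrite !(orient_normal _ n1 nyz) -/F -/y.
set tau := dot _ (tangent _); set d := dot _ _ in side *; set d' := dot _ _ in side *.
have -> : tau * d * (tau * d') = tau ^+ 2 * (d * d') by ring.
have D0 : orient (coord (vert K (i + 1))) (coord (vert K (i + 2%:R))) (apex K i) != 0.
  by have := apex_orient_neq0 HT i K; congr (_ != _); rewrite /orient /apex; ring.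
have D0' : orient (coord (vert K (i + 1))) (coord (vert K (i + 2%:R))) (apex K' i') != 0.
  have := apex_orient_neq0 HT i' K'.
  have : vert K (i + 2%:R) \in outer_edge (K', i') by rewrite -E.
  move: yF'; rewrite outer_edgeE !inE => /orP[] /eqP e1 /orP[] /eqP e2.
  - by move: yz; rewrite e1 e2 eqxx.
  - by rewrite e1 e2; congr (_ != _); rewrite /orient /apex; ring.
  - apply: contra => /eqP; rewrite e1 e2 => h; apply/eqP; rewrite -[RHS]oppr0 -h.
    by rewrite /orient /apex; ring.
  - by move: yz; rewrite e1 e2 eqxx.
move: D0 D0'; rewrite !(orient_normal _ n1 nyz) -/F -/y -/d -/d' -/tau.
rewrite !mulf_eq0 !negb_or => /andP[t0 d0] /andP[_ d0'].
apply: mulr_gt0; first by rewrite lt_def sqr_ge0 andbT expf_neq0.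
move: side; have [h|h|/eqP h] := ltrgtP d 0; last by rewrite h in d0.
  by move=> /esym h'; rewrite nmulr_rgt0.
by move=> /esym /negbT; rewrite -leNgt => h'; rewrite pmulr_rgt0 // lt_def d0'.
Qed.

Lemma opposite_outward s s' : s != s' -> outer_edge s = outer_edge s' ->
  outward (n (outer_edge s)) s' = ~~ outward (n (outer_edge s)) s.
Proof.
move=> ss' E; have := contra_neq (same_edge_unique E) ss'.
by case: (outward _ s); case: (outward _ s').
Qed.

Lemma edge_cases F : F \in edges Th -> exists s, [/\ outer_edge s = F, outward (n F) s &
  (forall p (w : sub_elt Th -> R * R -> R), trace_out n F w p = w s p) /\
  ((hull F `<=` boundary Omega /\ forall p (w : sub_elt Th -> R * R -> R), trace_in n F w p = 0) \/
   exists s', [/\ outer_edge s' = F, ~~ outward (n F) s' &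
     forall p (w : sub_elt Th -> R * R -> R), trace_in n F w p = w s' p])].
Proof.
have out1 s F' : outer_edge s = F' -> outward (n F') s ->
    forall p (w : sub_elt Th -> R * R -> R), trace_out n F' w p = w s p.
  move=> <- os p w; rewrite /trace_out (big_pred1 s) // => s' /=.
  apply/andP/eqP => [[/eqP e o]|-> //]; apply/esym/same_edge_unique; first by rewrite e.
  by rewrite os o.
have in1 s F' : outer_edge s = F' -> ~~ outward (n F') s ->
    forall p (w : sub_elt Th -> R * R -> R), trace_in n F' w p = w s p.
  move=> <- os p w; rewrite /trace_in (big_pred1 s) // => s' /=.
  apply/andP/eqP => [[/eqP e o]|-> //]; apply/esym/same_edge_unique; first by rewrite e.
  by rewrite (negbTE os) (negbTE o).
move=> /imsetP[s _ ->].
have [bF|/existsNP nF] := pselect (hull (outer_edge s) `<=` boundary Omega).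
  have bE : boundary_edge Omega (outer_edge s) by split => //; exact: outer_edge_in.
  have os : outward (n (outer_edge s)) s by exact: Hn.2.
  exists s; split=> //; split; first exact: out1.
  left; split=> // p w; rewrite /trace_in big_pred0 // => s'.
  apply/negP => /andP[/eqP e]; move/negP; apply; rewrite -e; apply: Hn.2.
  by rewrite e.
have iF : interior_edge Omega (outer_edge s).
  by split; [exact: outer_edge_in|apply/existsNP].
have [s' s's E] := interior_edge_neighbour HT iF.
have := opposite_outward s's E; rewrite E => oE.
have [os|os] := boolP (outward (n (outer_edge s)) s).
  exists s; split=> //; split; first exact: out1.
  by right; exists s'; split=> //; [rewrite -[~~ _]oE|apply: in1 => //; rewrite -[~~ _]oE].
have os' : outward (n (outer_edge s)) s' by move: os; rewrite oE negbK.
exists s'; split=> //; split; first exact: out1.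
by right; exists s; split=> //; exact: in1.
Qed.
End Traces.

(** * Estimates on elements *)

Section MeshSize.
Context {R : realType}.
Variables (Th : mesh R) (Omega : set (R * R)).
Hypothesis HT : triangulation Th Omega.
Implicit Types (K : elt Th) (s : sub_elt Th).

Lemma tame_cell K : tame_set (cell K).
Proof. by rewrite (apex_cell 0); apply: conv3_tame; exact: apex_orient_neq0 HT 0 K. Qed.

Lemma apex_in_cell K i : cell K (apex K i).
Proof.
rewrite (apex_cell i) conv3P; exists 1, 0, 0.
by split; rewrite ?addr0 ?scale1r ?scale0r ?addr0.
Qed.

Lemma enormC (p q : R * R) : enorm (p - q) = enorm (q - p).
Proof. by rewrite /enorm /dot /=; congr Num.sqrt; ring. Qed.

(** A real [sup] carries information only for a nonempty bounded set. *)
Lemma diam_has_sup K :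
  has_sup [set d | exists p q, [/\ cell K p, cell K q & d = enorm (p - q)]].
Proof.
split; first by exists (enorm (apex K 0 - apex K 0)), (apex K 0), (apex K 0); split=> //; exact: apex_in_cell.
have [_ [M bM]] := tame_cell K.
have M0 : 0 <= M by have [h _] := bM _ (apex_in_cell K 0); exact: le_trans h.
exists (4 * M) => _ [p [q [/bM[p1 p2] /bM[q1 q2] ->]]].
rewrite enorm_le ?mulr_ge0 // /dot /= -!expr2.
have sq (x y : R) : `|x| <= M -> `|y| <= M -> (x - y) ^+ 2 <= (2 * M) ^+ 2.
  move=> xM yM; rewrite -[(x - y) ^+ 2]real_normK ?num_real //.
  rewrite ler_sqr ?nnegrE ?mulr_ge0 // (le_trans (ler_normB _ _)) //; lra.
have := sq _ _ p1 q1; have := sq _ _ p2 q2; have := sqr_ge0 M.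
by rewrite !exprMn; lra.
Qed.

Lemma cell_diam K p q : cell K p -> cell K q -> enorm (p - q) <= mesh_size Th.
Proof.
move=> Kp Kq; apply: (@le_trans _ _ (diam (cell K))).
  by apply: ub_le_sup; [case: (diam_has_sup K)|exists p, q].
by rewrite /mesh_size; apply: (le_bigmax _ (fun K => diam (cell K))).
Qed.

Lemma diam_gt0 K : 0 < diam (cell K).
Proof.
have D0 := apex_orient_neq0 HT 0 K.
apply: (@lt_le_trans _ _ (enorm (apex K 0 - apex K (0 + 1)))).
  rewrite lt_def enorm_ge0 andbT enorm_eq0 subr_eq0; apply: contra D0 => /eqP ->.
  by rewrite /orient; apply/eqP; ring.
by apply: ub_le_sup; [case: (diam_has_sup K)|exists (apex K 0), (apex K (0 + 1)); split=> //; exact: apex_in_cell].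
Qed.

Lemma mesh_size_gt0 K : 0 < mesh_size Th.
Proof.
apply: (lt_le_trans (diam_gt0 K)).
by rewrite /mesh_size; apply: (le_bigmax _ (fun K => diam (cell K))).
Qed.

(** The supremum in [indiam] is approached up to one half of it, giving a disc of radius above a
    quarter of [indiam]: hence the 4. The factors 1 + |sigma| and 1 + |rho| are positive whatever
    the signs. *)
Lemma mesh_disc (sigma rho : R) K : shape_regular Th sigma -> quasi_uniform Th rho ->
  exists c0, forall p,
    enorm (p - c0) <= (4 * (1 + `|sigma|) * (1 + `|rho|))^-1 * mesh_size Th -> cell K p.
Proof.
move=> /(_ K) sr /(_ K) qu; set h := mesh_size Th in qu *.
have d0 := diam_gt0 K; set d := diam (cell K) in sr qu d0.
set S := [set x | exists c r, [/\ 0 <= r, x = 2 * r & [set p | enorm (p - c) <= r] `<=` cell K]].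
have hS : has_sup S.
  split.
    exists 0, (apex K 0), 0; split; rewrite ?mulr0 // => p /=.
    rewrite le_eqVlt ltNge enorm_ge0 orbF enorm_eq0 subr_eq0 => /eqP ->.
    exact: apex_in_cell.
  exists h => _ [c [r [r0 -> rK]]].
  have er : enorm ((r, 0) : R * R) = r.
    by rewrite /enorm /dot /= mulr0 addr0 -expr2 sqrtr_sqr ger0_norm.
  have c1 : cell K (c + (r, 0)) by apply: rK; rewrite /= addrC addKr er.
  have c2 : cell K (c - (r, 0)) by apply: rK; rewrite /= addrC addKr -[X in enorm X]sub0r enormC subr0 er.
  apply: le_trans (cell_diam c1 c2); rewrite /enorm /dot /=.
  rewrite [X in Num.sqrt X](_ : _ = (2 * r) ^+ 2); last by ring.
  by rewrite sqrtr_sqr ler_norm.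
have iE : indiam (cell K) = sup S by [].
have i0 : 0 <= sup S.
  apply: ub_le_sup; first by case: hS.
  exists (apex K 0), 0; split; rewrite ?mulr0 // => p /=.
  rewrite le_eqVlt ltNge enorm_ge0 orbF enorm_eq0 subr_eq0 => /eqP ->.
  exact: apex_in_cell.
rewrite iE in sr.
have s0 : 0 < sup S.
  rewrite lt_def i0 andbT; apply/eqP => e; move: sr; rewrite e mulr0.
  by rewrite leNgt d0.
have [_ [c [r [r0 -> rK]]] hr] := sup_adherent (divr_gt0 s0 (ltr0n R 2)) hS.
exists c => p pr; apply: rK; apply: (le_trans pr).
set A := 1 + `|sigma|; set B := 1 + `|rho|.
have A0 : 0 < A by rewrite ltr_wpDr.
have B0 : 0 < B by rewrite ltr_wpDr.
have h1 : h <= B * d.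
  apply: (le_trans qu); rewrite ler_pM2r // (le_trans (ler_norm _)) // lerDr //.
have h2 : d <= A * sup S.
  apply: (le_trans sr); rewrite ler_pM2r // (le_trans (ler_norm _)) // lerDr //.
have AB0 : 0 < 4 * A * B by rewrite !mulr_gt0.
rewrite mulrC ler_pdivrMr //.
have h3 : h <= B * (A * sup S) by apply: (le_trans h1); rewrite ler_pM2l.
have : B * A * sup S <= B * A * (4 * r).
  by rewrite ler_pM2l ?mulr_gt0 //; lra.
lra.
Qed.
End MeshSize.

Section Estimates.
Context {R : realType}.
Variables (Th : mesh R) (Omega : set (R * R)) (kappa : R).
Hypothesis HT : triangulation Th Omega.
Hypothesis kappa0 : 0 < kappa.
Local Notation h := (mesh_size Th).
Hypothesis Hdisc : forall K : elt Th, exists c0, forall p,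
  enorm (p - c0) <= kappa * h -> cell K p.
Implicit Types (K : elt Th) (s : sub_elt Th) (f : R * R -> R).

Lemma sub_cell_subset s : sub_cell s `<=` cell s.1.
Proof.
case: s => K i p; rewrite (apex_sub_cell i) (apex_cell i) !conv3P.
move=> [l0 [l1 [l2 [h0 h1 h2 hs ->]]]].
exists (l0 / 3), (l1 + l0 / 3), (l2 + l0 / 3); split; [lra..|].
by apply/eqP; rewrite xpair_eqE /= !scale_regE; apply/andP; split; apply/eqP; field.
Qed.

Lemma tame_sub s : tame_set (sub_cell s).
Proof.
case: s => K i; rewrite (apex_sub_cell i); apply: conv3_tame.
have := apex_orient_neq0 HT i K; set a := apex K i; set b := apex K _; set c := apex K _.
have -> : orient (3^-1 *: (a + b + c)) b c = 3^-1 * orient a b c.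
  by rewrite /orient /= !scale_regE; field.
by move=> D0; rewrite mulf_neq0 // invr_eq0 pnatr_eq0.
Qed.

Lemma cell_int_ub K (A : set (R * R)) f (M : R) : measurable A -> A `<=` cell K ->
  0 <= M -> tame f -> (forall p, A p -> f p <= M) -> area_int A f <= 4 * h ^+ 2 * M.
Proof.
move=> mA AK M0 tf fM; apply: (area_int_ub (c := apex K 0) mA) => //.
  exact: ltW (mesh_size_gt0 HT K).
move=> p /AK Kp; apply: (enorm_comp (u := p - apex K 0)).
  exact: ltW (mesh_size_gt0 HT K).
exact: cell_diam HT _ _ _ Kp (apex_in_cell _ _).
Qed.

Lemma edge_length s :
  2 * kappa * h <= enorm (edge_end s - edge_start s) <= h.
Proof.
case: s => K i; have h0 := mesh_size_gt0 HT K; apply/andP; split; last first.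
  by apply: (cell_diam HT (K := K)); exact: apex_in_cell.
have [c0 disc] := Hdisc K; rewrite (apex_cell i) in disc.
rewrite -mulrA; apply: (disc_edge (apex_orient_neq0 HT i K) _ disc).
exact: mulr_gt0.
Qed.
End Estimates.

(** The constant is fixed before the mesh and depends only on the degree and on kappa. The value is
    taken anywhere in the element, the integral over one subtriangle. *)
Lemma inverse_estimate (R : realType) (d : nat) (kappa : R) : 0 < kappa ->
  exists2 C : R, 0 < C & forall (Th : mesh R) (Omega : set (R * R)),
    triangulation Th Omega ->
    (forall K : elt Th, exists c0, forall p,
       enorm (p - c0) <= kappa * mesh_size Th -> cell K p) ->
    forall (s : sub_elt Th) f p, is_poly d f -> cell s.1 p ->
      f p ^+ 2 <= C / mesh_size Th ^+ 2 * area_int (sub_cell s) (fun q => f q ^+ 2).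
Proof.
move=> k0; have [C C0 HC] := @square_lower_bound R d (4 / kappa).
exists (C * 16 / kappa ^+ 2) => [|Th Omega HT Hdisc [K i] f p pf Kp].
  by rewrite divr_gt0 ?exprn_gt0 // mulr_gt0.
set h := mesh_size Th; have h0 : 0 < h := mesh_size_gt0 HT K.
have [c0 disc] := Hdisc K; rewrite (apex_cell i) in disc.
have r0 : 0 < kappa * h by exact: mulr_gt0.
have [e eS] := sub_square r0 disc; rewrite -apex_sub_cell in eS.
have r4 : 0 < kappa * h / 4 by rewrite divr_gt0.
have Ke : cell K e.
  apply: (@sub_cell_subset _ _ (K, i)); apply: eS.
  by split => /=; rewrite in_itv /= lexx lerDl ltW.
have [b1 b2] := enorm_comp (ltW h0) (cell_diam HT Kp Ke).
have hE : 4 / kappa * (kappa * h / 4) = h by field; rewrite gt_eqF.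
have := HC f e p (kappa * h / 4) pf r4; rewrite hE => /(_ b1 b2) /le_trans; apply.
have -> : C / (kappa * h / 4) ^+ 2 = C * 16 / kappa ^+ 2 / h ^+ 2.
  by field; rewrite !gt_eqF.
rewrite ler_pM2l; last by rewrite !divr_gt0 ?exprn_gt0 // mulr_gt0.
apply: area_int_subset => //.
- exact: (tame_set_rect _ _ _ _).1.
- exact: tame_sub HT (K, i).
- by apply: tameX; exact: tame_poly pf.
- by move=> q _; exact: sqr_ge0.
Qed.

(** * Components of the strain *)

Section Strain.
Context {R : realType}.
Implicit Types (v : R * R -> R * R) (p m : R * R) (e : 'M[R]_2).

Definition stress (x y : R) : 'M[R]_2 :=
  \matrix_(i, j) if i == j then (if i == ord0 then x else - x) else y.

Lemma frobE e e' : frob e e' = e ord0 ord0 * e' ord0 ord0 + e ord0 ord_max * e' ord0 ord_max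
  + (e ord_max ord0 * e' ord_max ord0 + e ord_max ord_max * e' ord_max ord_max).
Proof. by rewrite /frob sum_ord2 !sum_ord2. Qed.

Lemma frob_stress x y e : frob (stress x y) e =
  x * (e ord0 ord0 - e ord_max ord_max) + y * (e ord0 ord_max + e ord_max ord0).
Proof. by rewrite frobE !mxE /=; ring. Qed.

Lemma stress_nt x y m : dot (tangent m) (mxact (stress x y) m) =
  x * (2 * m.1 * m.2) + y * (m.2 ^+ 2 - m.1 ^+ 2).
Proof. by rewrite /dot /mxact /tangent !mxE /=; ring. Qed.

Definition strain_diff v p : R := eps v p ord0 ord0 - eps v p ord_max ord_max.
Definition strain_shear v p : R := eps v p ord0 ord_max + eps v p ord_max ord0.

(* For a unit vector m, the tangent t of m and the strain e = eps v:
   strain_normal is t^T e t - m^T e m and strain_tangent is 2 t^T e m. *)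
Definition strain_normal m v p : R :=
  (m.2 ^+ 2 - m.1 ^+ 2) * strain_diff v p - 2 * m.1 * m.2 * strain_shear v p.
Definition strain_tangent m v p : R :=
  2 * m.1 * m.2 * strain_diff v p + (m.2 ^+ 2 - m.1 ^+ 2) * strain_shear v p.

(** Turning the frame by an angle turns the pair (diagonal difference, shear) by twice that angle,
    which preserves its length. *)
Lemma strain_normal_tangent m v p : dot m m = 1 ->
  strain_normal m v p ^+ 2 + strain_tangent m v p ^+ 2 =
  strain_diff v p ^+ 2 + strain_shear v p ^+ 2.
Proof.
move=> m1; rewrite -[RHS]mulr1 -[X in _ = _ * X](expr1n _ 2) -m1.
by rewrite /strain_normal /strain_tangent /dot; ring.
Qed.

(** Trace and deviator of a symmetric matrix are orthogonal; the second is described by the diagonal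
    difference and the shear. *)
Lemma frob_eps v p : frob (eps v p) (eps v p) =
  (dive v p ^+ 2 + strain_diff v p ^+ 2 + strain_shear v p ^+ 2) / 2.
Proof.
rewrite frobE /strain_diff /strain_shear /dive /mxtrace sum_ord2 !mxE.
by field.
Qed.

Section poly.
Variables (k : nat) (v : R * R -> R * R).
Hypothesis pv : poly_field k v.

Lemma is_polyB d (f g : R * R -> R) : is_poly d f -> is_poly d g -> is_poly d (fun p => f p - g p).
Proof.
move=> pf pg; have -> : (fun p => f p - g p) = fun p => f p + (-1) * g p.
  by apply/funext => p; ring.
by apply: is_polyD => //; apply: is_polyZ.
Qed.

Lemma eps_poly i j : is_poly k.-1 (fun p => eps v p i j).
Proof.
have [g [pg _ gE]] := poly_field_grad pv.
have -> : (fun p => eps v p i j) = fun p => 2^-1 * (g i j p + g j i p).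
  by apply/funext => p; rewrite -!gE !mxE.
by apply: is_polyZ; apply: is_polyD.
Qed.

Lemma strain_diff_poly : is_poly k.-1 (strain_diff v).
Proof. by apply: is_polyB; exact: eps_poly. Qed.

Lemma strain_shear_poly : is_poly k.-1 (strain_shear v).
Proof. by apply: is_polyD; exact: eps_poly. Qed.

Lemma strain_normal_poly m : is_poly k.-1 (strain_normal m v).
Proof.
by apply: is_polyB; apply: is_polyZ; [exact: strain_diff_poly|exact: strain_shear_poly].
Qed.

Lemma strain_tangent_poly m : is_poly k.-1 (strain_tangent m v).
Proof.
by apply: is_polyD; apply: is_polyZ; [exact: strain_diff_poly|exact: strain_shear_poly].
Qed.
End poly.
End Strain.

(** * Control of the strain energy *)

Section Energy.
Context {R : realType}.
Variables (Th : mesh R) (Omega : set (R * R)) (n : {set node Th} -> R * R) (kappa C : R) (k : nat).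
Hypotheses (HT : triangulation Th Omega) (Hn : edge_normal Omega n) (kappa0 : 0 < kappa)
  (C0 : 0 < C).
Local Notation h := (mesh_size Th).
Hypothesis Hdisc : forall K : elt Th, exists c0, forall p,
  enorm (p - c0) <= kappa * h -> cell K p.
Hypothesis HC : forall (s : sub_elt Th) f p, is_poly k.-1 f -> cell s.1 p ->
      f p ^+ 2 <= C / h ^+ 2 * area_int (sub_cell s) (fun q => f q ^+ 2).
Implicit Types (K : elt Th) (s : sub_elt Th) (F : {set node Th}) (alpha : {set node Th} -> R).
Variable v : elt Th -> R * R -> R * R.
Hypothesis pv : forall K, poly_field k (v K).

Definition energy K : R := area_int (cell K) (fun p => frob (eps (v K) p) (eps (v K) p)).
Definition div_energy K : R := area_int (cell K) (fun p => dive (v K) p ^+ 2).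
Definition normal_energy s : R :=
  area_int (sub_cell s) (fun p => strain_normal (n (outer_edge s)) (v s.1) p ^+ 2).
(** Not divided by the area: multiplied by the coefficient of the edge, it is the cross term of m_F
    with eps v in [b2]. *)
Definition tangent_mean s : R :=
  area_int (sub_cell s) (strain_tangent (n (outer_edge s)) (v s.1)).

Let h0 K : 0 < h. Proof. exact: mesh_size_gt0 HT K. Qed.
Let n1 s : dot (n (outer_edge s)) (n (outer_edge s)) = 1.
Proof. by rewrite -enorm_sqr (normal_unit Hn) expr1n. Qed.
Let t_normal m K : tame (strain_normal m (v K)).
Proof. exact: tame_poly (strain_normal_poly (pv K) m). Qed.
Let t_tangent m K : tame (strain_tangent m (v K)).
Proof. exact: tame_poly (strain_tangent_poly (pv K) m). Qed.
Let t_dive K : tame (dive (v K)).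
Proof. exact: tame_poly (dive_poly_field (pv K)). Qed.
Let t_frob K : tame (fun p => frob (eps (v K) p) (eps (v K) p)).
Proof.
have te i j : tame (fun p => eps (v K) p i j) by exact: tame_poly (eps_poly (pv K) i j).
by under eq_fun do rewrite frobE; do !apply: tameD; apply: tameM; exact: te.
Qed.

Lemma sub_energy_le s : area_int (sub_cell s)
  (fun p => frob (eps (v s.1) p) (eps (v s.1) p)) <= energy s.1.
Proof.
apply: area_int_subset => //; [exact: (tame_sub HT s).1|exact: tame_cell HT s.1| |].
  exact: sub_cell_subset.
by move=> p _; rewrite frob_eps divr_ge0 // !addr_ge0 ?sqr_ge0.
Qed.

Lemma energy_ge0 K : 0 <= energy K.
Proof. by apply: area_int_ge0 => p _; rewrite frob_eps divr_ge0 // !addr_ge0 ?sqr_ge0. Qed.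

Lemma normal_energy_ge0 s : 0 <= normal_energy s.
Proof. by apply: area_int_ge0 => p _; exact: sqr_ge0. Qed.

Lemma strain_normal_le s p :
  strain_normal (n (outer_edge s)) (v s.1) p ^+ 2 <= 2 * frob (eps (v s.1) p) (eps (v s.1) p).
Proof.
have := strain_normal_tangent (v s.1) p (n1 s); rewrite frob_eps.
have := sqr_ge0 (strain_tangent (n (outer_edge s)) (v s.1) p); have := sqr_ge0 (dive (v s.1) p).
lra.
Qed.

Lemma strain_tangent_le s p :
  strain_tangent (n (outer_edge s)) (v s.1) p ^+ 2 <= 2 * frob (eps (v s.1) p) (eps (v s.1) p).
Proof.
have := strain_normal_tangent (v s.1) p (n1 s); rewrite frob_eps.
have := sqr_ge0 (strain_normal (n (outer_edge s)) (v s.1) p); have := sqr_ge0 (dive (v s.1) p).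
lra.
Qed.

Lemma normal_energy_le s : normal_energy s <= 2 * energy s.1.
Proof.
apply: (@le_trans _ _ (2 * area_int (sub_cell s) (fun p => frob (eps (v s.1) p) (eps (v s.1) p)))).
  rewrite -area_intZ //; last exact: tame_sub HT s.
  apply: area_int_le; [exact: tame_sub HT s|exact: tameX|exact: tameZ|].
  by move=> p _; exact: strain_normal_le.
by rewrite ler_pM2l // sub_energy_le.
Qed.

Lemma div_energy_le K : div_energy K <= 2 * energy K.
Proof.
rewrite -area_intZ //; last exact: tame_cell HT K.
apply: area_int_le; [exact: tame_cell HT K|exact: tameX|exact: tameZ|].
move=> p _; rewrite frob_eps; have := sqr_ge0 (strain_diff (v K) p).
by have := sqr_ge0 (strain_shear (v K) p); lra.
Qed.

(** The inequality of Young with a free weight eta, a r <= eta a^2 + r^2 / (4 eta), integrated; eta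
    is chosen when the cross term is absorbed. *)
Lemma tangent_mean_le s (a eta : R) : 0 < eta ->
  a * tangent_mean s <= 4 * h ^+ 2 * (eta * a ^+ 2) + energy s.1 / (2 * eta).
Proof.
move=> eta0; have tS := tame_sub HT s.
rewrite -area_intZ //.
pose f1 p := eta * a ^+ 2 + (2 * eta)^-1 * frob (eps (v s.1) p) (eps (v s.1) p).
have t1 : tame f1 by apply: tameD; [exact: tameC|exact: tameZ].
apply: (@le_trans _ _ (area_int (sub_cell s) f1)).
  apply: area_int_le => //; first exact: tameZ.
  move=> p _; rewrite /f1; have := strain_tangent_le s p.
  set r := strain_tangent _ _ _; set e := frob _ _ => re.
  have : r ^+ 2 / (4 * eta) <= (2 * eta)^-1 * e.
    have -> : (2 * eta)^-1 * e = 2 * e / (4 * eta) by field; rewrite gt_eqF.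
    by rewrite ler_pM2r // invr_gt0 mulr_gt0.
  have -> : r ^+ 2 / (4 * eta) = a * r - eta * a ^+ 2 + eta * (a - r / (2 * eta)) ^+ 2.
    by field; rewrite gt_eqF.
  have := mulr_ge0 (ltW eta0) (sqr_ge0 (a - r / (2 * eta))); lra.
rewrite area_intD; [|by []|exact: tameC|exact: tameZ].
apply: lerD.
  apply: (cell_int_ub HT (tame_sub HT s).1 (@sub_cell_subset _ _ s)) => //.
    by rewrite mulr_ge0 ?sqr_ge0 ?ltW.
  exact: tameC.
rewrite area_intZ // mulrC ler_pM2r ?invr_gt0 ?mulr_gt0 //.
exact: sub_energy_le.
Qed.

(** [three_directions] for the edge vectors u_i, with disc radius kappa h. As u_i is a multiple of
    the tangent, [strain_normal] times |u_i|^2 is a linear form in difference and shear with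
    coefficients quadratic in u_i. The factor h^2 cancels. *)
Lemma pointwise_normal K p :
  strain_diff (v K) p ^+ 2 + strain_shear (v K) p ^+ 2 <=
  (2 * kappa ^+ 2)^-1 * \sum_i strain_normal (n (outer_edge (K, i))) (v K) p ^+ 2.
Proof.
pose u i := edge_end (K, i) - edge_start (K, i).
pose m i := n (outer_edge (K, i)).
have [c0 disc] := Hdisc K.
have ht i : dot (m i) (u i) = 0.
  rewrite /u /edge_end /edge_start /apex /=; apply: (normal_orth Hn).
    by rewrite outer_edgeE !inE eqxx orbT.
  by rewrite outer_edgeE !inE eqxx.
have m1 i : dot (m i) (m i) = 1 by exact: n1.
have nq i : strain_normal (m i) (v K) p * dot (u i) (u i) =
    ((u i).1 ^+ 2 - (u i).2 ^+ 2) * strain_diff (v K) p + 2 * (u i).1 * (u i).2 * strain_shear (v K) p.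
  have uE := orth_tangent (m1 i) (ht i).
  set tau := dot (u i) (tangent (m i)) in uE.
  have uu : dot (u i) (u i) = tau ^+ 2.
    have -> : dot (u i) (u i) = tau ^+ 2 * dot (m i) (m i).
      by rewrite {1 2}uE /dot /tangent /= !scale_regE; ring.
    by rewrite m1 mulr1.
  rewrite uu uE /strain_normal /tangent /= !scale_regE; ring.
have D0 i := apex_orient_neq0 HT i K.
have r0 : 0 < kappa * h by rewrite mulr_gt0 // (h0 K).
have height i : 4 * (kappa * h) ^+ 2 * dot (u i) (u i) <= `|orient (apex K 0) (apex K 1) (apex K 2%:R)| ^+ 2.
  have disc' := disc; rewrite (apex_cell i) in disc'.
  have := disc_height (D0 i) r0 disc'; rewrite orient_apex -/(u i) => H.
  have -> : 4 * (kappa * h) ^+ 2 * dot (u i) (u i) = (2 * (kappa * h) * enorm (u i)) ^+ 2.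
    by rewrite -enorm_sqr; ring.
  by rewrite ler_sqr ?nnegrE // !mulr_ge0 ?enorm_ge0 ?ltW // (h0 K).
have len i : dot (u i) (u i) <= h ^+ 2.
  rewrite -enorm_le; last exact: ltW (h0 K).
  by have /andP[] := edge_length HT kappa0 Hdisc (K, i).
have u_gt0 : 0 < dot (u 0) (u 0).
  have /andP[h1 _] := edge_length HT kappa0 Hdisc (K, 0).
  rewrite -enorm_sqr exprn_gt0 //; apply: lt_le_trans h1.
  by rewrite !mulr_gt0 // (h0 K).
have sum0 : u 0 + u 1 + u 2%:R = 0.
  rewrite /u /edge_end /edge_start /= !ord3_addE.
  by apply/eqP; rewrite xpair_eqE /=; apply/andP; split; apply/eqP; ring.
have crossE : `|(u 0).1 * (u 1).2 - (u 1).1 * (u 0).2| = `|orient (apex K 0) (apex K 1) (apex K 2%:R)|.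
  rewrite /u /edge_end /edge_start /= !ord3_addE /orient.
  by congr (`|_|); ring.
have := three_directions sum0 r0 u_gt0 (len 0) (len 1) (len 2%:R) crossE (height 1) (height 2%:R)
  (nq 0) (nq 1) (nq 2%:R).
set X := _ ^+ 2 + _ => H.
have -> : \sum_i strain_normal (n (outer_edge (K, i))) (v K) p ^+ 2 =
    strain_normal (m 0) (v K) p ^+ 2 + strain_normal (m 1) (v K) p ^+ 2 + strain_normal (m 2%:R) (v K) p ^+ 2.
  rewrite !big_ord_recl big_ord0 addr0 addrA.
  by congr (_ + _ ^+ 2 + _ ^+ 2); congr (strain_normal (m _)); apply/val_inj.
have k2 : 0 < 2 * kappa ^+ 2 by rewrite mulr_gt0 // exprn_gt0.
rewrite mulrC ler_pdivlMr // -(ler_pM2l (exprn_gt0 2 (h0 K))).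
by apply: le_trans H; rewrite le_eqVlt; apply/orP; left; apply/eqP; ring.
Qed.

Lemma energy_le K : energy K <=
  div_energy K / 2 + C / kappa ^+ 2 * \sum_i normal_energy (K, i).
Proof.
have tK := tame_cell HT K.
pose f p := 2^-1 * dive (v K) p ^+ 2 + (4 * kappa ^+ 2)^-1 *
  (strain_normal (n (outer_edge (K, 0))) (v K) p ^+ 2 +
   strain_normal (n (outer_edge (K, 1))) (v K) p ^+ 2 +
   strain_normal (n (outer_edge (K, 2%:R))) (v K) p ^+ 2).
have tq i : tame (fun p => strain_normal (n (outer_edge (K, i))) (v K) p ^+ 2) by exact: tameX.
have sum3 (g : 'I_3 -> R) : \sum_i g i = g 0 + g 1 + g 2%:R.
  rewrite !big_ord_recl big_ord0 addr0 addrA.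
  by congr (_ + g _ + g _); apply/val_inj.
have k2 : 0 < 2 * kappa ^+ 2 by rewrite mulr_gt0 // exprn_gt0.
have td2 : tame (fun p => dive (v K) p ^+ 2) by exact: tameX.
have tf : tame f.
  by apply: tameD; [exact: tameZ|apply: tameZ; do !apply: tameD].
apply: (@le_trans _ _ (area_int (cell K) f)).
  apply: area_int_le => // p _; rewrite frob_eps /f.
  have := pointwise_normal K p; rewrite sum3.
  set q := _ + _ + _; set x := _ + _ => xq.
  have -> : (4 * kappa ^+ 2)^-1 * q = (2 * kappa ^+ 2)^-1 * q / 2 by field; rewrite gt_eqF.
  rewrite -addrA -/x; lra.
rewrite area_intD //; [|exact: tameZ|apply: tameZ; do !apply: tameD => //].
rewrite !area_intZ //; last by do !apply: tameD.
rewrite !area_intD //; last by apply: tameD.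
rewrite [2^-1 * _]mulrC lerD2l sum3.
(* Area at most 4 h^2 times the pointwise bound C / h^2: the powers of h cancel. *)
have bound i : area_int (cell K) (fun p => strain_normal (n (outer_edge (K, i))) (v K) p ^+ 2) <=
    4 * C * normal_energy (K, i).
  have B0 := normal_energy_ge0 (K, i).
  have -> : 4 * C * normal_energy (K, i) = 4 * h ^+ 2 * (C / h ^+ 2 * normal_energy (K, i)).
    by field; rewrite gt_eqF // (h0 K).
  apply: (cell_int_ub HT tK.1 (@subset_refl _ _)) => //.
    by rewrite !mulr_ge0 // ?invr_ge0 ?sqr_ge0 // ltW.
  by move=> p Kp; apply: (HC (s := (K, i))) => //; exact: strain_normal_poly.
have := bound 0; have := bound 1; have := bound 2%:R => b2 b1 b0.
have -> : C / kappa ^+ 2 * (normal_energy (K, 0) + normal_energy (K, 1) + normal_energy (K, 2%:R)) =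
   (4 * kappa ^+ 2)^-1 * (4 * C * normal_energy (K, 0) + 4 * C * normal_energy (K, 1) + 4 * C * normal_energy (K, 2%:R)).
  by field; rewrite gt_eqF.
rewrite ler_pM2l; last by rewrite invr_gt0 mulr_gt0 // exprn_gt0.
lra.
Qed.
End Energy.

(** * Estimates on edges *)

Section Edges.
Context {R : realType}.
Variables (Th : mesh R) (Omega : set (R * R)) (n : {set node Th} -> R * R).
Hypotheses (HT : triangulation Th Omega) (Hn : edge_normal Omega n).
Local Notation h := (mesh_size Th).
Local Notation mu := (@lebesgue_measure R).
Implicit Types (K : elt Th) (s : sub_elt Th) (F : {set node Th}).

Definition edge_mean F (f : R * R -> R) : R :=
  if enum F is [:: y; z] then
    \int[mu]_(x in `[0, 1]) f ((1 - x) *: coord y + x *: coord z) else 0.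

Definition edge_len F : R :=
  if enum F is [:: y; z] then enorm (coord z - coord y) else 0.

Lemma edge_intE F f : edge_int F f = edge_len F * edge_mean F f.
Proof.
by rewrite /edge_int /edge_len /edge_mean; case: (enum F) => [|y [|z []]]; rewrite ?mul0r.
Qed.

Lemma edge_enum s : exists y z : node Th, [/\ enum (outer_edge s) = [:: y; z],
  outer_edge s = [set y; z]%SET, y != z &
  (coord y = edge_start s /\ coord z = edge_end s) \/
  (coord y = edge_end s /\ coord z = edge_start s)].
Proof.
case: s => K i; have yz := outer_edge_neq HT K i; have E := outer_edgeE K i.
have c2 : #|outer_edge (K, i)| = 2%N by rewrite E cards2 yz.
have := mem_enum (mem (outer_edge (K, i))); have := enum_uniq (mem (outer_edge (K, i))).
move: c2; rewrite cardE; case eE: (enum _) => [|y [|z []]] //= _.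
rewrite inE andbT => yz' memE; exists y, z; split=> //.
  by apply/setP => x; have := memE x; rewrite !inE => ->.
have := memE y; have := memE z; rewrite !inE !eqxx orbT /= E !inE => /esym hz /esym hy.
move: hz hy => /orP[] /eqP hz /orP[] /eqP hy.
- by move: yz'; rewrite hz hy eqxx.
- by right; rewrite hz hy.
- by left; rewrite hz hy.
- by move: yz'; rewrite hz hy eqxx.
Qed.

Lemma edge_lenE s : edge_len (outer_edge s) = enorm (edge_end s - edge_start s).
Proof.
have [y [z [eE _ _]]] := edge_enum s; rewrite /edge_len eE.
by case=> -[-> ->] //; rewrite enormC.
Qed.

(** The order in which [enum] lists the endpoints of an edge is arbitrary; the substitution of 1 -
    x, made on a primitive, shows that it does not matter. *)
Lemma poly_segment_rev d (f : R * R -> R) (a b : R * R) : is_poly d f ->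
  \int[mu]_(x in `[0, 1]) f ((1 - x) *: a + x *: b) =
  \int[mu]_(x in `[0, 1]) f ((1 - x) *: b + x *: a).
Proof.
move=> pf; have [f1 [f2 [_ _ Hl]]] := is_poly_partials pf.
have [L [_ LE _]] := Hl a (b - a).
have [Q QE] := poly_primitive L.
pose P := - (Q \Po (1%:P - 'X)).
have PE x : P^`().[x] = f ((1 - x) *: b + x *: a).
  rewrite /P derivN deriv_comp QE derivB derivC derivX sub0r mulrN mulr1 opprK.
  rewrite horner_comp hornerD hornerC hornerN hornerX LE; congr f.
  by rewrite -segment_line opprB addrCA subrr addr0 addrC.
transitivity (\int[mu]_(x in `[0, 1]) (Q^`()).[x]).
  by apply: eq_Rintegral => x _; rewrite QE LE segment_line.
transitivity (\int[mu]_(x in `[0, 1]) (P^`()).[x]); last first.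
  by apply: eq_Rintegral => x _; rewrite PE.
rewrite !int_deriv // /P !hornerN !horner_comp !hornerE subr0 subrr opprK.
by rewrite addrC.
Qed.

Lemma edge_mean_poly d s f : is_poly d f -> edge_mean (outer_edge s) f =
  \int[mu]_(x in `[0, 1]) f ((1 - x) *: edge_start s + x *: edge_end s).
Proof.
move=> pf; have [y [z [eE _ _]]] := edge_enum s; rewrite /edge_mean eE.
by case=> -[-> ->] //; rewrite (poly_segment_rev _ _ pf).
Qed.

Lemma edge_mean_eq F f g : F \in edges Th -> (forall p, hull F p -> f p = g p) ->
  edge_mean F f = edge_mean F g.
Proof.
move=> /imsetP[s _ ->] fg; have [y [z [eE FE yz _]]] := edge_enum s.
rewrite /edge_mean eE; apply: eq_Rintegral => x; rewrite inE /= in_itv /= => x01.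
by apply: fg; rewrite FE (hull2P _ yz); exists x.
Qed.

Lemma edge_mean0 F : edge_mean F (fun=> 0) = 0.
Proof.
by rewrite /edge_mean; case: (enum F) => [|y [|z []]] //; rewrite Rintegral_cst // mul0r.
Qed.

Lemma edge_meanB d F f g : is_poly d f -> is_poly d g ->
  edge_mean F (fun p => f p - g p) = edge_mean F f - edge_mean F g.
Proof.
move=> pf pg; rewrite /edge_mean; case: (enum F) => [|y [|z []]]; rewrite ?subr0 //.
by rewrite RintegralB //; apply: poly_segment_integrable; eassumption.
Qed.

Lemma edge_meanZ d F f a : is_poly d f ->
  edge_mean F (fun p => a * f p) = a * edge_mean F f.
Proof.
move=> pf; rewrite /edge_mean; case: (enum F) => [|y [|z []]]; rewrite ?mulr0 //.
by rewrite RintegralZl //; apply: poly_segment_integrable; eassumption.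
Qed.

(** A signed sum over the sides of F becomes the jump of a field that is constant on each side, to
    which [edge_cases] applies; the point p is a dummy. *)
Lemma jump_const F (g : sub_elt Th -> R) p :
  \sum_(s | outer_edge s == F) (if outward (n F) s then g s else - g s) =
  jump n F (fun s _ => g s) p.
Proof.
rewrite /jump /trace_out /trace_in (bigID (outward (n F))) /=; congr (_ + _).
  by apply: eq_bigr => s /andP[_ ->].
by rewrite -sumrN; apply: eq_bigr => s /andP[_ /negbTE ->].
Qed.

Lemma sum_traces F (g : sub_elt Th -> R) p :
  \sum_(s | outer_edge s == F) g s =
  trace_out n F (fun s _ => g s) p + trace_in n F (fun s _ => g s) p.
Proof. by rewrite /trace_out /trace_in (bigID (outward (n F))). Qed.

Section field.
Variables (k : nat) (v : elt Th -> R * R -> R * R).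
Hypothesis pv : forall K, poly_field k (v K).

Lemma comp_dir_poly K (m : R * R) : is_poly k (fun p => dot (v K p) m).
Proof.
have -> : (fun p => dot (v K p) m) = fun p =>
    m.1 * component ord0 (v K p) + m.2 * component ord_max (v K p).
  by apply/funext => p; rewrite /dot /component /=; ring.
by apply: is_polyD; apply: is_polyZ; exact: (pv K).
Qed.

(** With tau the signed length of the edge along t, the orientation of K has the sign of tau times
    that of n . (apex - Y), and the flux is - tau times the mean of v . n. The sign of tau turns the
    latter tau into the length; what remains is the outwardness of n. *)
Lemma signed_flux K (i : 'I_3) :
  Num.sg (orient (apex K 0) (apex K 1) (apex K 2%:R)) *
    vec_flux (v K) (edge_start (K, i)) (edge_end (K, i)) =
  if outward (n (outer_edge (K, i))) (K, i)
  then edge_int (outer_edge (K, i)) (comp_n n (outer_edge (K, i)) v (K, i))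
  else - edge_int (outer_edge (K, i)) (comp_n n (outer_edge (K, i)) v (K, i)).
Proof.
set F := outer_edge (K, i); set s := (K, i); set Y := edge_start s; set Z := edge_end s.
have yF : vert K (i + 1) \in F by rewrite /F outer_edgeE !inE eqxx.
have zF : vert K (i + 2%:R) \in F by rewrite /F outer_edgeE !inE eqxx orbT.
have n1 := normal_unit Hn s; have nyz : dot (n F) (Z - Y) = 0 := normal_orth Hn zF yF.
have oE := outwardE Hn yF; rewrite -/F in oE n1.
set tau := dot (Z - Y) (tangent (n F)).
have tau2 : tau ^+ 2 = enorm (Z - Y) ^+ 2 by rewrite enorm_sqr /tau (normal_edge_length n1 nyz).
have D0 := apex_orient_neq0 HT i K.
have Dtau : orient (apex K 0) (apex K 1) (apex K 2%:R) = tau * dot (n F) (apex K i - Y).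
  rewrite -(orient_normal _ n1 nyz) -(orient_apex i) /Y /Z /edge_start /edge_end /=.
  by rewrite /orient; ring.
have fluxE : vec_flux (v K) Y Z = - tau * edge_mean F (comp_n n F v s).
  rewrite /F (edge_mean_poly (d := k)); last exact: comp_dir_poly.
  rewrite /vec_flux -/s -/Y -/Z -RintegralZl //; last first.
    exact: (poly_segment_integrable _ _ (comp_dir_poly K (n (outer_edge s)))).
  apply: eq_Rintegral => x _; rewrite /comp_n /=.
  have -> : tangent (Z - Y) = - tau *: n F.
    have n11 : dot (n F) (n F) = 1 by rewrite -enorm_sqr n1 expr1n.
    have := congr1 tangent (orth_tangent n11 nyz); rewrite -/tau => ->.
    by apply/eqP; rewrite /tangent xpair_eqE /= !scale_regE mulrN !mulNr !eqxx.
  by rewrite /dot /= !scale_regE /F; ring.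
rewrite fluxE edge_intE edge_lenE -/Y -/Z.
have d0 : dot (n F) (apex K i - Y) != 0.
  by move: D0; rewrite orient_apex Dtau mulf_eq0 negb_or => /andP[].
have tau0 : tau != 0 by move: D0; rewrite orient_apex Dtau mulf_eq0 negb_or => /andP[].
have Ltau : enorm (Z - Y) = Num.sg tau * tau.
  apply/eqP; rewrite -normrEsg -(@eqrXn2 _ 2) ?enorm_ge0 // real_normK ?num_real //.
  by rewrite tau2.
rewrite Dtau sgrM oE /= -/Y Ltau.
have [dn|dp|/eqP] := ltrgtP (dot (n F) (apex K i - Y)) 0; last by rewrite (negbTE d0).
  by rewrite (ltr0_sg dn); ring.
by rewrite (gtr0_sg dp); ring.
Qed.

Lemma sum_by_edge (g : sub_elt Th -> R) :
  \sum_(F in edges Th) \sum_(s | outer_edge s == F) g s = \sum_s g s.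
Proof.
rewrite [RHS](partition_big (fun s => outer_edge s) (fun F => F \in edges Th)) //= => s _.
exact: outer_edge_in.
Qed.

Lemma sum_div0 : (forall F, F \in edges Th -> forall p, hull F p -> jump n F (comp_n n F v) p = 0) ->
  \sum_K area_int (cell K) (dive (v K)) = 0.
Proof.
move=> Hj.
pose G s := if outward (n (outer_edge s)) s
  then edge_int (outer_edge s) (comp_n n (outer_edge s) v s)
  else - edge_int (outer_edge s) (comp_n n (outer_edge s) v s).
have divE K : area_int (cell K) (dive (v K)) = \sum_i G (K, i).
  have D0 : orient (apex K 0) (apex K 1) (apex K 2%:R) != 0.
    by have := apex_orient_neq0 HT 0 K; rewrite !ord3_addE.
  have := triangle_divergence (pv K) D0.
  have cE : cell K = conv [:: apex K 0; apex K 1; apex K 2%:R].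
    by rewrite (apex_cell 0) !ord3_addE.
  rewrite -cE => H.
  have sg2 : Num.sg (orient (apex K 0) (apex K 1) (apex K 2%:R)) * Num.sg (orient (apex K 0) (apex K 1) (apex K 2%:R)) = 1 :> R.
    by rewrite -sgrM gtr0_sg // -expr2 exprn_even_gt0.
  transitivity (Num.sg (orient (apex K 0) (apex K 1) (apex K 2%:R)) *
     (vec_flux (v K) (apex K 0) (apex K 1) + vec_flux (v K) (apex K 1) (apex K 2%:R) +
      vec_flux (v K) (apex K 2%:R) (apex K 0))).
    by rewrite -H mulrA sg2 mul1r.
  have sum3 (g : 'I_3 -> R) : \sum_i g i = g 2%:R + g 0 + g 1.
    rewrite !big_ord_recl big_ord0 addr0 addrA [LHS]addrC addrA;
      congr (g _ + g _ + g _); apply/val_inj => //.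
  rewrite sum3 /G -!signed_flux -!mulrDr; congr (_ * (_ + _ + _));
    by rewrite /edge_start /edge_end /= !ord3_addE.
under eq_bigr do rewrite divE.
rewrite pair_big /=.
transitivity (\sum_s G s).
  by apply: eq_bigr => -[K i] _.
rewrite -sum_by_edge; apply: big1 => F FE.
(* The outflows of the two neighbours through F combine to the integral of the jump of v . n. On a
   boundary edge the jump is the trace itself and vanishes as well. *)
transitivity (jump n F (fun s _ => edge_int F (comp_n n F v s)) 0).
  rewrite -(jump_const _ _ 0); apply: eq_bigr => s /eqP <- //.
have [s [sF so [outE inE']]] := edge_cases HT Hn FE.
have Hj' := Hj F FE.
transitivity (edge_int F (jump n F (comp_n n F v))); last first.
  by rewrite edge_intE (edge_mean_eq FE Hj') edge_mean0 mulr0.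
rewrite [in LHS]/jump outE !edge_intE.
case: inE' => [[_ in0]|[s' [_ _ inE'']]].
  rewrite in0 subr0; congr (_ * edge_mean F _); apply/funext => p.
  by rewrite /jump outE in0 subr0.
rewrite inE'' /= ?edge_intE -mulrBr; congr (_ * _).
rewrite -(edge_meanB _ (comp_dir_poly s.1 (n F)) (comp_dir_poly s'.1 (n F))).
by congr edge_mean; apply/funext => p; rewrite /jump outE inE''.
Qed.

End field.
End Edges.

(** * Oscillation of the tangential jump *)

Section Jumps.
Context {R : realType}.
Variables (Th : mesh R) (Omega : set (R * R)) (n : {set node Th} -> R * R) (kappa C : R) (k : nat).
Hypotheses (HT : triangulation Th Omega) (Hn : edge_normal Omega n) (kappa0 : 0 < kappa)
  (C0 : 0 < C).
Local Notation h := (mesh_size Th).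
Local Notation mu := (@lebesgue_measure R).
Hypothesis Hdisc : forall K : elt Th, exists c0, forall p,
  enorm (p - c0) <= kappa * h -> cell K p.
Hypothesis HC : forall (s : sub_elt Th) f p, is_poly k.-1 f -> cell s.1 p ->
      f p ^+ 2 <= C / h ^+ 2 * area_int (sub_cell s) (fun q => f q ^+ 2).
Implicit Types (K : elt Th) (s : sub_elt Th) (F : {set node Th}).
Variable v : elt Th -> R * R -> R * R.
Hypothesis pv : forall K, poly_field k (v K).

(** The mean value theorem along the edge: the length contributes at most h^2 to the square of the
    difference and the inverse estimate for t^T eps(v) t contributes C / h^2, so no power of h is
    left. *)
Lemma comp_t_osc s p q : hull (outer_edge s) p -> hull (outer_edge s) q ->
  (comp_t n (outer_edge s) v s p - comp_t n (outer_edge s) v s q) ^+ 2 <= C * energy v s.1.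
Proof.
case: s => K i; set s := (K, i); set F := outer_edge s.
rewrite {1 2}/F outer_edgeE !(hull2P _ (outer_edge_neq HT K i)).
set Y := coord (vert K (i + 1)); set Z := coord (vert K (i + 2%:R)).
move=> [x [x01 ->]] [y [y01 ->]].
wlog yx : x y x01 y01 / y <= x.
  move=> H; have [yx|/ltW xy] := leP y x; first exact: H.
  by rewrite -[X in X <= _]sqrrN opprB; exact: H.
have [c0 disc] := Hdisc K; have h0 := mesh_size_gt0 HT K.
have yF : vert K (i + 1) \in F by rewrite /F outer_edgeE !inE eqxx.
have zF : vert K (i + 2%:R) \in F by rewrite /F outer_edgeE !inE eqxx orbT.
have n1 := normal_unit Hn s; have nyz : dot (n F) (Z - Y) = 0 := normal_orth Hn zF yF.
have n11 : dot (n F) (n F) = 1 by rewrite -enorm_sqr n1 expr1n.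
set tau := dot (Z - Y) (tangent (n F)).
have tau2 : tau ^+ 2 <= h ^+ 2.
  rewrite /tau (normal_edge_length n1 nyz) -enorm_le; last exact: ltW h0.
  by have /andP[] := edge_length HT kappa0 Hdisc s.
have uE : Z - Y = tau *: tangent (n F) := orth_tangent n11 nyz.
have [g [pg gpd gE]] := poly_field_grad (pv K).
have [_ _ Hl0] := gpd ord0; have [L0 [_ L0E dL0]] := Hl0 Y (Z - Y).
have [_ _ Hl1] := gpd ord_max; have [L1 [_ L1E dL1]] := Hl1 Y (Z - Y).
pose P := (n F).2 *: L0 - (n F).1 *: L1.
have PE c : P.[c] = comp_t n F v s ((1 - c) *: Y + c *: Z).
  rewrite segment_line /P hornerD hornerN !hornerZ L0E L1E /comp_t /dot /component /tangent /=.
  by ring.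
(* This is t^T eps(v) t: together with n^T eps(v) n it adds up to the divergence, and their
   difference is [strain_normal]. *)
pose ett p := (dive (v K) p + strain_normal (n F) (v K) p) / 2.
have dPE c : P^`().[c] = tau * ett (Y + c *: (Z - Y)).
  rewrite /P derivB !derivZ hornerD hornerN !hornerZ dL0 dL1.
  set w := Y + _; rewrite uE /= !scale_regE.
  rewrite /ett /strain_normal /strain_diff /strain_shear /dive /mxtrace sum_ord2.
  rewrite [eps (v K) w]/eps.
  have e (A : 'M[R]_2) i' j' : (2^-1 *: (A + A^T)) i' j' = (A i' j' + A j' i') / 2.
    by rewrite !mxE mulrC.
  rewrite !e !gE.
  transitivity (tau * ((g ord0 ord0 w + g ord_max ord_max w) * dot (n F) (n F) +
     (((n F).2 ^+ 2 - (n F).1 ^+ 2) * (g ord0 ord0 w - g ord_max ord_max w)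
      - 2 * (n F).1 * (n F).2 * (g ord0 ord_max w + g ord_max ord0 w))) / 2).
    by rewrite /dot; field.
  by rewrite n11; field.
have ett_poly : is_poly k.-1 ett.
  have -> : ett = fun p => 2^-1 * (dive (v K) p + strain_normal (n F) (v K) p).
    by apply/funext => p'; rewrite /ett mulrC.
  apply: is_polyZ; apply: is_polyD; first exact: dive_poly_field.
  exact: strain_normal_poly.
have ett_le w : ett w ^+ 2 <= frob (eps (v K) w) (eps (v K) w).
  rewrite frob_eps /ett.
  have h3 := strain_normal_tangent (v K) w n11; move: h3.
  set T := dive _ _; set N := strain_normal _ _ _; set S := strain_tangent _ _ _.
  set X := strain_diff _ _; set W := strain_shear _ _ => h3.
  have -> : T ^+ 2 + X ^+ 2 + W ^+ 2 = T ^+ 2 + (N ^+ 2 + S ^+ 2) by rewrite h3; ring.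
  have -> : (T ^+ 2 + (N ^+ 2 + S ^+ 2)) / 2 = ((T + N) / 2) ^+ 2 + ((T - N) / 2) ^+ 2 + S ^+ 2 / 2.
    by field.
  by rewrite -addrA lerDl addr_ge0 ?divr_ge0 ?sqr_ge0.
have ett_sup c : y < c < x -> ett (Y + c *: (Z - Y)) ^+ 2 <= C / h ^+ 2 * energy v K.
  move=> /andP[yc cx].
  have Kc : cell K (Y + c *: (Z - Y)).
    rewrite -segment_line (apex_cell i) conv3P; exists 0, (1 - c), c.
    case/andP: x01 => x0 x1; case/andP: y01 => y0 y1.
    split; [lra..|by rewrite scale0r add0r].
  apply: (le_trans (HC (s := s) ett_poly Kc)).
  have h2 : 0 < C / h ^+ 2 by rewrite divr_gt0 // exprn_gt0.
  rewrite ler_pM2l //; apply: le_trans (sub_energy_le HT pv s).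
  apply: area_int_le => //; first exact: tame_sub HT s.
  - by apply: tameX; exact: tame_poly ett_poly.
  - have te i' j' : tame (fun p => eps (v K) p i' j') by exact: tame_poly (eps_poly (pv K) i' j').
    by under eq_fun do rewrite frobE; do !apply: tameD; apply: tameM; exact: te.
rewrite -!PE; move: yx; rewrite le_eqVlt => /orP[/eqP ->|yx].
  by rewrite subrr expr0n /=; apply: mulr_ge0; [exact: ltW|exact: energy_ge0].
have [c cI ->] : exists2 c, c \in `]y, x[%R & P.[x] - P.[y] = P^`().[c] * (x - y).
  apply: (@MVT _ (horner P) (horner P^`())) => //.
  by apply: continuous_subspaceT; exact: continuous_horner.
rewrite dPE; move: cI; rewrite in_itv /= => /ett_sup ec.
have xy1 : (x - y) ^+ 2 <= 1.
  case/andP: x01 => x0 x1; case/andP: y01 => y0 y1.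
  by rewrite expr_le1 //; lra.
rewrite exprMn [X in X * _]exprMn.
have E0 : 0 <= energy v K by exact: energy_ge0.
have h2 : 0 < h ^+ 2 by rewrite exprn_gt0.
have -> : C * energy v K = h ^+ 2 * (C / h ^+ 2 * energy v K) * 1.
  by field; rewrite gt_eqF.
apply: ler_pM => //; [by apply: mulr_ge0; exact: sqr_ge0|exact: sqr_ge0|].
by apply: ler_pM => //; exact: sqr_ge0.
Qed.

Lemma jump_poly F : F \in edges Th -> is_poly k (jump n F (comp_t n F v)).
Proof.
move=> FE; have [s [_ _ [outE [[_ in0]|[s' [_ _ inE']]]]]] := edge_cases HT Hn FE.
  have -> : jump n F (comp_t n F v) = comp_t n F v s.
    by apply/funext => p; rewrite /jump outE in0 subr0.
  exact: comp_dir_poly.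
have -> : jump n F (comp_t n F v) = fun p => comp_t n F v s p - comp_t n F v s' p.
  by apply/funext => p; rewrite /jump outE inE'.
by apply: is_polyB; exact: comp_dir_poly.
Qed.

Lemma jump_osc F p q : F \in edges Th -> hull F p -> hull F q ->
  (jump n F (comp_t n F v) p - jump n F (comp_t n F v) q) ^+ 2 <=
  2 * C * \sum_(s | outer_edge s == F) energy v s.1.
Proof.
move=> FE Fp Fq; have [s [sF _ [outE inC]]] := edge_cases HT Hn FE.
rewrite (sum_traces n F (fun s => energy v s.1) 0) /jump !outE.
have E0 (s' : sub_elt Th) : 0 <= energy v s'.1 by exact: energy_ge0.
have osc s' : outer_edge s' = F -> (comp_t n F v s' p - comp_t n F v s' q) ^+ 2 <= C * energy v s'.1.
  by move=> e; rewrite -e; apply: comp_t_osc; rewrite e.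
have h1 := osc s sF.
case: inC => [[_ in0]|[s' [s'F _ inE']]].
  rewrite !in0 !subr0 addr0; apply: (le_trans h1).
  rewrite -mulrA; apply: ler_peMl; last by rewrite ler1n.
  by apply: mulr_ge0 => //; exact: ltW.
have h2 := osc s' s'F; rewrite !inE' /=.
set a := comp_t _ _ _ s p in h1 *; set b := comp_t _ _ _ s q in h1 *.
set c := comp_t _ _ _ s' p in h2 *; set d := comp_t _ _ _ s' q in h2 *.
have -> : a - c - (b - d) = (a - b) - (c - d) by ring.
apply: (@le_trans _ _ (2 * (a - b) ^+ 2 + 2 * (c - d) ^+ 2)).
  have -> : 2 * (a - b) ^+ 2 + 2 * (c - d) ^+ 2 =
      (a - b - (c - d)) ^+ 2 + (a - b + (c - d)) ^+ 2 by ring.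
  by rewrite lerDl sqr_ge0.
rewrite -mulrDr -[leRHS]mulrA.
apply: (ler_wpM2l (ler0n R 2)).
rewrite [leRHS]mulrDr.
by apply: lerD; [exact: h1|exact: h2].
Qed.

(** Pointwise, J^2 <= 2 m^2 + 2 (J - m)^2, and the deviation from the mean m is at most the
    oscillation, whose square is bounded by [jump_osc]. *)
Lemma jump_mean F : F \in edges Th ->
  edge_mean F (fun p => jump n F (comp_t n F v) p ^+ 2) <=
  2 * edge_mean F (jump n F (comp_t n F v)) ^+ 2 +
  4 * C * \sum_(s | outer_edge s == F) energy v s.1.
Proof.
move=> FE; set J := jump n F (comp_t n F v); have pJ : is_poly k J := jump_poly FE.
set W := \sum_(s | _) _.
have W0 : 0 <= W by apply: sumr_ge0 => s _; exact: energy_ge0.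
have osc p q : hull F p -> hull F q -> (J p - J q) ^+ 2 <= 2 * C * W.
  by move=> Fp Fq; apply: jump_osc.
move: (FE) => /imsetP[s _ sF]; have [y [z [eE FE' yz _]]] := edge_enum HT s.
rewrite -sF in eE FE'; set a := coord y; set b := coord z.
have [f1 [f2 [_ _ Hl]]] := is_poly_partials pJ.
have [L [_ LE _]] := Hl a (b - a).
have JE x : J ((1 - x) *: a + x *: b) = L.[x] by rewrite LE segment_line.
rewrite /edge_mean eE -/a -/b.
have -> : \int[mu]_(x in `[0, 1]) J ((1 - x) *: a + x *: b) = \int[mu]_(x in `[0, 1]) L.[x].
  by apply: eq_Rintegral => x _; rewrite JE.
have -> : \int[mu]_(x in `[0, 1]) J ((1 - x) *: a + x *: b) ^+ 2 =
    \int[mu]_(x in `[0, 1]) (L ^+ 2).[x].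
  by apply: eq_Rintegral => x _; rewrite JE horner_exp.
set m := \int[mu]_(x in _) L.[x].
have osc' x x' : 0 <= x <= 1 -> 0 <= x' <= 1 -> `|L.[x] - L.[x']| <= Num.sqrt (2 * C * W).
  move=> x01 x01'; rewrite -sqrtr_sqr ler_wsqrtr // -!JE; apply: osc.
    by rewrite FE' (hull2P _ yz); exists x.
  by rewrite FE' (hull2P _ yz); exists x'.
set w := Num.sqrt _ in osc'.
have w2 : w ^+ 2 = 2 * C * W by rewrite sqr_sqrtr // !mulr_ge0 // ltW.
have int_cst (c : R) : \int[mu]_(x in `[0, 1]) c%:P.[x] = c.
  have -> : c%:P = (c *: 'X)^`() by rewrite derivZ derivX alg_polyC.
  by rewrite int_deriv // !hornerZ !hornerX mulr1 mulr0 subr0.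
have mono (A B : {poly R}) : (forall x, 0 <= x <= 1 -> A.[x] <= B.[x]) ->
    \int[mu]_(x in `[0, 1]) A.[x] <= \int[mu]_(x in `[0, 1]) B.[x].
  move=> AB; apply: le_Rintegral;
    [by []|exact: horner_integrable|exact: horner_integrable|].
  by move=> x; rewrite /= in_itv /=; exact: AB.
(* The mean averages values that all differ from [L.[x]] by at most w. *)
have Lm x : 0 <= x <= 1 -> `|L.[x] - m| <= w.
  move=> x01; rewrite ler_norml; apply/andP; split.
    rewrite lerBrDr addrC lerBlDr -[leRHS]int_cst; apply: mono => x' x01'.
    rewrite hornerC; have := osc' _ _ x01' x01; rewrite ler_norml => /andP[_]; lra.
  rewrite lerBlDl addrC -lerBlDl -[leLHS]int_cst; apply: mono => x' x01'.
  rewrite hornerC; have := osc' _ _ x01 x01'; rewrite ler_norml => /andP[_]; lra.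
have -> : 2 * m ^+ 2 + 4 * C * W = 2 * m ^+ 2 + 2 * w ^+ 2 by rewrite w2; ring.
rewrite -[leRHS]int_cst; apply: mono => x /Lm Lx.
have : (L.[x] - m) ^+ 2 <= w ^+ 2.
  by rewrite -[leLHS]real_normK ?num_real // ler_sqr ?nnegrE ?sqrtr_ge0.
rewrite hornerC horner_exp => h.
have := sqr_ge0 (L.[x] - m - m).
have -> : L.[x] ^+ 2 = 2 * (L.[x] - m) ^+ 2 + 2 * m ^+ 2 - (L.[x] - m - m) ^+ 2 by ring.
move: h; set A := (L.[x] - m) ^+ 2; set B := (_ - m) ^+ 2; set D := w ^+ 2; set G := m ^+ 2; lra.
Qed.
End Jumps.

(** * The inf-sup condition *)

Section InfSup.
Context {R : realType}.
Variables (Th : mesh R) (Omega : set (R * R)) (n : {set node Th} -> R * R) (kappa C : R) (k : nat).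
Hypotheses (HT : triangulation Th Omega) (Hn : edge_normal Omega n) (kappa0 : 0 < kappa)
  (C0 : 0 < C).
Local Notation h := (mesh_size Th).
Hypothesis Hdisc : forall K : elt Th, exists c0, forall p,
  enorm (p - c0) <= kappa * h -> cell K p.
Hypothesis HC : forall (s : sub_elt Th) f p, is_poly k.-1 f -> cell s.1 p ->
      f p ^+ 2 <= C / h ^+ 2 * area_int (sub_cell s) (fun q => f q ^+ 2).
Implicit Types (K : elt Th) (s : sub_elt Th) (F : {set node Th}).
Variable v : elt Th -> R * R -> R * R.
Hypothesis Hv : V_h n k v.

Let pv K : poly_field k (v K). Proof. exact: Hv.1. Qed.
Let n1 s : dot (n (outer_edge s)) (n (outer_edge s)) = 1.
Proof. by rewrite -enorm_sqr (normal_unit Hn) expr1n. Qed.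
Let t_normal2 s : tame (fun p => strain_normal (n (outer_edge s)) (v s.1) p ^+ 2).
Proof. by apply: tameX; exact: tame_poly (strain_normal_poly (pv s.1) _). Qed.
Let t_tangent s : tame (strain_tangent (n (outer_edge s)) (v s.1)).
Proof. exact: tame_poly (strain_tangent_poly (pv s.1) _). Qed.

(* With t the tangent of m: alpha (t m^T + m t^T) + beta (t t^T - m m^T). *)
Definition edge_stress (m : R * R) (alpha beta : R) : 'M[R]_2 :=
  stress (alpha * (2 * m.1 * m.2) + beta * (m.2 ^+ 2 - m.1 ^+ 2))
         (alpha * (m.2 ^+ 2 - m.1 ^+ 2) - beta * (2 * m.1 * m.2)).

(** The coefficients are left free for two uses: scaled mean jumps with c = 1 for the estimate, and
    a constant alpha with c = 0 when the norm of v vanishes. *)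
Definition test_stress (alpha : {set node Th} -> R) (c : R) s (p : R * R) : 'M[R]_2 :=
  edge_stress (n (outer_edge s)) (alpha (outer_edge s))
    (- c * strain_normal (n (outer_edge s)) (v s.1) p).

Variables (alpha : {set node Th} -> R) (c : R).
Let tau := test_stress alpha c.

Lemma test_stress_eps s p : frob (tau s p) (eps (v s.1) p) =
  alpha (outer_edge s) * strain_tangent (n (outer_edge s)) (v s.1) p -
  c * strain_normal (n (outer_edge s)) (v s.1) p ^+ 2.
Proof.
rewrite frob_stress -/(strain_diff _ _) -/(strain_shear _ _).
by rewrite /strain_normal /strain_tangent; ring.
Qed.

Lemma test_stress_sqr s p : frob (tau s p) (tau s p) =
  2 * alpha (outer_edge s) ^+ 2 +
  2 * c ^+ 2 * strain_normal (n (outer_edge s)) (v s.1) p ^+ 2.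
Proof.
rewrite /tau /test_stress; set m := n _; set a := alpha _; set q := strain_normal _ _ _.
rewrite frob_stress !mxE /=.
transitivity (2 * (a ^+ 2 + (c * q) ^+ 2) * dot m m ^+ 2).
  by rewrite /dot; ring.
by rewrite n1; ring.
Qed.

(** The beta part has no nt component, so the value depends on the edge only and is the same from
    both sides. *)
Lemma test_stress_nt s p : dot (tangent (n (outer_edge s))) (mxact (tau s p) (n (outer_edge s))) =
  alpha (outer_edge s).
Proof.
rewrite stress_nt; set m := n _; set a := alpha _.
transitivity (a * dot m m ^+ 2); first by rewrite /dot; ring.
by rewrite n1; ring.
Qed.

Lemma test_stress_trace F p : F \in edges Th -> trace_out n F (comp_nt n F tau) p = alpha F.
Proof.
move=> FE; have [s [<- _ [outE _]]] := edge_cases HT Hn FE.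
by rewrite outE /comp_nt test_stress_nt.
Qed.

Lemma test_stress_Sigma : Sigma_h n Omega k.-1 tau.
Proof.
split.
- move=> s i j.
  have pq := strain_normal_poly (pv s.1) (n (outer_edge s)).
  have pb : is_poly k.-1 (fun p => - c * strain_normal (n (outer_edge s)) (v s.1) p) by exact: is_polyZ.
  set m := n (outer_edge s); set a := alpha (outer_edge s).
  have px (x y : R) : is_poly k.-1 (fun p => a * x + (- c * strain_normal m (v s.1) p) * y).
    have -> : (fun p => a * x + (- c * strain_normal m (v s.1) p) * y) =
              (fun p => a * x + y * (- c * strain_normal m (v s.1) p)).
      by apply/funext => p; ring.
    by apply: is_polyD; [exact: is_polyC|exact: is_polyZ].
  have E : (fun p => tau s p i j) = fun p =>
    if i == j then (if i == ord0 then a * (2 * m.1 * m.2) + (- c * strain_normal m (v s.1) p) * (m.2 ^+ 2 - m.1 ^+ 2)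
       else a * (- (2 * m.1 * m.2)) + (- c * strain_normal m (v s.1) p) * (- (m.2 ^+ 2 - m.1 ^+ 2)))
    else a * (m.2 ^+ 2 - m.1 ^+ 2) + (- c * strain_normal m (v s.1) p) * (- (2 * m.1 * m.2)).
    apply/funext => p; rewrite /tau /test_stress /edge_stress !mxE -/m -/a.
    by case: ifP => _; [case: ifP => _|]; ring.
  by rewrite E; case: (i == j); [case: (i == ord0)|]; exact: px.
- move=> s p; apply/matrixP => i j; rewrite !mxE eq_sym.
  by case: eqP => // ->.
- by move=> s p; rewrite /mxtrace sum_ord2 !mxE /= subrr.
- move=> F [FE nF] p _.
  rewrite /jump (test_stress_trace _ FE).
  have [s [_ _ [_ [[bF _]|[s' [<- _ inE']]]]]] := edge_cases HT Hn FE; first by [].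
  by rewrite inE' /comp_nt test_stress_nt subrr.
Qed.

Lemma b2_test_stress : b2 n tau v =
  c * (\sum_s normal_energy n v s) - \sum_s alpha (outer_edge s) * tangent_mean n v s +
  \sum_(F in edges Th) alpha F * (edge_len F * edge_mean F (jump n F (comp_t n F v))).
Proof.
rewrite /b2; congr (_ + _).
  rewrite pair_big /= -[LHS]opprK; rewrite opprK.
  transitivity (- \sum_s (alpha (outer_edge s) * tangent_mean n v s - c * normal_energy n v s)).
    congr (- _); apply: eq_bigr => -[K i] _; set s := (K, i).
    have tS := tame_sub HT s.
    transitivity (area_int (sub_cell s) (fun p =>
       alpha (outer_edge s) * strain_tangent (n (outer_edge s)) (v s.1) p +
       (- c) * strain_normal (n (outer_edge s)) (v s.1) p ^+ 2)).
      congr area_int; apply/funext => p; rewrite (test_stress_eps s p); ring.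
    rewrite area_intD //; [|by apply: tameZ|by apply: tameZ].
    by rewrite !area_intZ // mulNr.
  by rewrite sumrB opprB mulr_sumr.
apply: eq_bigr => F FE; rewrite edge_intE mulrCA; congr (_ * _).
rewrite -(edge_meanZ F (alpha F) (jump_poly HT Hn pv FE)).
by congr edge_mean; apply/funext => p; rewrite (test_stress_trace _ FE).
Qed.

Lemma norm_Sigma_test : norm_Sigma tau ^+ 2 = \sum_s area_int (sub_cell s) (fun p =>
  2 * alpha (outer_edge s) ^+ 2 + 2 * c ^+ 2 * strain_normal (n (outer_edge s)) (v s.1) p ^+ 2).
Proof.
have E : \sum_s area_int (sub_cell s) (fun p => frob (tau s p) (tau s p)) =
  \sum_s area_int (sub_cell s) (fun p =>
  2 * alpha (outer_edge s) ^+ 2 + 2 * c ^+ 2 * strain_normal (n (outer_edge s)) (v s.1) p ^+ 2).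
  by apply: eq_bigr => s _; congr area_int; apply/funext => p; exact: test_stress_sqr.
rewrite /norm_Sigma E sqr_sqrtr //; apply: sumr_ge0 => s _; apply: area_int_ge0 => p _.
apply: addr_ge0; first exact: mulr_ge0 (ler0n _ 2) (sqr_ge0 _).
exact: mulr_ge0 (mulr_ge0 (ler0n _ 2) (sqr_ge0 _)) (sqr_ge0 _).
Qed.

Lemma norm_Sigma_test_le : norm_Sigma tau ^+ 2 <=
  \sum_s (8 * (h * alpha (outer_edge s)) ^+ 2 + 2 * c ^+ 2 * normal_energy n v s).
Proof.
rewrite norm_Sigma_test; apply: ler_sum => s _; have tS := tame_sub HT s.
rewrite area_intD //; [|exact: tameC|exact: tameZ].
rewrite (area_intZ (2 * c ^+ 2) tS (t_normal2 s)) lerD2r.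
have -> : 8 * (h * alpha (outer_edge s)) ^+ 2 = 4 * h ^+ 2 * (2 * alpha (outer_edge s) ^+ 2) by ring.
apply: (cell_int_ub HT tS.1 (@sub_cell_subset _ _ s)) => //; last exact: tameC.
by rewrite mulr_ge0 ?sqr_ge0.
Qed.

(** The inverse estimate for a constant function bounds the area of a subtriangle below by h^2 / C.
    The resulting bound serves to prove that the denominator is not zero. *)
Lemma norm_Sigma_test_ge :
  \sum_s (2 / C * (h * alpha (outer_edge s)) ^+ 2 + 2 * c ^+ 2 * normal_energy n v s) <=
  norm_Sigma tau ^+ 2.
Proof.
rewrite norm_Sigma_test; apply: ler_sum => s _; have tS := tame_sub HT s.
rewrite area_intD //; [|exact: tameC|exact: tameZ].
rewrite (area_intZ (2 * c ^+ 2) tS (t_normal2 s)) lerD2r; set a := alpha _.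
have h0 := mesh_size_gt0 HT s.1; have h2 : 0 < h ^+ 2 by rewrite exprn_gt0.
have := HC (s := s) (f := fun=> a) (is_polyC _ a) (apex_in_cell s.1 0).
set I := area_int _ _ => aI.
have -> : area_int (sub_cell s) (fun=> 2 * a ^+ 2) = 2 * I by rewrite /I area_intZ //; exact: tameC.
have -> : 2 / C * (h * a) ^+ 2 = 2 * (h ^+ 2 / C * a ^+ 2) by field; rewrite gt_eqF.
rewrite ler_pM2l //.
have -> : I = h ^+ 2 / C * (C / h ^+ 2 * I) by field; rewrite !gt_eqF.
by rewrite ler_pM2l // divr_gt0.
Qed.
End InfSup.

Section Bound.
Context {R : realType}.
Variables (Th : mesh R) (Omega : set (R * R)) (n : {set node Th} -> R * R) (kappa C : R) (k : nat).
Hypotheses (HT : triangulation Th Omega) (Hn : edge_normal Omega n) (kappa0 : 0 < kappa)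
  (C0 : 0 < C).
Local Notation h := (mesh_size Th).
Hypothesis Hdisc : forall K : elt Th, exists c0, forall p,
  enorm (p - c0) <= kappa * h -> cell K p.
Hypothesis HC : forall (s : sub_elt Th) f p, is_poly k.-1 f -> cell s.1 p ->
      f p ^+ 2 <= C / h ^+ 2 * area_int (sub_cell s) (fun q => f q ^+ 2).
Implicit Types (K : elt Th) (s : sub_elt Th) (F : {set node Th}).
Variable v : elt Th -> R * R -> R * R.
Hypothesis Hv : V_h n k v.

Let pv K : poly_field k (v K). Proof. exact: Hv.1. Qed.

(** The jump part of the square of [norm_V] with every jump replaced by its mean over the edge. *)
Definition jump_mean_energy : R := \sum_(F in edges Th)
  h^-1 * edge_len F * edge_mean F (jump n F (comp_t n F v)) ^+ 2.

Let E := \sum_K energy v K.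
Let D := \sum_K div_energy v K.
Let B := \sum_s normal_energy n v s.
Let J := jump_mean_energy.
Let m F := edge_mean F (jump n F (comp_t n F v)).

Lemma edge_len_bound F : F \in edges Th -> 2 * kappa <= h^-1 * edge_len F <= 1.
Proof.
move=> /imsetP[s _ ->]; rewrite (edge_lenE HT).
have /andP[h1 h2] := edge_length HT kappa0 Hdisc s.
have h0 := mesh_size_gt0 HT s.1.
by rewrite [h^-1 * _]mulrC ler_pdivlMr // ler_pdivrMr // mul1r h1 h2.
Qed.

Lemma sum_elt_sub (g : elt Th -> R) : \sum_(s : sub_elt Th) g s.1 = 3 * \sum_K g K.
Proof.
rewrite -(pair_bigA _ (fun K (i : 'I_3) => g K)) /= mulr_sumr.
by apply: eq_bigr => K _; rewrite sumr_const card_ord mulr_natl.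
Qed.

Lemma total_energy_le : E <= D / 2 + C / kappa ^+ 2 * B.
Proof.
rewrite /B -(pair_bigA _ (fun K i => normal_energy n v (K, i))) /=.
rewrite /D mulr_suml mulr_sumr -big_split /=; apply: ler_sum => K _.
exact: (energy_le HT Hn kappa0 C0 Hdisc HC pv).
Qed.

(** In 12 C, the 4 C comes from [jump_mean] and the 3 from counting each element once for each of
    its edges. *)
Lemma norm_V_le : norm_V n v ^+ 2 <= (1 + 12 * C) * E + 2 * J.
Proof.
have e0 F : 0 <= edge_mean F (fun p => jump n F (comp_t n F v) p ^+ 2).
  rewrite /edge_mean; case: (enum F) => [|y [|z []]] //.
  by apply: Rintegral_ge0 => x _; exact: sqr_ge0.
rewrite /norm_V -/(energy v _) sqr_sqrtr; last first.
  apply: addr_ge0; first by apply: sumr_ge0 => K _; exact: energy_ge0.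
  apply: sumr_ge0 => F FE; rewrite edge_intE mulrA mulr_ge0 //.
  have /andP[h1 _] := edge_len_bound FE; apply: le_trans h1; rewrite mulr_ge0 // ltW //.
have -> : (1 + 12 * C) * E + 2 * J = E + (2 * J + 4 * C * (3 * E)) by ring.
rewrite lerD2l.
apply: (@le_trans _ _ (\sum_(F in edges Th) (2 * (h^-1 * edge_len F * m F ^+ 2) +
    4 * C * \sum_(s | outer_edge s == F) energy v s.1))).
  apply: ler_sum => F FE; rewrite edge_intE [leLHS]mulrA.
  have := jump_mean HT Hn kappa0 C0 Hdisc HC pv FE; rewrite -/(m F).
  set W := \sum_(s | _) _; have W0 : 0 <= W by apply: sumr_ge0 => s _; exact: energy_ge0.
  have /andP[h1 h2] := edge_len_bound FE; have l0 : 0 <= h^-1 * edge_len F.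
    by apply: le_trans h1; rewrite mulr_ge0 // ltW.
  move=> H; apply: (le_trans (ler_wpM2l l0 H)).
  rewrite mulrDr mulrCA lerD2l; apply: ler_piMl => //.
  by apply: mulr_ge0 => //; apply: mulr_ge0 => //; exact: ltW.
rewrite big_split /= -!mulr_sumr lerD2l sum_by_edge //.
by rewrite (sum_elt_sub (energy v)).
Qed.

End Bound.

(** * Choice of the constants and conclusion *)

Section Final.
Context {R : realType}.
Variables (Th : mesh R) (Omega : set (R * R)) (n : {set node Th} -> R * R) (kappa C : R) (k : nat).
Hypotheses (HT : triangulation Th Omega) (Hn : edge_normal Omega n) (kappa0 : 0 < kappa)
  (C0 : 0 < C).
Local Notation h := (mesh_size Th).
Hypothesis Hdisc : forall K : elt Th, exists c0, forall p,
  enorm (p - c0) <= kappa * h -> cell K p.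
Hypothesis HC : forall (s : sub_elt Th) f p, is_poly k.-1 f -> cell s.1 p ->
      f p ^+ 2 <= C / h ^+ 2 * area_int (sub_cell s) (fun q => f q ^+ 2).
Implicit Types (K : elt Th) (s : sub_elt Th) (F : {set node Th}).
Variable v : elt Th -> R * R -> R * R.
Hypothesis Hv : V_h n k v.

Let pv K : poly_field k (v K). Proof. exact: Hv.1. Qed.

Let E := \sum_K energy v K.
Let D := \sum_K div_energy v K.
Let B := \sum_s normal_energy n v s.
Let J := jump_mean_energy n v.
Let m F := edge_mean F (jump n F (comp_t n F v)).
Let q K := dive (v K).
(** Chosen so that [total_energy_le] gives E <= c2 (D + B). *)
Let c2 : R := 1 / 2 + C / kappa ^+ 2.
Let delta : R := kappa / (24 * c2).
Let tau := test_stress n v (fun F => delta * h^-1 * m F) 1.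

Let c20 : 0 < c2.
Proof. by rewrite addr_gt0 ?divr_gt0 // exprn_gt0. Qed.
Let delta0 : 0 < delta.
Proof. by rewrite divr_gt0 // mulr_gt0. Qed.
Let E0 : 0 <= E.
Proof. by apply: sumr_ge0 => K _; exact: energy_ge0. Qed.
Let D0 : 0 <= D.
Proof. by apply: sumr_ge0 => K _; apply: area_int_ge0 => p _; exact: sqr_ge0. Qed.
Let B0 : 0 <= B.
Proof. by apply: sumr_ge0 => s _; exact: normal_energy_ge0. Qed.
Let J0 : 0 <= J.
Proof.
apply: sumr_ge0 => F FE; apply: mulr_ge0; last exact: sqr_ge0.
by have /andP[h1 _] := edge_len_bound HT kappa0 Hdisc FE; apply: le_trans h1; rewrite mulr_ge0 // ltW.
Qed.

Lemma sum_edge_sides F (x : R) : F \in edges Th -> 0 <= x ->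
  x <= \sum_(s : sub_elt Th | outer_edge s == F) x <= 2 * x.
Proof.
move=> FE x0; rewrite (sum_traces n F (fun=> x) 0).
have [s [_ _ [outE [[_ in0]|[s' [_ _ inE']]]]]] := edge_cases HT Hn FE.
  by rewrite outE in0; apply/andP; split; lra.
by rewrite outE inE'; apply/andP; split; lra.
Qed.

(** An edge is the outer edge of one or two subtriangles, and its length lies between 2 kappa h and
    h; the 2 of the two sides cancels against that of 2 kappa. *)
Lemma jump_means : J <= \sum_s m (outer_edge s) ^+ 2 <= J / kappa.
Proof.
rewrite -(sum_by_edge (fun s => m (outer_edge s) ^+ 2)).
have side F : F \in edges Th -> m F ^+ 2 <= \sum_(s | outer_edge s == F) m (outer_edge s) ^+ 2 <= 2 * m F ^+ 2.
  move=> FE; rewrite (_ : \sum_(s | _) _ = \sum_(s : sub_elt Th | outer_edge s == F) m F ^+ 2).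
    by apply: sum_edge_sides => //; exact: sqr_ge0.
  by apply: eq_bigr => s /eqP ->.
apply/andP; split.
  apply: ler_sum => F FE; have /andP[h1 _] := side F FE; apply: le_trans h1.
  have /andP[_ h2] := edge_len_bound HT kappa0 Hdisc FE.
  by rewrite -[leRHS]mul1r ler_wpM2r // sqr_ge0.
rewrite ler_pdivlMr // mulr_suml; apply: ler_sum => F FE.
have /andP[_ h1] := side F FE.
apply: (@le_trans _ _ (2 * m F ^+ 2 * kappa)); first by rewrite ler_pM2r.
have /andP[h2 _] := edge_len_bound HT kappa0 Hdisc FE.
by rewrite mulrAC ler_wpM2r // sqr_ge0.
Qed.

Let hm s : h * (delta * h^-1 * m (outer_edge s)) = delta * m (outer_edge s).
Proof. by have h0 := mesh_size_gt0 HT s.1; field; rewrite gt_eqF. Qed.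

(** Without the cross term the forms add up to D + B + delta J, with D + B >= E / c2. The cross term
    consumes half of E / c2 and half of delta J. *)
Lemma test_forms_ge : E / (2 * c2) + delta / 2 * J <= b1 v q + b2 n tau v.
Proof.
have -> : b1 v q = D.
  by apply: eq_bigr => K _; congr area_int; apply/funext => p; rewrite expr2.
rewrite /tau (b2_test_stress HT Hn Hv) mul1r.
have -> : \sum_(F in edges Th) delta * h^-1 * m F * (edge_len F * edge_mean F (jump n F (comp_t n F v))) = delta * J.
  by rewrite mulr_sumr; apply: eq_bigr => F _; rewrite -/(m F); ring.
(* This weight makes the jump part of the cross term equal to delta J / 2. Its energy part is 3 E /
   (2 eta), and delta = kappa / (24 c2) is the value for which eta = 3 c2, so that this part is E /
   (2 c2). *)
pose eta := kappa / (8 * delta).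
have eta0 : 0 < eta by rewrite divr_gt0 // mulr_gt0.
have cross : \sum_s delta * h^-1 * m (outer_edge s) * tangent_mean n v s <=
    delta / 2 * J + E / (2 * c2).
  apply: (@le_trans _ _ (\sum_s (4 * eta * delta ^+ 2 * m (outer_edge s) ^+ 2 + energy v s.1 / (2 * eta)))).
    apply: ler_sum => s _; have := tangent_mean_le HT Hn pv s (delta * h^-1 * m (outer_edge s)) eta0.
    move=> /le_trans; apply; rewrite lerD2r.
    have -> : 4 * h ^+ 2 * (eta * (delta * h^-1 * m (outer_edge s)) ^+ 2) =
      4 * eta * (h * (delta * h^-1 * m (outer_edge s))) ^+ 2 by ring.
    by rewrite hm exprMn mulrA.
  rewrite big_split /= -mulr_sumr -mulr_suml (sum_elt_sub (energy v)) -/E.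
  apply: lerD; last first.
    rewrite le_eqVlt; apply/orP; left; apply/eqP; rewrite /eta /delta; field.
    by rewrite !gt_eqF.
  have /andP[_ h1] := jump_means.
  have -> : delta / 2 * J = 4 * eta * delta ^+ 2 * (J / kappa).
    by rewrite /eta; field; rewrite !gt_eqF.
  apply: ler_wpM2l => //.
  by apply: mulr_ge0; [apply: mulr_ge0 => //; exact: ltW|exact: sqr_ge0].
have DB : E / c2 <= D + B.
  rewrite ler_pdivrMr //; apply: (le_trans (total_energy_le HT Hn kappa0 C0 Hdisc HC Hv)).
  rewrite /c2 -/D -/B; set X := C / _.
  have X0 : 0 <= X by apply: divr_ge0; [exact: ltW|exact: sqr_ge0].
  have -> : (D + B) * (1 / 2 + X) = D / 2 + X * B + (D * X + B / 2) by field.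
  by rewrite lerDl; apply: addr_ge0; apply: mulr_ge0 => //; rewrite invr_ge0.
have -> : E / (2 * c2) = E / c2 - E / (2 * c2) by field; rewrite gt_eqF.
rewrite -/B; lra.
Qed.

Lemma norm_Q_div : norm_Q q ^+ 2 = D.
Proof. by rewrite /norm_Q sqr_sqrtr. Qed.

(** With (a + b)^2 <= 2 a^2 + 2 b^2, the contributions to 28 E are 24 E from B <= 6 E and 4 E from D
    <= 2 E. *)
Lemma test_norms_le : (norm_Sigma tau + norm_Q q) ^+ 2 <= 28 * E + 16 * delta ^+ 2 / kappa * J.
Proof.
have D2E : D <= 2 * E.
  by rewrite mulr_sumr; apply: ler_sum => K _; exact: (div_energy_le HT pv).
have B6E : B <= 2 * (3 * E).
  rewrite -(sum_elt_sub (energy v)) mulr_sumr; apply: ler_sum => s _.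
  exact: (normal_energy_le HT Hn pv).
have S2 : norm_Sigma tau ^+ 2 <= 8 * delta ^+ 2 * (J / kappa) + 2 * B.
  apply: (le_trans (norm_Sigma_test_le HT Hn Hv _ _)).
  rewrite big_split /= -mulr_sumr.
  have -> : \sum_s (h * (delta * h^-1 * m (outer_edge s))) ^+ 2 = delta ^+ 2 * \sum_s m (outer_edge s) ^+ 2.
    by rewrite mulr_sumr; apply: eq_bigr => s _; rewrite hm exprMn.
  have /andP[_ h1] := jump_means.
  rewrite -mulr_sumr expr1n mulr1 -/B lerD2r mulrA.
  by apply: ler_wpM2l => //; apply: mulr_ge0 => //; exact: sqr_ge0.
have -> : 28 * E + 16 * delta ^+ 2 / kappa * J =
  2 * (8 * delta ^+ 2 * (J / kappa) + 2 * (2 * (3 * E))) + 2 * (2 * E) by ring.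
apply: (@le_trans _ _ (2 * norm_Sigma tau ^+ 2 + 2 * norm_Q q ^+ 2)).
  rewrite -subr_ge0.
  have -> : 2 * norm_Sigma tau ^+ 2 + 2 * norm_Q q ^+ 2 - (norm_Sigma tau + norm_Q q) ^+ 2 =
    (norm_Sigma tau - norm_Q q) ^+ 2 by ring.
  exact: sqr_ge0.
by rewrite norm_Q_div; lra.
Qed.

(** A vanishing test pair forces D = B = J = 0, hence E = 0, and then the norm of v is zero. The
    contrapositive makes the denominator positive. *)
Lemma test_norms_eq0 : norm_Sigma tau + norm_Q q = 0 -> norm_V n v = 0.
Proof.
have s0 : 0 <= norm_Sigma tau by exact: sqrtr_ge0.
have q0 : 0 <= norm_Q q by exact: sqrtr_ge0.
move=> S0; have sz : norm_Sigma tau = 0 by lra.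
have qz : norm_Q q = 0 by lra.
have Dz : D = 0 by rewrite -norm_Q_div qz expr0n.
have := norm_Sigma_test_ge HT Hn C0 HC Hv (fun F => delta * h^-1 * m F) 1.
rewrite -/tau sz expr0n /= big_split /= -!mulr_sumr expr1n mulr1 -/B.
have -> : \sum_s (h * (delta * h^-1 * m (outer_edge s))) ^+ 2 = delta ^+ 2 * \sum_s m (outer_edge s) ^+ 2.
  by rewrite mulr_sumr; apply: eq_bigr => s _; rewrite hm exprMn.
have /andP[h1 _] := jump_means.
have a0 : 0 < 2 / C * delta ^+ 2 by rewrite mulr_gt0 ?exprn_gt0 // divr_gt0.
rewrite mulrA => H.
have aJ : 2 / C * delta ^+ 2 * J <= 2 / C * delta ^+ 2 * \sum_s m (outer_edge s) ^+ 2 by rewrite ler_pM2l.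
have T0 : 0 <= 2 / C * delta ^+ 2 * J := mulr_ge0 (ltW a0) J0.
have B20 : 0 <= 2 * B := mulr_ge0 (ler0n R 2) B0.
have : 2 / C * delta ^+ 2 * J + 2 * B == 0.
  rewrite eq_le addr_ge0 // andbT; apply: le_trans H.
  by rewrite lerD2r.
rewrite paddr_eq0 // (mulf_eq0 _ J) (mulf_eq0 _ B) (gt_eqF a0) pnatr_eq0 /= => /andP[/eqP Jz /eqP Bz].
have Ez : E = 0.
  have := total_energy_le HT Hn kappa0 C0 Hdisc HC Hv; rewrite -/E -/D -/B Dz Bz mul0r mulr0 addr0 => Ele.
  by apply/le_anti; rewrite E0 Ele.
have := norm_V_le HT Hn kappa0 C0 Hdisc HC Hv.
rewrite -/E -/J Ez Jz !mulr0 addr0 => N0; apply/eqP.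
by rewrite -sqrf_eq0; apply/eqP/le_anti; rewrite N0 sqr_ge0.
Qed.

(** Here beta is below both coefficients 1 / (2 c2) and delta / 2 of [test_forms_ge]. The
    denominator adds the bounds of N^2 and S^2 by E + J, and the 2 comes from 2 N S <= N^2 + S^2. *)
Definition infsup_constant : R :=
  let beta := (2 * c2 + 2 / delta)^-1 in
  2 * beta / (3 + 12 * C + (28 + 16 * delta ^+ 2 / kappa)).

Lemma infsup_constant_gt0 : 0 < infsup_constant.
Proof.
have b0 : 0 < 2 * c2 + 2 / delta by rewrite addr_gt0 ?mulr_gt0 // invr_gt0.
have g0 : 0 < 3 + 12 * C + (28 + 16 * delta ^+ 2 / kappa).
  have d2 : 0 < 16 * delta ^+ 2 / kappa by rewrite divr_gt0 // mulr_gt0 // exprn_gt0.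
  by apply: addr_gt0; apply: addr_gt0 => //; apply: mulr_gt0.
by rewrite /infsup_constant divr_gt0 // mulr_gt0 // invr_gt0.
Qed.

Lemma test_pair_infsup : norm_V n v != 0 ->
  0 < norm_Sigma tau + norm_Q q /\
  infsup_constant * norm_V n v <= (b1 v q + b2 n tau v) / (norm_Sigma tau + norm_Q q).
Proof.
move=> N0; set S := norm_Sigma tau + norm_Q q; set N := norm_V n v in N0 *.
have S0 : 0 < S.
  rewrite lt_def addr_ge0 ?sqrtr_ge0 // andbT; apply: contra N0 => /eqP S0.
  by apply/eqP/test_norms_eq0.
split=> //; rewrite ler_pdivlMr //.
have b0 : 0 < 2 * c2 + 2 / delta by rewrite addr_gt0 ?mulr_gt0 // invr_gt0.
pose g := 28 + 16 * delta ^+ 2 / kappa; pose l := 3 + 12 * C.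
have d2 : 0 < 16 * delta ^+ 2 / kappa by rewrite divr_gt0 // mulr_gt0 // exprn_gt0.
have g0 : 0 < l + g.
  by rewrite /l /g; apply: addr_gt0; apply: addr_gt0 => //; apply: mulr_gt0.
have SQ : S ^+ 2 <= g * (E + J).
  apply: (le_trans test_norms_le); rewrite /g; set X := 16 * _ / _ in d2 *.
  have -> : (28 + X) * (E + J) = 28 * E + X * J + (X * E + 28 * J) by ring.
  by rewrite lerDl; apply: addr_ge0; apply: mulr_ge0 => //; exact: ltW.
have NQ : N ^+ 2 <= l * (E + J).
  apply: (le_trans (norm_V_le HT Hn kappa0 C0 Hdisc HC Hv)); rewrite -/E -/J /l.
  have -> : (3 + 12 * C) * (E + J) = (1 + 12 * C) * E + 2 * J + (2 * E + (J + 12 * (C * J))) by ring.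
  rewrite lerDl; apply: addr_ge0; first exact: mulr_ge0.
  by apply: addr_ge0 => //; apply: mulr_ge0 => //; apply: mulr_ge0 => //; exact: ltW.
have NS : 2 * (N * S) <= (l + g) * (E + J).
  have : 2 * (N * S) <= N ^+ 2 + S ^+ 2.
    rewrite -subr_ge0 (_ : _ - _ = (N - S) ^+ 2); [exact: sqr_ge0|ring].
  by rewrite mulrDl; lra.
have bQ : (E + J) / (2 * c2 + 2 / delta) <= b1 v q + b2 n tau v.
  apply: le_trans test_forms_ge; rewrite ler_pdivrMr //.
  have -> : (E / (2 * c2) + delta / 2 * J) * (2 * c2 + 2 / delta) =
    E + J + (E / (c2 * delta) + delta * c2 * J) by field; rewrite !gt_eqF.
  rewrite lerDl; apply: addr_ge0.
    by apply: divr_ge0 => //; apply: mulr_ge0; exact: ltW.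
  by apply: mulr_ge0 => //; apply: mulr_ge0; exact: ltW.
apply: le_trans bQ; rewrite /infsup_constant -/l -/g.
have -> : 2 * (2 * c2 + 2 / delta)^-1 / (l + g) * N * S =
   2 * (N * S) / (l + g) / (2 * c2 + 2 / delta) by ring.
by rewrite ler_pM2r ?invr_gt0 // ler_pdivrMr // [leRHS]mulrC.
Qed.

(** For a v of norm zero it suffices to find one nonzero admissible pair with nonnegative quotient.
    The element K guarantees that a stress which is nonzero on every subtriangle is nonzero. *)
Lemma nonneg_test_stress K : exists tau0 : sub_elt Th -> R * R -> 'M[R]_2,
  [/\ Sigma_h n Omega k.-1 tau0, ~ (forall s p, tau0 s p = 0) &
    0 <= (b1 v (fun _ : elt Th => cst 0) + b2 n tau0 v) / (norm_Sigma tau0 + norm_Q (fun _ : elt Th => cst 0))].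
Proof.
(* The form is linear in the constant a, so one of a = 1 and a = -1 makes it nonnegative; both have
   square 1, which keeps the stress nonzero. *)
pose x a := b2 n (test_stress n v (fun=> a) 0) v.
have [a [a1 xa]] : exists a, a ^+ 2 = 1 /\ 0 <= x a.
  have xN : x (-1) = - x 1.
    rewrite /x !(b2_test_stress HT Hn Hv) !mul0r !add0r.
    rewrite opprD opprK; congr (_ + _); rewrite -sumrN.
      by apply: eq_bigr => s _; ring.
    by apply: eq_bigr => F _; ring.
  have [x0|x0] := leP 0 (x 1); first by exists 1; rewrite expr1n.
  by exists (-1); rewrite sqrrN expr1n xN oppr_ge0 ltW.
exists (test_stress n v (fun=> a) 0); split.
- exact: (test_stress_Sigma HT Hn Hv).
- move=> /(_ (K, 0) 0) t0.
  have := test_stress_sqr Hn v (fun=> a) 0 (K, 0) 0.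
  rewrite t0 /frob; under eq_bigr do (under eq_bigr do rewrite mxE mul0r).
  rewrite !big1 // a1 expr0n /= mulr0 mul0r mulr1 addr0 => /eqP.
  by rewrite eq_sym pnatr_eq0.
- apply: divr_ge0; last by rewrite addr_ge0 ?sqrtr_ge0.
  apply: addr_ge0 => //.
  apply: sumr_ge0 => K' _; apply: area_int_ge0 => p _.
  by rewrite /cst mulr0.
Qed.
End Final.

Theorem theorem4p6 (R : realType) (k : nat) (Omega : set (R * R)) (sigma rho : R) :
  (1 <= k)%N ->
  domain Omega -> bounded_set Omega -> polygonal Omega -> lipschitz_boundary Omega ->
  exists2 c : R, 0 < c &
    forall (Th : mesh R) (n : {set node Th} -> R * R),
      triangulation Th Omega -> shape_regular Th sigma -> quasi_uniform Th rho ->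
      edge_normal Omega n ->
      forall v : elt Th -> R * R -> R * R, V_h n k v ->
        ((c * norm_V n v)%:E <=
         ereal_sup [set x : \bar R |
           exists (tau : sub_elt Th -> R * R -> 'M[R]_2) (q : elt Th -> R * R -> R),
             [/\ Sigma_h n Omega k.-1 tau, Q_h k.-1 q,
                 ~ ((forall s p, tau s p = 0%R) /\ (forall K p, q K p = 0%R)) &
                 x = ((b1 v q + b2 n tau v) / (norm_Sigma tau + norm_Q q))%:E]])%E.
Proof.
move=> k1 [[x0 Ox0] _ _] _ _ _.
(* Only sigma and rho enter kappa, and only k and kappa enter C: the constant is fixed before any
   mesh is introduced. *)
pose kappa : R := (4 * (1 + `|sigma|) * (1 + `|rho|))^-1.
have kappa0 : 0 < kappa by rewrite invr_gt0 !mulr_gt0 // ltr_wpDr.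
have [C C0 HC] := inverse_estimate k.-1 kappa0.
exists (infsup_constant kappa C); first exact: infsup_constant_gt0.
move=> Th n HT sr qu Hn v Hv.
have Hdisc (K : elt Th) : exists c0, forall p, enorm (p - c0) <= kappa * mesh_size Th -> cell K p.
  exact: (mesh_disc HT K sr qu).
have HC' := HC Th Omega HT Hdisc.
(* The domain is nonempty and covered by the cells, so the mesh has at least one element. *)
have [K0 _ _] : (\bigcup_(K in [set: elt Th]) cell K) x0.
  by case: HT => _ _ _ _ <-; exact: subset_closure.
suff [tau [q [St Qq nz cN]]] : exists (tau : sub_elt Th -> R * R -> 'M[R]_2) (q : elt Th -> R * R -> R),
    [/\ Sigma_h n Omega k.-1 tau, Q_h k.-1 q,
      ~ ((forall s p, tau s p = 0%R) /\ (forall K p, q K p = 0%R)) &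
      infsup_constant kappa C * norm_V n v <= (b1 v q + b2 n tau v) / (norm_Sigma tau + norm_Q q)].
  apply: le_trans (ereal_sup_ubound _); last by exists tau, q; split.
  by rewrite lee_fin.
have [N0|N0] := eqVneq (norm_V n v) 0.
  have [tau [St tn0 b0]] := nonneg_test_stress HT Hn Hv K0.
  exists tau, (fun=> cst 0); split=> //; last by rewrite N0 mulr0.
    split; first by move=> K; exact: is_polyC.
    apply: big1 => K _; rewrite /area_int Rintegral_cst ?mul0r //.
    exact: (tame_cell HT K).1.
  by case.
have [S0 bS] := test_pair_infsup HT Hn kappa0 C0 Hdisc HC' Hv N0.
move: S0 bS; set tau := test_stress _ _ _ _; set q := fun K => dive (v K) => S0 bS.
exists tau, q; split=> //.
- exact: (test_stress_Sigma HT Hn Hv).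
- split; first by move=> K; exact: dive_poly_field (Hv.1 K).
  exact: (sum_div0 HT Hn (fun K => Hv.1 K) Hv.2).
(* The sum of the norms is positive, whereas a zero pair would make it zero. *)
- move=> [t0 q0]; move: S0.
  have -> : norm_Sigma tau = 0.
    rewrite /norm_Sigma big1 ?sqrtr0 // => s _.
    rewrite (_ : (fun p => _) = fun=> 0); last first.
      apply/funext => p; rewrite t0 /frob big1 // => i _; rewrite big1 // => j _.
      by rewrite mxE mul0r.
    by rewrite /area_int Rintegral_cst ?mul0r //; exact: (tame_sub HT s).1.
  have -> : norm_Q q = 0.
    rewrite /norm_Q big1 ?sqrtr0 // => K _.
    rewrite (_ : (fun p => _) = fun=> 0); last by apply/funext => p; rewrite q0 expr0n.
    by rewrite /area_int Rintegral_cst ?mul0r //; exact: (tame_cell HT K).1.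
  by rewrite addr0 ltxx.
Qed.
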